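(* Consider the adaptive distributed estimation scheme described in the context, and assume (A.1)–(A.5) hold. Then for every $\tau_0$ with $$0\le \tau_0<\tau_1-\tau_2-\frac{1}{2+\varepsilon_1},$$ and for every pair of agents $n,l\in\{1,\dots,N\}$, $$\mathbb{P}_{\theta^*}\Big(\lim_{t\to\infty}(t+1)^{\tau_0}\,\|\mathbf{x}_n(t)-\mathbf{x}_l(t)\|=0\Big)=1.$$
   Context: There are $N$ agents indexed $n=1,\dots,N$ and an unknown deterministic parameter $\theta^*\in\mathbb{R}^M$. All random objects are defined on a probability space with filtration $\{\mathcal{F}_t\}_{t\ge 0}$; $\mathbb{P}_{\theta^*}$ and $\mathbb{E}_{\theta^*}$ denote probability and expectation. Inequalities between random variables are understood almost surely. Observation model: agent $n$ observes, at times $t=0,1,2,\dots$, the vector $\mathbf{y}_n(t)=H_n\theta^*+\zeta_n(t)\in\mathbb{R}^{M_n}$. Here $H_n\in\mathbb{R}^{M_n\times M}$ is deterministic. For each $n$, $\{\zeta_n(t)\}_t$ is a zero-mean, temporally i.i.d. sequence with finite covariance $R_n$, which is nonsingular and unknown to the agents. Each $\zeta_n(t)$ is $\mathcal{F}_{t+1}$-measurable and independent of $\mathcal{F}_t$. For $n\neq l$ the sequences $\{\zeta_n(t)\}$ and $\{\zeta_l(t)\}$ are mutually uncorrelated. Communication model: $\{L_t\}$ is a sequence of random $N\times N$ Laplacian matrices of simple undirected graphs on $\{1,\dots,N\}$ (the Laplacian is degree matrix minus adjacency matrix). The random neighborhood of agent $n$ at time $t$ is $\Omega_n(t)=\{l: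 (L_t)_{nl}=-1\}$. Algorithm. The weights are $\alpha_t=a/(t+1)^{\tau_1}$ and $\beta_t=b/(t+1)^{\tau_2}$, and $\{\gamma_t\}$ is a sequence of positive reals with $\gamma_t\to 0$. The estimates $\mathbf{x}_n(t)\in\mathbb{R}^M$ have deterministic initial values $\mathbf{x}_n(0)$ and evolve as $$\mathbf{x}_n(t+1)=\mathbf{x}_n(t)-\beta_t\sum_{l\in\Omega_n(t)}(\mathbf{x}_n(t)-\mathbf{x}_l(t))+\alpha_t K_n(t)\big(\mathbf{y}_n(t)-H_n\mathbf{x}_n(t)\big).$$ The gains are $$K_n(t)=(G_n(t)+\gamma_t I_M)^{-1}H_n^T(Q_n(t)+\gamma_t I_{M_n})^{-1}.$$ The matrices $Q_n(t)$ start from a positive semidefinite initial value and are updated as the sample covariance $$Q_n(t+1)=\frac1t\sum_{s=0}^{t}\mathbf{y}_n(s)\mathbf{y}_n(s)^T-\Big(\frac1t\sum_{s=0}^{t-1}\mathbf{y}_n(s)\Big)\Big(\frac1t\sum_{s=0}^{t-1}\mathbf{y}_n(s)\Big)^T.$$ The matrices $G_n(t)$ start from positive semidefinite $G_n(0)$ and evolve as $$G_n(t+1)=G_n(t)-\beta_t\sum_{l\in\Omega_n(t)}(G_n(t)-G_l(t))+\alpha_t\big(H_n^T(Q_n(t)+\gamma_tI_{M_n})^{-1}H_n-G_n(t)\big).$$ Assumptions: (A.1) $\overline{\Sigma}_c=\frac1N\sum_{n=1}^N H_n^TR_n^{-1}H_n$ is invertible. (A.2) $\{L_t\}$ is temporally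 i.i.d., $L_t$ is $\mathcal{F}_{t+1}$-measurable and independent of $\mathcal{F}_t$, and $\lambda_2(\overline{L})>0$, where $\overline{L}=\mathbb{E}_{\theta^*}[L_t]$ and $\lambda_2$ denotes the second smallest eigenvalue. (A.3) $\{L_t\}$ and $\{\zeta_n(t)\}_{n}$ are mutually independent. (A.4) There is $\varepsilon_1>0$ with $\mathbb{E}_{\theta^*}\|\zeta_n(t)\|^{2+\varepsilon_1}<\infty$ for all $n$. (A.5) $a,b>0$, $0<\tau_2\le\tau_1\le 1$, and $\tau_1>\tau_2+\frac{1}{2+\varepsilon_1}+\frac12$.
   Formalization: The update for Q_n(t+1) contains 1/t and is undefined at t=0, so it is imposed only for t ≥ 1, and Q_n(1), like Q_n(0), is taken to be an arbitrary deterministic positive semidefinite initial matrix. *)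

(* Defs.v *)
From HB Require Import structures.
From mathcomp Require Import all_boot all_order all_algebra.
From mathcomp Require Import all_classical all_reals all_analysis.
Set Implicit Arguments. Unset Strict Implicit. Unset Printing Implicit Defensive.
Import Order.TTheory GRing.Theory Num.Theory.
Import numFieldNormedType.Exports.
Local Open Scope classical_set_scope.
Local Open Scope ring_scope.

Section Defs.
Variable R : realType.

Definition vnorm (m : nat) (v : 'cV[R]_m) : R :=
  Num.sqrt (\sum_(i < m) (v i 0) ^+ 2).

Definition mx_borel (m n : nat) : set_system 'M[R]_(m, n) :=
  <<s [set S | exists (i : 'I_m) (j : 'I_n) (B : set R),
                 measurable B /\ S = [set A : 'M[R]_(m, n) | B (A i j)]] >>.

Variables (d : measure_display) (T : measurableType d) (P : probability T R).

Definition sigmaX (m n : nat) (X : T -> 'M[R]_(m, n)) : set_system T :=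
  [set A | exists2 B, mx_borel B & A = X @^-1` B].

Definition meas_wrt (G : set_system T) (m n : nat) (X : T -> 'M[R]_(m, n)) :=
  forall B, mx_borel B -> G (X @^-1` B).

Definition indep (G1 G2 : set_system T) :=
  forall A B, G1 A -> G2 B -> P (A `&` B) = (P A * P B)%E.

Definition same_law (m n : nat) (X Y : T -> 'M[R]_(m, n)) :=
  forall B, mx_borel B -> P (X @^-1` B) = P (Y @^-1` B).

Definition filtration (F : nat -> set_system T) :=
  (forall t, sigma_algebra setT (F t)) /\
  (forall t, F t `<=` measurable) /\
  (forall t, F t `<=` F t.+1).

Definition Ex (f : T -> R) : \bar R := (\int[P]_w (f w)%:E)%E.

End Defs.

Definition is_graph_laplacian (R : realType) (N : nat) (L : 'M[R]_N) :=
  exists A : 'M[R]_N,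
    (forall i j, A i j = 0 \/ A i j = 1) /\ (forall i, A i i = 0) /\ A^T = A /\
    L = diag_mx (\row_i \sum_j A i j) - A.

Definition psd (R : realType) (m : nat) (A : 'M[R]_m) :=
  A^T = A /\ forall v : 'cV[R]_m, 0 <= (v^T *m A *m v) 0 0.

(* eigenvalues, listed nondecreasingly with algebraic multiplicity, of a matrix
   whose characteristic polynomial splits over R (e.g. a real symmetric one) *)
Definition eigs (R : realType) (N : nat) (A : 'M[R]_N) : seq R :=
  xget [::] [set s : seq R | sorted <=%R s /\
                             char_poly A = \prod_(a <- s) ('X - a%:P)].

Definition lambda2 (R : realType) (N : nat) (A : 'M[R]_N) : R :=
  nth 0 (eigs A) 1.

Definition stepw (R : realType) (c tau : R) (t : nat) : R := c / (t.+1%:R `^ tau).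

Definition gain (R : realType) (M m : nat) (Gm : 'M[R]_M) (Hm : 'M[R]_(m, M))
  (Qm : 'M[R]_m) (g : R) : 'M[R]_(M, m) :=
  invmx (Gm + g%:M) *m Hm^T *m invmx (Qm + g%:M).

(* Main.v *)
Require Import Defs.
From HB Require Import structures.
From mathcomp Require Import all_boot all_order all_algebra.
From mathcomp Require Import all_classical all_reals all_analysis.
From mathcomp Require Import measurable_realfun.
From mathcomp Require Import ring lra.
Import Order.TTheory GRing.Theory Num.Theory.
Import numFieldNormedType.Exports.
Local Open Scope classical_set_scope.
Local Open Scope ring_scope.

(** The argument is pathwise.  Almost surely:
    - |zeta_n(t)| = O(t^p) for every p > 1/(2 + eps1) (Markov and Borel-Cantelli);
    - Q_n(t) -> R_n (strong law of large numbers, proved by truncation, Chebyshev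
      along k = j^q and monotone interpolation);
    - for all large t, every edge of the mean graph, which is connected since
      lambda2 > 0, appears in some L_r with t <= r < t + m_t, where m_t ~ t^del and
      del > 0 is arbitrarily small (the probability of a silent window decays
      faster than any power of t).
    On such a path, over one window the l2 disagreement contracts by the factor
    1 - c beta_t, up to the sum of the inputs received during the window; hence
    inputs O(t^-rho) give disagreement O(t^(tau2 + del + delta - rho)) for every
    delta > 0.  Applied to the entries of G this shows that the G_n agree
    asymptotically; their mean is an averaging scheme driven by converging inputs,
    so G_n -> Sigma_c and the gains K_n(t) converge, with mean (1/N) sum K_n H_n -> I.
    Consequently the mean estimation error contracts at rate alpha_t, and a
    small-gain argument between the mean error and the disagreement (whose coupling
    is of order alpha_t m_t / beta_t -> 0) bounds all errors by O(t^p), the size of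
    the noise.  The input of the disagreement dynamics of x is thus
    O(t^(p - tau1)), which gives the claimed rate. *)

Set Implicit Arguments. Unset Strict Implicit. Unset Printing Implicit Defensive.

(** * Disagreement dynamics on a time-varying graph *)

(** The innovation of a single agent need not contract its error: the limit of [K_n H_n] is
    [S^-1 H_n^T R_n^-1 H_n], which may be singular, and only its average over the agents is the
    identity. So the mean error cannot be bounded without the disagreement, nor the disagreement
    without the size of the errors that feed it. The small-gain step breaks this circle without any
    prior bound on the estimates. In the recursion for x the noise enters only through its size,
    with no martingale cancellation, so gains that depend on the whole past cause no difficulty. The
    price is that the errors are bounded only by the growing envelope t^p. This is affordable
    because alpha_t multiplies them before they reach the disagreement. A single graph may be
    disconnected, so contraction is visible only over windows, and a window of length t^del costs a
    factor t^del in the rate. Both this loss and the excess of p over 1/(2 + eps1) are paid from the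
    strict inequality on tau0. *)

Section FiniteSums.
Variable R : realType.

Lemma sqr_sum_le (I : finType) (P : pred I) (a : I -> R) :
  (\sum_(i | P i) a i) ^+ 2 <= #|I|%:R * \sum_(i | P i) a i ^+ 2.
Proof.
have -> : (\sum_(i | P i) a i) ^+ 2 = \sum_(i | P i) \sum_(j | P j) a i * a j.
  by rewrite expr2 mulr_suml; apply: eq_bigr => i _; rewrite mulr_sumr.
have H : \sum_(i | P i) \sum_(j | P j) a i * a j <=
  \sum_(i | P i) \sum_(j | P j) (2^-1 * a i ^+ 2 + 2^-1 * a j ^+ 2).
  apply: ler_sum => i _; apply: ler_sum => j _.
  have := sqr_ge0 (a i - a j); nra.
apply: (le_trans H).
have -> : \sum_(i | P i) \sum_(j | P j) (2^-1 * a i ^+ 2 + 2^-1 * a j ^+ 2)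
   = #|[pred i | P i]|%:R * \sum_(i | P i) a i ^+ 2.
  rewrite (eq_bigr (fun i => #|[pred i | P i]|%:R * (2^-1 * a i ^+ 2)
      + 2^-1 * \sum_(j | P j) a j ^+ 2)); last first.
    move=> i _; rewrite big_split /= sumr_const -mulr_sumr mulr_natl.
    by congr (_ *+ _ + _).
  rewrite big_split /= -mulr_sumr -mulr_sumr sumr_const -mulr_natl.
  set S := \sum_(i | P i) a i ^+ 2; set n := (#|_|%:R : R).
  lra.
rewrite ler_wpM2r ?ler_nat ?max_card//.
by apply: sumr_ge0 => i _; exact: sqr_ge0.
Qed.

(** Lagrange's identity: the defect is half the sum of the squared minors
    [a i * b j - a j * b i]. *)
Lemma cauchy_schwarz_sum (I : finType) (a b : I -> R) :
  (\sum_i a i * b i) ^+ 2 <= (\sum_i a i ^+ 2) * (\sum_i b i ^+ 2).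
Proof.
have H : 0 <= \sum_i \sum_j (a i * b j - a j * b i) ^+ 2.
  by apply: sumr_ge0 => i _; apply: sumr_ge0 => j _; exact: sqr_ge0.
have E : \sum_i \sum_j (a i * b j - a j * b i) ^+ 2 =
   2 * ((\sum_i a i ^+ 2) * (\sum_i b i ^+ 2) - (\sum_i a i * b i) ^+ 2).
  transitivity (\sum_i (a i ^+ 2 * (\sum_j b j ^+ 2) +
     (\sum_j a j ^+ 2) * b i ^+ 2 - 2 * (a i * b i) * \sum_j (a j * b j))).
    apply: eq_bigr => i _; rewrite mulr_sumr mulr_suml mulr_sumr.
    rewrite -big_split -sumrB /=; apply: eq_bigr => j _; ring.
  rewrite sumrB big_split /= -mulr_suml -mulr_sumr -mulr_suml -mulr_sumr.
  ring.
by rewrite E pmulr_rge0 // subr_ge0 in H.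
Qed.

End FiniteSums.

Lemma sumr_ord_const (R : pzRingType) (n : nat) (c : R) : \sum_(i < n) c = n%:R * c.
Proof. by rewrite sumr_const card_ord mulr_natl. Qed.

Section Graph.
Variables (R : realType) (N : nat).
Implicit Types (z u : 'I_N -> R) (A : rel 'I_N).

Definition l2norm z : R := Num.sqrt (\sum_i z i ^+ 2).

Definition lap A z (i : 'I_N) : R := \sum_(j | A i j) (z i - z j).

Definition centered z (i : 'I_N) : R := z i - N%:R^-1 * \sum_j z j.

Lemma sumsq_ge0 z : 0 <= \sum_i z i ^+ 2.
Proof. by apply: sumr_ge0 => i _; exact: sqr_ge0. Qed.

Lemma l2norm_ge0 z : 0 <= l2norm z. Proof. exact: sqrtr_ge0. Qed.

Lemma sqr_l2norm z : l2norm z ^+ 2 = \sum_i z i ^+ 2.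
Proof. by rewrite sqr_sqrtr ?sumsq_ge0. Qed.

Lemma eq_l2norm z z' : z =1 z' -> l2norm z = l2norm z'.
Proof. by move=> e; congr Num.sqrt; apply: eq_bigr => i _; rewrite e. Qed.

Lemma le_l2norm z i : `|z i| <= l2norm z.
Proof.
rewrite -sqrtr_sqr ler_wsqrtr // (bigD1 i) //= lerDl.
by apply: sumr_ge0 => j _; exact: sqr_ge0.
Qed.

Lemma l2norm_le_sum z : l2norm z <= \sum_i `|z i|.
Proof.
have h : 0 <= \sum_i `|z i| by apply: sumr_ge0.
rewrite -(ler_pXn2r (n := 2)) ?nnegrE ?l2norm_ge0 // sqr_l2norm.
have -> : (\sum_i `|z i|) ^+ 2 = \sum_i `|z i| * \sum_j `|z j|.
  by rewrite expr2 mulr_suml.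
apply: ler_sum => i _; rewrite -(real_normK (num_real _)) expr2 ler_wpM2l //.
by rewrite (bigD1 i) //= lerDl; apply: sumr_ge0.
Qed.

Lemma l2norm_triangle z u : l2norm (fun i => z i + u i) <= l2norm z + l2norm u.
Proof.
rewrite -(ler_pXn2r (n := 2)) ?nnegrE ?addr_ge0 ?l2norm_ge0 //.
rewrite sqrrD !sqr_l2norm.
have -> : \sum_i (z i + u i) ^+ 2 =
    \sum_i z i ^+ 2 + (\sum_i z i * u i) *+ 2 + \sum_i u i ^+ 2.
  rewrite -sumrMnl -!big_split /=; apply: eq_bigr => i _; exact: sqrrD.
rewrite lerD2r lerD2l lerMn2r /=.
apply: le_trans (ler_norm _) _.
rewrite -(ler_pXn2r (n := 2)) ?nnegrE ?mulr_ge0 ?l2norm_ge0 //.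
by rewrite real_normK ?num_real // exprMn !sqr_l2norm; exact: cauchy_schwarz_sum.
Qed.

(** Twice the Dirichlet form of a symmetric graph: the double sum meets every undirected edge in
    both directions, whence the factors 2 below. *)
Definition energy A z : R := \sum_i \sum_(j | A i j) (z i - z j) ^+ 2.

(** Summation by parts: exchange the roles of [i] and [j], then add the two expressions. *)
Lemma lap_energy A z : symmetric A -> \sum_i z i * lap A z i = 2^-1 * energy A z.
Proof.
move=> sA.
have swap : \sum_i z i * lap A z i = \sum_i \sum_(j | A i j) - z j * (z i - z j).
  rewrite [RHS](exchange_big_dep predT) //=; apply: eq_bigr => i _.
  rewrite /lap mulr_sumr; apply: eq_big => j; first by rewrite sA.
  move=> _; ring.
suff : \sum_i z i * lap A z i + \sum_i z i * lap A z i = energy A z by lra.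
rewrite {2}swap -big_split /=; apply: eq_bigr => i _.
rewrite /lap mulr_sumr -big_split /=; apply: eq_bigr => j _; ring.
Qed.

Lemma lap_sum0 A z : symmetric A -> \sum_i lap A z i = 0.
Proof.
move=> sA.
have : \sum_i lap A z i = - \sum_i lap A z i.
  transitivity (\sum_i \sum_(j | A i j) (z j - z i)); last first.
    rewrite -sumrN; apply: eq_bigr => i _.
    by rewrite /lap -sumrN; apply: eq_bigr => j _; rewrite opprB.
  rewrite /lap (exchange_big_dep predT) //=; apply: eq_bigr => i _.
  by apply: eq_bigl => j; rewrite sA.
lra.
Qed.

Definition lapstep A (b : R) z (i : 'I_N) : R := z i - b * lap A z i.

(** Expanding the square, the first-order term gains [b * energy A z], and the quadratic term is at
    most [b^2 * N * energy A z] by Cauchy-Schwarz. The step-size condition makes the latter at most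
    half of the gain. *)
Lemma lapstep_energy A b z : symmetric A -> 0 <= b -> b * N%:R <= 2^-1 ->
  \sum_i lapstep A b z i ^+ 2 <= \sum_i z i ^+ 2 - 2^-1 * b * energy A z.
Proof.
move=> sA b0 bN.
have E0 : 0 <= energy A z.
  by apply: sumr_ge0 => i _; apply: sumr_ge0 => j _; exact: sqr_ge0.
have -> : \sum_i lapstep A b z i ^+ 2 = \sum_i z i ^+ 2
    - 2 * b * \sum_i z i * lap A z i + b ^+ 2 * \sum_i lap A z i ^+ 2.
  rewrite 2!mulr_sumr -sumrB -big_split /=; apply: eq_bigr => i _.
  rewrite /lapstep; ring.
have L2 : \sum_i lap A z i ^+ 2 <= N%:R * energy A z.
  rewrite mulr_sumr; apply: ler_sum => i _.
  by have := sqr_sum_le (A i) (fun j => z i - z j); rewrite card_ord.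
rewrite lap_energy //.
have : b ^+ 2 * \sum_i lap A z i ^+ 2 <= b ^+ 2 * (N%:R * energy A z).
  by rewrite ler_wpM2l // sqr_ge0.
have : (b * N%:R) * (b * energy A z) <= 2^-1 * (b * energy A z).
  by rewrite ler_wpM2r // mulr_ge0.
nra.
Qed.

Lemma energy_ge0 A z : 0 <= energy A z.
Proof. by apply: sumr_ge0 => i _; apply: sumr_ge0 => j _; exact: sqr_ge0. Qed.

Lemma energy_ge_edge A z k l : symmetric A -> A k l ->
  (z k - z l) ^+ 2 * 2 <= energy A z.
Proof.
move=> sA Akl; have [->|nkl] := eqVneq k l.
  by rewrite subrr expr0n /= mul0r energy_ge0.
rewrite /energy (bigD1 k) //= (bigD1 l (P := A k)) //=.
rewrite [X in _ <= _ + X](bigD1 l) 1?eq_sym //= [X in _ <= _ + (X + _)](bigD1 k) 1?sA //=.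
have h1 : 0 <= \sum_(i | A k i && (i != l)) (z k - z i) ^+ 2.
  by apply: sumr_ge0 => j _; exact: sqr_ge0.
have h2 : 0 <= \sum_(i | A l i && (i != k)) (z l - z i) ^+ 2.
  by apply: sumr_ge0 => j _; exact: sqr_ge0.
have h3 : 0 <= \sum_(i | (i != k) && (i != l)) \sum_(j | A i j) (z i - z j) ^+ 2.
  by apply: sumr_ge0 => i _; apply: sumr_ge0 => j _; exact: sqr_ge0.
move: h1 h2 h3; set a := bigop _ _ _; set b := bigop _ _ _; set c := bigop _ _ _.
move=> h1 h2 h3.
have -> : (z l - z k) ^+ 2 = (z k - z l) ^+ 2 by ring.
set q := (z k - z l) ^+ 2; lra.
Qed.

Lemma lapstep_l2norm A b z : symmetric A -> 0 <= b -> b * N%:R <= 2^-1 ->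
  l2norm (lapstep A b z) <= l2norm z.
Proof.
move=> sA b0 bN; rewrite ler_wsqrtr //.
apply: (le_trans (lapstep_energy z sA b0 bN)); rewrite gerBl.
by rewrite !mulr_ge0 // ?energy_ge0 // invr_ge0.
Qed.

Lemma lap_le A z i : `|lap A z i| <= 2 * N%:R * l2norm z.
Proof.
apply: (le_trans (ler_norm_sum _ _ _)).
apply: (@le_trans _ _ (\sum_(j < N | A i j) 2 * l2norm z)).
  apply: ler_sum => j _; apply: (le_trans (ler_normB _ _)).
  have := le_l2norm z i; have := le_l2norm z j; lra.
apply: (@le_trans _ _ (\sum_(j < N) 2 * l2norm z)).
  by rewrite [leRHS](bigID (A i)) /= lerDl sumr_ge0 // => j _; rewrite mulr_ge0 // l2norm_ge0.
by rewrite sumr_ord_const mulrCA mulrA.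
Qed.

Lemma path_gap (e : rel 'I_N) z (g : R) : (forall k l, e k l -> `|z k - z l| <= g) ->
  forall p i, path e i p -> `|z i - z (last i p)| <= (size p)%:R * g.
Proof.
move=> H; elim=> [|k p IH] i /=; first by rewrite subrr normr0 mul0r.
move=> /andP[eik pk]; rewrite -nat1r mulrDl mul1r.
have -> : z i - z (last k p) = (z i - z k) + (z k - z (last k p)) by ring.
by apply: (le_trans (ler_normD _ _)); apply: lerD; [exact: H|exact: IH].
Qed.

(** A path without repeated vertices has at most [N.-1] edges, whatever the graph. *)
Lemma connect_gap (e : rel 'I_N) z (g : R) : 0 <= g -> (forall i j, connect e i j) ->
  (forall k l, e k l -> `|z k - z l| <= g) -> forall i j, `|z i - z j| <= N.-1%:R * g.
Proof.
move=> g0 ce H i j; have /connectP[p pp ->] := ce i j.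
have [q pq uq _] := shortenP pp.
apply: (le_trans (path_gap H pq)); rewrite ler_wpM2r // ler_nat.
have := max_card [in i :: q]; rewrite (card_uniqP uq) card_ord /= => h.
by rewrite -ltnS (ltn_predK h).
Qed.

(* If all edges were narrow, a path of length < N would keep every entry close to the
   mean, which is 0. *)
Lemma wide_edge (e : rel 'I_N) z : (0 < N)%N -> (forall i j, connect e i j) ->
  \sum_i z i = 0 -> 0 < l2norm z ->
  exists k l, e k l /\ l2norm z <= N%:R ^+ 2 * `|z k - z l|.
Proof.
move=> N0 ce z0 s0; set s := l2norm z in s0 *.
have N1 : 1 <= N%:R :> R by rewrite ler1n.
apply: contrapT => /forallNP nE.
have gap k l : e k l -> `|z k - z l| <= s / N%:R ^+ 2.
  move=> ekl; rewrite ler_pdivlMr ?exprn_gt0 ?ltr0n // mulrC leNgt; apply/negP => h.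
  by apply: (nE k); exists l; split => //; exact: ltW.
have g0 : 0 <= s / N%:R ^+ 2 by rewrite divr_ge0 ?(ltW s0) // exprn_ge0.
have gapall := connect_gap g0 ce gap.
have small i : `|z i| <= N.-1%:R * (s / N%:R ^+ 2).
  have E : N%:R * z i = \sum_j (z i - z j).
    by rewrite sumrB z0 subr0 sumr_const card_ord mulr_natl.
  have : `|N%:R * z i| <= N%:R * (N.-1%:R * (s / N%:R ^+ 2)).
    rewrite E; apply: (le_trans (ler_norm_sum _ _ _)).
    rewrite (_ : N%:R * _ = \sum_(j < N) (N.-1%:R * (s / N%:R ^+ 2))).
      by apply: ler_sum => j _; exact: gapall.
    by rewrite sumr_const card_ord mulr_natl.
  by rewrite normrM normr_nat ler_pM2l // ltr0n.
have : s <= \sum_i `|z i| by exact: l2norm_le_sum.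
apply/negP; rewrite -ltNge.
apply: (@le_lt_trans _ _ (\sum_(i < N) N.-1%:R * (s / N%:R ^+ 2))).
  by apply: ler_sum => i _; exact: small.
rewrite sumr_ord_const.
have -> : N%:R * (N.-1%:R * (s / N%:R ^+ 2)) = N.-1%:R / N%:R * s.
  by field; rewrite pnatr_eq0 -lt0n.
by rewrite gtr_pMl // ltr_pdivrMr ?ltr0n // mul1r ltr_nat ltn_predL.
Qed.

Lemma lapstepB A b z z' i :
  lapstep A b z i - lapstep A b z' i = lapstep A b (fun i => z i - z' i) i.
Proof.
rewrite /lapstep /lap.
have -> : \sum_(j | A i j) (z i - z' i - (z j - z' j)) =
    \sum_(j | A i j) (z i - z j) - \sum_(j | A i j) (z' i - z' j).
  by rewrite -sumrB; apply: eq_bigr => j _; ring.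
ring.
Qed.

Lemma centered_sum0 z : (0 < N)%N -> \sum_i centered z i = 0.
Proof.
move=> N0; rewrite sumrB sumr_ord_const mulrA divff ?mul1r ?subrr //.
by rewrite pnatr_eq0 -lt0n.
Qed.

Lemma lap_centered A z : lap A (centered z) =1 lap A z.
Proof. by move=> i; apply: eq_bigr => j _; rewrite /centered; ring. Qed.

Lemma centered_lapstep A b z i : symmetric A ->
  centered (lapstep A b z) i = lapstep A b (centered z) i.
Proof.
move=> sA; rewrite /centered /lapstep lap_centered sumrB -mulr_sumr lap_sum0 //.
by ring.
Qed.

Lemma centeredD z u i : centered (fun i => z i + u i) i = centered z i + centered u i.
Proof. by rewrite /centered big_split /=; ring. Qed.

Lemma centered_l2norm z : l2norm (centered z) <= l2norm z.
Proof.
case: (posnP N) => [N0|N0].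
  by rewrite ler_wsqrtr // !big1 // => i; have := ltn_ord i; rewrite [X in (_ < X)%N]N0.
rewrite ler_wsqrtr //.
have -> : \sum_i centered z i ^+ 2 =
    \sum_i z i ^+ 2 - N%:R * (N%:R^-1 * \sum_j z j) ^+ 2.
  set mu := N%:R^-1 * _.
  have E : \sum_i z i = N%:R * mu by rewrite /mu mulVKf // pnatr_eq0 -lt0n.
  transitivity (\sum_i (z i ^+ 2 - 2 * mu * z i + mu ^+ 2)).
    by apply: eq_bigr => i _; rewrite /centered -/mu; ring.
  rewrite big_split sumrB /= -mulr_sumr E sumr_ord_const; ring.
by rewrite gerBl mulr_ge0 // sqr_ge0.
Qed.

(** * Contraction of the disagreement over a window of jointly connected graphs *)

Section Window.
Variables (A : nat -> rel 'I_N) (b : nat -> R) (t m : nat).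
Hypotheses (sA : forall r, symmetric (A r)) (b_ge0 : forall r, 0 <= b r).

Lemma lapstep_flow_l2norm (z : nat -> 'I_N -> R) :
  (forall r, (t <= r < t + m)%N -> b r * N%:R <= 2^-1) ->
  (forall r, (t <= r < t + m)%N -> z r.+1 =1 lapstep (A r) (b r) (z r)) ->
  forall k, (k <= m)%N -> l2norm (z (t + k)%N) <= l2norm (z t).
Proof.
move=> bN hz; elim=> [|k IH] km; first by rewrite addn0.
have hr : (t <= t + k < t + m)%N by rewrite leq_addr ltn_add2l.
rewrite addnS (eq_l2norm (hz _ hr)).
apply: le_trans (IH (ltnW km)); apply: lapstep_l2norm => //; exact: bN.
Qed.

Lemma lapstep_flow_drift (z : nat -> 'I_N -> R) :
  (forall r, (t <= r < t + m)%N -> b r * N%:R <= 2^-1) ->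
  (forall r, (t <= r < t + m)%N -> z r.+1 =1 lapstep (A r) (b r) (z r)) ->
  forall k i, (k <= m)%N -> `|z (t + k)%N i - z t i| <=
    (\sum_(t <= r < t + k) b r) * (2 * N%:R * l2norm (z t)).
Proof.
move=> bN hz; elim=> [|k IH] i km; first by rewrite addn0 subrr normr0 big_geq ?mul0r.
have hr : (t <= t + k < t + m)%N by rewrite leq_addr ltn_add2l.
rewrite addnS (hz _ hr) big_nat_recr ?leq_addr //= mulrDl.
have -> : lapstep (A (t + k)%N) (b (t + k)%N) (z (t + k)%N) i - z t i =
  (z (t + k)%N i - z t i) - b (t + k)%N * lap (A (t + k)%N) (z (t + k)%N) i.
  by rewrite /lapstep; ring.
apply: (le_trans (ler_normB _ _)); apply: lerD; first exact: IH (ltnW km).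
rewrite normrM ger0_norm // ler_wpM2l //.
apply: (le_trans (lap_le _ _ _)); rewrite ler_wpM2l ?mulr_ge0 //.
exact: lapstep_flow_l2norm (ltnW km).
Qed.

(* Some edge is wide at time t; the state drifts too little within the window to close
   it before it is used, and using it dissipates a fixed fraction of the energy. *)
Lemma window_contraction (e : rel 'I_N) (z : nat -> 'I_N -> R) (b0 : R) :
  (0 < N)%N -> (forall i j, connect e i j) ->
  (forall i j, e i j -> exists2 r, (t <= r < t + m)%N & A r i j) ->
  (forall r, (t <= r < t + m)%N -> z r.+1 =1 lapstep (A r) (b r) (z r)) ->
  \sum_(t <= r < t + m) b r <= (8 * N%:R ^+ 3)^-1 ->
  (forall r, (t <= r < t + m)%N -> b0 <= b r) -> 0 <= b0 ->
  \sum_i z t i = 0 ->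
  l2norm (z (t + m)%N) <= (1 - b0 / (8 * N%:R ^+ 4)) * l2norm (z t).
Proof.
move=> N0 ce eA hz bs hb0 b00 z0.
have N1 : 1 <= N%:R :> R by rewrite ler1n.
have N3 : 1 <= N%:R ^+ 2 :> R by rewrite exprn_ege1.
have Np : 0 < N%:R ^+ 3 :> R by rewrite exprn_gt0 // ltr0n.
(* The steps are nonnegative, so each is at most the window total; this already forces the step-size
   condition. *)
have bN r : (t <= r < t + m)%N -> b r * N%:R <= 2^-1.
  move=> hr; have br : b r <= (8 * N%:R ^+ 3)^-1.
    apply: le_trans bs; rewrite (big_cat_nat (n := r)) //=; last 2 first.
    - by case/andP: hr.
    - by case/andP: hr => _ /ltnW.
    rewrite [X in _ + X]big_ltn; last by case/andP: hr.
    rewrite addrCA lerDl addr_ge0 //; exact: sumr_ge0.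
  apply: (@le_trans _ _ ((8 * N%:R ^+ 3)^-1 * N%:R)); first by rewrite ler_wpM2r.
  rewrite -ler_pdivlMr ?ltr0n // -[leRHS]invfM lef_pV2 ?posrE ?mulr_gt0 ?ltr0n //.
  rewrite exprS; nra.
have [s0|s0] := ltrP 0 (l2norm (z t)); last first.
  have E : l2norm (z t) = 0 by apply/eqP; rewrite eq_le s0 l2norm_ge0.
  by have := lapstep_flow_l2norm bN hz (leqnn m); rewrite E mulr0.
have [k [l [ekl gap]]] := wide_edge N0 ce z0 s0.
have [r /andP[tr rm] Akl] := eA _ _ ekl.
set s := l2norm (z t) in s0 gap *.
have hr : (t <= r < t + m)%N by rewrite tr rm.
have rE : (t + (r - t))%N = r by rewrite subnKC.
have rtm : (r - t <= m)%N by rewrite leq_subLR ltnW.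
have sub_b : \sum_(t <= r0 < r) b r0 <= (8 * N%:R ^+ 3)^-1.
  apply: le_trans bs; rewrite [leRHS](big_cat_nat (n := r)) //=; last exact: ltnW.
  by rewrite lerDl; exact: sumr_ge0.
have drift i : `|z r i - z t i| <= (8 * N%:R ^+ 3)^-1 * (2 * N%:R * s).
  have := lapstep_flow_drift bN hz i rtm; rewrite rE => h; apply: (le_trans h).
  by rewrite ler_wpM2r // !mulr_ge0 // ltW.
(* The constant [8 N^3] limits the drift of each endpoint to a quarter of [s / N^2], so half of the
   gap of time [t] survives until the edge is used. *)
have gapr : s / (2 * N%:R ^+ 2) <= `|z r k - z r l|.
  have d1 := drift k; have d2 := drift l.
  have E : (8 * N%:R ^+ 3)^-1 * (2 * N%:R * s) = s / N%:R ^+ 2 / 4.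
    by field; rewrite pnatr_eq0 -lt0n.
  have E2 : s / (2 * N%:R ^+ 2) = s / N%:R ^+ 2 / 2.
    by field; rewrite pnatr_eq0 -lt0n.
  have g : s / N%:R ^+ 2 <= `|z t k - z t l|.
    by rewrite ler_pdivrMr ?(lt_le_trans _ N3) // mulrC.
  rewrite E in d1 d2; rewrite E2.
  have : `|z t k - z t l| <= `|z r k - z r l| + `|z r k - z t k| + `|z r l - z t l|.
    have -> : z t k - z t l = (z r k - z r l) - (z r k - z t k) + (z r l - z t l).
      by ring.
    by apply: (le_trans (ler_normD _ _)); rewrite lerD2r; exact: ler_normB.
  lra.
have gap2 : (s / (2 * N%:R ^+ 2)) ^+ 2 <= (z r k - z r l) ^+ 2.
  rewrite -[leRHS](real_normK (num_real _)) ler_pXn2r ?nnegrE //.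
  by rewrite divr_ge0 ?mulr_ge0 ?(ltW s0) // (le_trans _ N3).
have step : l2norm (z r.+1) ^+ 2 <= s ^+ 2 - b0 * (s / (2 * N%:R ^+ 2)) ^+ 2.
  rewrite (eq_l2norm (hz _ hr)) sqr_l2norm.
  apply: (le_trans (lapstep_energy _ (sA r) (b_ge0 r) (bN _ hr))).
  have En := energy_ge_edge (z r) (sA r) Akl.
  have zr : \sum_i z r i ^+ 2 <= s ^+ 2.
    rewrite -sqr_l2norm ler_pXn2r ?nnegrE ?l2norm_ge0 //.
    by have := lapstep_flow_l2norm bN hz rtm; rewrite rE.
  have hb := hb0 _ hr; have hbr := b_ge0 r.
  set g := (s / _) ^+ 2 in gap2 *; set q := (z r k - z r l) ^+ 2 in gap2 En.
  have g0 : 0 <= g by exact: sqr_ge0.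
  nra.
have last_step : l2norm (z (t + m)%N) <= l2norm (z r.+1).
  have hz' r' : (r.+1 <= r' < r.+1 + (t + m - r.+1))%N ->
      z r'.+1 =1 lapstep (A r') (b r') (z r') /\ b r' * N%:R <= 2^-1.
    rewrite subnKC // => /andP[h1 h2].
    have h : (t <= r' < t + m)%N by rewrite h2 andbT (leq_trans tr) // ltnW.
    by split; [exact: hz|exact: bN].
  have : forall k, (k <= t + m - r.+1)%N -> l2norm (z (r.+1 + k)%N) <= l2norm (z r.+1).
    elim=> [|j IH] jm; first by rewrite addn0.
    have [|e1 e2] := hz' (r.+1 + j)%N; first by rewrite leq_addr ltn_add2l.
    rewrite addnS (eq_l2norm e1); apply: le_trans (IH (ltnW jm)).
    exact: lapstep_l2norm.
  by move=> /(_ _ (leqnn _)); rewrite subnKC.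
apply: (le_trans last_step).
have x1 : b0 / (8 * N%:R ^+ 4) <= 1.
  rewrite ler_pdivrMr ?mul1r ?mulr_gt0 ?exprn_gt0 ?ltr0n //.
  have hb := hb0 _ hr; have hN := bN _ hr.
  have : b r <= b r * N%:R by rewrite ler_peMr.
  have : 1 <= N%:R ^+ 4 :> R by rewrite exprn_ege1.
  lra.
(* With [x = b0 / (8 N^4)] the dissipated energy is [2 * x * s^2], and [1 - 2x <= (1 - x)^2];
   passing to square roots needs [x <= 1]. *)
rewrite -(ler_pXn2r (n := 2)) ?nnegrE ?l2norm_ge0 ?mulr_ge0 ?l2norm_ge0 ?subr_ge0 //.
apply: (le_trans step).
set x := b0 / _ in x1 *.
have -> : b0 * (s / (2 * N%:R ^+ 2)) ^+ 2 = 2 * x * s ^+ 2.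
  by rewrite /x; field; rewrite pnatr_eq0 -lt0n.
have := sqr_ge0 (x * s); nra.
Qed.

(* By linearity and nonexpansiveness the inputs merely add up. *)
Lemma perturbed_flow (z u : nat -> 'I_N -> R) :
  (forall r, (t <= r < t + m)%N -> b r * N%:R <= 2^-1) ->
  (forall r, (t <= r < t + m)%N ->
     z r.+1 =1 fun i => lapstep (A r) (b r) (z r) i + u r i) ->
  exists z' : nat -> 'I_N -> R, [/\ z' t =1 z t,
    forall r, (t <= r < t + m)%N -> z' r.+1 =1 lapstep (A r) (b r) (z' r) &
    forall k, (k <= m)%N -> l2norm (z (t + k)%N) <=
       l2norm (z' (t + k)%N) + \sum_(t <= r < t + k) l2norm (u r)].
Proof.
move=> bN hz.
pose w := fix w k := if k is k'.+1 then
  lapstep (A (t + k')%N) (b (t + k')%N) (w k') else z t.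
exists (fun r => w (r - t)%N); split.
- by move=> i /=; rewrite subnn.
- by move=> r /andP[tr _] i; rewrite subSn //= subnKC.
suff H k : (k <= m)%N -> l2norm (fun i => z (t + k)%N i - w k i) <=
    \sum_(t <= r < t + k) l2norm (u r).
  move=> k km; rewrite addKn.
  rewrite (@eq_l2norm _ (fun i => w k i + (z (t + k)%N i - w k i))); last first.
    by move=> i; rewrite addrC subrK.
  by apply: (le_trans (l2norm_triangle _ _)); rewrite lerD2l; exact: H.
elim: k => [|k IH] km.
  rewrite addn0 big_geq // /l2norm big1 ?sqrtr0 // => i _.
  by rewrite subrr expr0n.
have hr : (t <= t + k < t + m)%N by rewrite leq_addr ltn_add2l.
rewrite addnS big_nat_recr ?leq_addr //=.
rewrite (@eq_l2norm _ (fun i => lapstep (A (t + k)%N) (b (t + k)%N)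
    (fun i => z (t + k)%N i - w k i) i + u (t + k)%N i)); last first.
  by move=> i; rewrite (hz _ hr) -lapstepB; ring.
apply: (le_trans (l2norm_triangle _ _)); rewrite lerD2r.
apply: le_trans (IH (ltnW km)); apply: lapstep_l2norm => //; exact: bN.
Qed.

End Window.

End Graph.

(** * Rates of windowed recursions *)

Section Rates.
Variable R : realType.

Lemma cvg_mulc (u : nat -> R) (c l : R) :
  u @ \oo --> l -> (fun t => c * u t) @ \oo --> c * l.
Proof. by move=> h; apply: cvgM => //; exact: cvg_cst. Qed.

Implicit Types (x y e : R) (t : nat).

Lemma powSD t x y : (t.+1%:R : R) `^ (x + y) = t.+1%:R `^ x * t.+1%:R `^ y.
Proof. by rewrite powRD // pnatr_eq0 implybT. Qed.

Lemma powS_gt0 t x : 0 < (t.+1%:R : R) `^ x.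
Proof. by rewrite powR_gt0 // ltr0n. Qed.

Lemma powS_ge1 t x : 0 <= x -> 1 <= (t.+1%:R : R) `^ x.
Proof.
by move=> x0; rewrite -[leLHS](powRr0 (t.+1%:R : R)) ler_powR // ler1n.
Qed.

Lemma cvg_powSN e : 0 < e -> (fun t => (t.+1%:R : R) `^ (- e)) @ \oo --> (0 : R).
Proof.
move=> e0; apply/cvgrPdist_lt => eps eps0.
have M0 : 0 <= eps^-1 `^ e^-1 by exact: powR_ge0.
near=> t.
rewrite sub0r normrN ger0_norm ?powR_ge0 // powRN.
rewrite -[ltRHS]invrK ltf_pV2 ?posrE ?invr_gt0 ?powS_gt0 //.
have -> : eps^-1 = (eps^-1 `^ e^-1) `^ e.
  by rewrite -powRrM mulVf ?gt_eqF // powRr1 // invr_ge0 ltW.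
apply: gt0_ltr_powR; rewrite ?nnegrE //.
apply: (@lt_le_trans _ _ t%:R); last by rewrite ler_nat.
by near: t; exact: nbhs_infty_gtr.
Unshelve. all: by end_near.
Qed.

Lemma near_powS_le (C eps : R) x y : x < y -> 0 < eps ->
  \forall t \near \oo, C * (t.+1%:R : R) `^ x <= eps * t.+1%:R `^ y.
Proof.
move=> xy eps0.
have h := @cvg_powSN (y - x); rewrite subr_gt0 in h.
have := @cvg_mulc _ C _ (h xy).
move=> /cvgrPdist_lt /(_ _ eps0); rewrite mulr0; apply: filterS => t.
rewrite sub0r normrN => h1.
have {}h1 := le_lt_trans (ler_norm _) h1.
have -> : (t.+1%:R : R) `^ x = t.+1%:R `^ (- (y - x)) * t.+1%:R `^ y.
  by rewrite -powSD; congr (_ `^ _); ring.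
by rewrite mulrA ler_wpM2r ?powR_ge0 // ltW.
Qed.

(** With [q = m / (t+1)], [(1 + q)^-x = exp (- x ln (1 + q)) >= exp (- x q) >= 1 - x q]. This
    measures how much a decaying reference power falls over a window, a loss that the contraction
    has to beat. *)
Lemma powS_shift_ge t m x : 0 <= x ->
  (t.+1%:R : R) `^ (- x) * (1 - x * m%:R / t.+1%:R) <= (t + m).+1%:R `^ (- x).
Proof.
move=> x0.
have s0 : 0 < t.+1%:R :> R by rewrite ltr0n.
have -> : ((t + m).+1%:R : R) = t.+1%:R * (1 + m%:R / t.+1%:R).
  by rewrite mulrDr mulr1 mulrCA divff ?gt_eqF // mulr1 -natrD addSn.
have q0 : 0 <= m%:R / t.+1%:R :> R by rewrite divr_ge0.
set q := m%:R / _ in q0 *; rewrite -mulrA -/q powRM ?addr_ge0 // ?ler_wpM2l ?powR_ge0 //.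
rewrite /powR gt_eqF ?ltr_pwDl //.
apply: (@le_trans _ _ (expR (- (x * q)))); first by have := expR_ge1Dx (- (x * q)).
by rewrite ler_expR mulNr lerN2 ler_wpM2l // le_ln1Dx // (lt_le_trans _ q0) // ltrN10.
Qed.

Definition winlen (del : R) t : nat := (Num.truncn ((t.+1%:R : R) `^ del)).+1.

Lemma winlen_ge del t : (t.+1%:R : R) `^ del <= (winlen del t)%:R.
Proof. by rewrite ltW // truncnS_gt. Qed.

Lemma winlen_le del t : 0 <= del -> (winlen del t)%:R <= 2 * (t.+1%:R : R) `^ del.
Proof.
move=> d0; rewrite /winlen -natr1.
have := powS_ge1 t d0; have : (Num.truncn ((t.+1%:R : R) `^ del))%:R <= (t.+1%:R : R) `^ del.
  by rewrite truncn_le powR_ge0.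
lra.
Qed.

Lemma winlen_end del t r : 0 <= del <= 1 -> (r <= t + winlen del t)%N ->
  (r.+1%:R : R) <= 3 * t.+1%:R.
Proof.
move=> /andP[d0 d1] h.
have : (r.+1%:R : R) <= t.+1%:R + (winlen del t)%:R by rewrite -natrD ler_nat addSn ltnS.
have := winlen_le t d0.
have : (t.+1%:R : R) `^ del <= t.+1%:R by rewrite ler1_powR // ler1n.
lra.
Qed.

Lemma stepw_gt0 (c tau : R) t : 0 < c -> 0 < stepw c tau t.
Proof. by move=> c0; rewrite divr_gt0 // powS_gt0. Qed.

Lemma stepwE (c tau : R) t : stepw c tau t = c * t.+1%:R `^ (- tau).
Proof. by rewrite /stepw powRN. Qed.

Lemma stepw_le (c tau : R) t r : 0 <= c -> 0 <= tau -> (t <= r)%N ->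
  stepw c tau r <= stepw c tau t.
Proof.
move=> c0 tau0 tr; rewrite /stepw ler_wpM2l // lef_pV2 ?posrE ?powS_gt0 //.
by rewrite ge0_ler_powR // ?nnegrE // ler_nat.
Qed.

(** A window starting at [t] ends before [3 (t+1)], and the exponent is at most 1, so step sizes
    within a window differ by at most a factor 3. *)
Lemma stepw_win (c tau del : R) t r : 0 <= c -> 0 <= tau <= 1 -> 0 <= del <= 1 ->
  (r <= t + winlen del t)%N -> stepw c tau t / 3 <= stepw c tau r.
Proof.
move=> c0 /andP[tau0 tau1] hd hr; rewrite /stepw -mulrA ler_wpM2l //.
rewrite -invfM lef_pV2 ?posrE ?mulr_gt0 ?powS_gt0 //.
apply: (@le_trans _ _ ((3 * t.+1%:R) `^ tau)).
  by rewrite ge0_ler_powR // ?nnegrE ?mulr_ge0 //; exact: winlen_end hr.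
rewrite powRM // mulrC ler_wpM2l ?powR_ge0 // ler1_powR //; lra.
Qed.

(** Windows laid end to end from [t0] cover all later times. An invariant that is propagated only
    from the start of a window to its end is thus available at the start of some window containing
    any given time. *)
Lemma window_cover (m : nat -> nat) (P : nat -> Prop) t0 :
  (forall t, (0 < m t)%N) -> P t0 ->
  (forall t, (t0 <= t)%N -> P t -> P (t + m t)%N) ->
  forall t, (t0 <= t)%N -> exists T, [/\ P T, (t0 <= T <= t)%N & (t <= T + m T)%N].
Proof.
move=> m0 P0 PS t; elim: t => [|t IH].
  by move=> h; exists t0; split; rewrite ?leqnn.
rewrite leq_eqVlt => /orP[/eqP <-|/IH [T [PT /andP[h1 h2] h3]]].
  by exists t0; split; rewrite ?leqnn ?leq_addr.
case: (ltnP t (T + m T)) => h4.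
  by exists T; split => //; rewrite h1 leqW.
have e : t = (T + m T)%N by apply/eqP; rewrite eqn_leq h3 h4.
exists t; split; rewrite ?leqnSn ?(leq_trans h1 h2) //.
  by rewrite e; exact: PS.
by rewrite -addn1 leq_add2l.
Qed.

(** The interface between the graph dynamics and the rate arguments: inside a window the inputs
    merely add up, and only at its end is the factor [1 - bet t] gained. A window may start at any
    time from [t0] on. *)
Definition window_decay (m : nat -> nat) (bet U W : nat -> R) t0 : Prop :=
  forall t, (t0 <= t)%N ->
    (forall k, (k <= m t)%N -> W (t + k)%N <= W t + \sum_(t <= r < t + k) U r) /\
    W (t + m t)%N <= (1 - bet t) * W t + \sum_(t <= r < t + m t) U r.

Lemma sum_window_le (U : nat -> R) (B : R) t k K : 0 <= B -> (k <= K)%N ->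
  (forall r, (t <= r < t + k)%N -> U r <= B) -> \sum_(t <= r < t + k) U r <= K%:R * B.
Proof.
move=> B0 kK hU; apply: (@le_trans _ _ (k%:R * B)); last first.
  by rewrite ler_wpM2r // ler_nat.
rewrite (_ : k%:R * B = \sum_(t <= r < t + k) B); last first.
  by rewrite sumr_const_nat addKn mulr_natl.
by rewrite big_nat [leRHS]big_nat; exact: ler_sum.
Qed.

(** [W] is compared with [A * t^-sg], where [sg] lies strictly between [tau0] and
    [rho - tau2 - del]. A window contracts by an amount of order t^-tau2. Half of it pays for the
    fall of the reference power, of order t^(del - 1), which requires [del + tau2 < 1]. The other
    half pays for the inputs, of order t^(del - rho), which requires [sg + tau2 < rho - del]. *)
Lemma window_rate (W U : nat -> R) (b c tau2 del rho C tau0 : R) t0 :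
  0 < b -> 0 < c -> 0 < tau2 -> 0 < del -> del + tau2 < 1 ->
  window_decay (winlen del) (fun t => c * stepw b tau2 t) U W t0 ->
  (forall t, 0 <= W t) ->
  (forall t, (t0 <= t)%N -> U t <= C * t.+1%:R `^ (- rho)) ->
  0 <= C -> 0 <= tau0 -> tau0 < rho - tau2 - del ->
  (fun t => (t.+1%:R : R) `^ tau0 * W t) @ \oo --> (0 : R).
Proof.
move=> b0 c0 tau20 del0 dt WD W0 hU C0 tau00 htau.
pose sg := (tau0 + (rho - tau2 - del)) / 2.
have sg0 : tau0 < sg by rewrite /sg; lra.
have sg1 : sg < rho - tau2 - del by rewrite /sg; lra.
have sgp : 0 < sg by lra.
have cb0 : 0 < c * b / 2 by rewrite divr_gt0 // mulr_gt0.
have [t1 _ H1] : \forall t \near \oo,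
    (2 * sg) * (t.+1%:R : R) `^ (del - 1) <= (c * b / 2) * t.+1%:R `^ (- tau2).
  by apply: near_powS_le => //; lra.
have [t2 _ H2] : \forall t \near \oo,
    (2 * C) * (t.+1%:R : R) `^ (del - rho) <= (c * b / 2) * t.+1%:R `^ (- sg - tau2).
  by apply: near_powS_le => //; lra.
have [t3 _ H3] : \forall t \near \oo,
    (c * b) * (t.+1%:R : R) `^ (- tau2) <= 1 * t.+1%:R `^ 0.
  by apply: near_powS_le => //; lra.
pose T0 := maxn t0 (maxn t1 (maxn t2 t3)).
have {}H1 t : (T0 <= t)%N ->
    (2 * sg) * (t.+1%:R : R) `^ (del - 1) <= (c * b / 2) * t.+1%:R `^ (- tau2).
  by move=> h; apply: H1 => /=; apply: leq_trans h; rewrite /T0 !leq_max leqnn !orbT.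
have {}H2 t : (T0 <= t)%N ->
    (2 * C) * (t.+1%:R : R) `^ (del - rho) <= (c * b / 2) * t.+1%:R `^ (- sg - tau2).
  by move=> h; apply: H2 => /=; apply: leq_trans h; rewrite /T0 !leq_max leqnn !orbT.
have {}H3 t : (T0 <= t)%N -> c * stepw b tau2 t <= 1.
  move=> h; rewrite stepwE mulrA; have := H3 t; rewrite powRr0 mulr1; apply => /=.
  by apply: leq_trans h; rewrite /T0 !leq_max leqnn !orbT.
have T00 t : (T0 <= t)%N -> (t0 <= t)%N.
  by move=> h; apply: leq_trans h; rewrite /T0 !leq_max leqnn.
pose A := 1 + W T0 * T0.+1%:R `^ sg.
have A1 : 1 <= A by rewrite /A lerDl mulr_ge0 // powR_ge0.
have sumU t k : (T0 <= t)%N -> (k <= winlen del t)%N ->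
    \sum_(t <= r < t + k) U r <= 2 * C * (t.+1%:R : R) `^ (del - rho).
  move=> ht hk.
  have hp : 0 <= C * (t.+1%:R : R) `^ (- rho) by rewrite mulr_ge0 // powR_ge0.
  apply: (le_trans (sum_window_le hp hk _)) => [r /andP[tr _]|].
    apply: (le_trans (hU r _)); first by rewrite (leq_trans _ tr) // T00.
    rewrite ler_wpM2l // !powRN lef_pV2 ?posrE ?powS_gt0 //.
    by rewrite ge0_ler_powR ?nnegrE ?ler_nat //; lra.
  rewrite powSD; have := winlen_le t (ltW del0).
  move=> /(ler_wpM2r hp) h; apply: (le_trans h).
  lra.
have inv T : (T0 <= T)%N -> W T <= A * (T.+1%:R : R) `^ (- sg) ->
    W (T + winlen del T)%N <= A * ((T + winlen del T).+1%:R : R) `^ (- sg).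
  move=> hT hW; have [_ h] := WD T (T00 _ hT).
  apply: (le_trans h); have hs := sumU _ _ hT (leqnn _).
  have h4 : (1 - c * stepw b tau2 T) * W T <=
      (1 - c * stepw b tau2 T) * (A * (T.+1%:R : R) `^ (- sg)).
    by rewrite ler_wpM2l // subr_ge0 H3.
  have h5 := powS_shift_ge T (winlen del T) (ltW sgp).
  have h6 : sg * (winlen del T)%:R / T.+1%:R <= c * stepw b tau2 T / 2.
    have -> : c * stepw b tau2 T / 2 = (c * b / 2) * T.+1%:R `^ (- tau2).
      by rewrite stepwE; lra.
    apply: le_trans (H1 _ hT).
    rewrite powSD powR_inv1 //.
    have := winlen_le T (ltW del0) => h7.
    rewrite mulrA ler_wpM2r ?invr_ge0 //.
    have := ler_wpM2l (ltW sgp) h7; lra.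
  have h7 := H2 _ hT.
  have e7 : (c * b / 2) * T.+1%:R `^ (- sg - tau2) = (c * stepw b tau2 T / 2) * T.+1%:R `^ (- sg).
    by rewrite powSD stepwE; ring.
  rewrite e7 in h7.
  have p0 := powS_gt0 T (- sg).
  set p := (T.+1%:R : R) `^ (- sg) in h4 h5 h7 p0 *.
  set q := c * stepw b tau2 T in h4 h6 h7 *.
  have q0 : 0 <= q by rewrite mulr_ge0 // ltW // stepw_gt0.
  have h8 : A * (p * (1 - sg * (winlen del T)%:R / T.+1%:R)) <=
      A * ((T + winlen del T).+1%:R `^ (- sg)).
    by rewrite ler_wpM2l // (le_trans _ A1).
  apply: le_trans h8.
  apply: (le_trans (lerD h4 hs)); apply: (le_trans (lerD (lexx _) h7)).
  set v := sg * _ / _ in h6 *.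
  have : A * (p * v) <= A * (p * (q / 2)).
    by rewrite ler_wpM2l ?(le_trans _ A1) // ler_wpM2l // ltW.
  have : q / 2 * p <= A * (q / 2 * p).
    by rewrite ler_peMl // mulr_ge0 ?divr_ge0 // ltW.
  lra.
have base : W T0 <= A * (T0.+1%:R : R) `^ (- sg).
  rewrite /A mulrDl mul1r -mulrA -powSD subrr powRr0 mulr1 lerDr; exact: powR_ge0.
(* At a time inside a window, the factor 2 covers the inputs received since its start, and [3 ^ sg]
   the replacement of the start [T] by [t]. *)
have all t : (T0 <= t)%N -> W t <= 2 * A * 3 `^ sg * (t.+1%:R : R) `^ (- sg).
  move=> ht.
  have [T [PT /andP[h1 h2] h3]] := @window_cover (winlen del)
    (fun T => W T <= A * (T.+1%:R : R) `^ (- sg)) T0 (fun=> isT) base inv t ht.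
  have [h _] := WD T (T00 _ h1).
  have hk : (t - T <= winlen del T)%N by rewrite leq_subLR.
  have := h _ hk; have := sumU _ _ h1 hk; rewrite subnKC // => h4 h5.
  have h6 := H2 _ h1.
  have e7 : (c * b / 2) * T.+1%:R `^ (- sg - tau2) = (c * stepw b tau2 T / 2) * T.+1%:R `^ (- sg).
    by rewrite powSD stepwE; ring.
  have h7 := H3 _ h1.
  have p0 := powS_gt0 T (- sg).
  have h8 : W t <= 2 * A * (T.+1%:R : R) `^ (- sg).
    rewrite e7 in h6; set p := (T.+1%:R : R) `^ (- sg) in h6 p0 PT *.
    set q := c * stepw b tau2 T in h6 h7.
    have : q * p <= p by rewrite ler_piMl // ltW.
    have : p <= A * p by rewrite ler_peMl // ltW.
    lra.
  apply: (le_trans h8).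
  rewrite -[leRHS]mulrA ler_wpM2l ?mulr_ge0 ?(le_trans _ A1) //.
  have h9 : (t.+1%:R : R) <= 3 * T.+1%:R.
    by apply: (@winlen_end del) => //; rewrite ltW //=; lra.
  rewrite !powRN -[leLHS]mul1r ler_pdivrMr ?powS_gt0 // mulrAC.
  rewrite ler_pdivlMr ?powS_gt0 // mul1r -powRM // ge0_ler_powR ?nnegrE ?mulr_ge0 //.
  lra.
apply: (@squeeze_cvgr _ _ _ _ (fun=> 0)
  (fun t => 2 * A * 3 `^ sg * (t.+1%:R : R) `^ (- (sg - tau0)))).
- exists T0 => // t /= ht; rewrite mulr_ge0 ?powR_ge0 //=.
  have := all _ ht => /(ler_wpM2l (powR_ge0 (t.+1%:R : R) tau0)) h.
  apply: (le_trans h).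
  have -> : - (sg - tau0) = tau0 + - sg by ring.
  by rewrite powSD; lra.
- exact: cvg_cst.
- have := fun h => @cvg_mulc _ (2 * A * 3 `^ sg) _ (@cvg_powSN (sg - tau0) h).
  by rewrite mulr0; apply; lra.
Qed.

(** The mean error [y] is driven by the disagreement [W], which in turn is driven by [y]. The
    invariant keeps [W] a small multiple [kap] of the bound on [y]: then the feedback of [W] cannot
    defeat the contraction [al / 2] of [y], while [bet] dominates everything that a window feeds
    into [W]. Since [g] is nondecreasing, bounds in terms of [g] only relax with time. *)
Lemma small_gain (m : nat -> nat) (y W U g al bet : nat -> R) (C : R) t0 :
  (forall t, (0 < m t)%N) -> 1 <= C ->
  (forall t, 0 <= y t) -> (forall t, 0 <= W t) -> (forall t, 1 <= g t) ->
  (forall t r, (t <= r)%N -> g t <= g r) ->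
  (forall t, 0 <= al t) -> (forall t r, (t <= r)%N -> al r <= al t) ->
  (forall t, (t0 <= t)%N -> al t <= 1) ->
  (forall t, (t0 <= t)%N -> 0 <= bet t <= 1) ->
  (forall t, (t0 <= t)%N -> (m t)%:R * al t * (32 * C ^+ 2) <= bet t) ->
  window_decay m bet U W t0 ->
  (forall t, (t0 <= t)%N -> U t <= C * al t * (y t + W t + g t)) ->
  (forall t, (t0 <= t)%N ->
     y t.+1 <= (1 - al t / 2) * y t + C * al t * (W t + g t)) ->
  exists A, forall t, (t0 <= t)%N -> y t <= A * g t /\ W t <= A * g t.
Proof.
move=> m0 C1 y0 W0 g1 gm al0 alm al1 bet01 mab WD hU hy.
(* The term [4 * C] absorbs the forcing by [g]; the other two make the invariant true at [t0], as
   [kap * (8 * C) = 1]. *)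
pose A := 4 * C + y t0 + 8 * C * W t0.
have CW0 : 0 <= C * W t0 by rewrite mulr_ge0 // (le_trans _ C1).
have A4 : 4 * C <= A by have := y0 t0; rewrite /A; lra.
have A0 : 0 < A by lra.
(* Inside a window [W] may double to [2 * kap * A * g]. The input to [y] is then at most
   [al * g * (A / 4 + C) <= al * g * A / 2], exactly what its contraction removes. *)
pose kap := (8 * C)^-1.
have kapC : kap * C = 8^-1 by rewrite /kap; field; lra.
have kap0 : 0 < kap by rewrite /kap invr_gt0; lra.
have kap1 : kap <= 8^-1.
  by rewrite /kap lef_pV2 ?posrE //; lra.
have g0 t : 0 <= g t by apply: le_trans (g1 t).
(* Inside a window the two bounds are propagated simultaneously: y through its own
   contraction, W by absorbing the accumulated input, which is small against bet. *)
have inside T : (t0 <= T)%N ->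
    (forall t, (t0 <= t <= T)%N -> y t <= A * g t) -> W T <= kap * A * g T ->
    forall k, (k <= m T)%N ->
    (forall t, (t0 <= t <= T + k)%N -> y t <= A * g t) /\
    (forall j, (j <= k)%N -> W (T + j)%N <= 2 * kap * A * g (T + j)%N) /\
    \sum_(T <= r < T + k) U r <= bet T * kap * A * g (T + k)%N.
  move=> hT hyT hWT.
  have sumU k : (k <= m T)%N ->
     (forall j, (j < k)%N -> y (T + j)%N <= A * g (T + j)%N /\
        W (T + j)%N <= 2 * kap * A * g (T + j)%N) ->
     \sum_(T <= r < T + k) U r <= bet T * kap * A * g (T + k)%N.
    move=> km hj.
    have B0 : 0 <= C * al T * (4 * A * g (T + k)%N).
      by rewrite !mulr_ge0 // ?(le_trans _ C1) // ltW.
    apply: (le_trans (sum_window_le B0 km _)).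
      move=> r /andP[Tr rk].
      have rE : (T + (r - T))%N = r by rewrite subnKC.
      have [|h1 h2] := hj (r - T)%N; first by rewrite ltn_subLR.
      rewrite rE in h1 h2.
      have tr : (t0 <= r)%N by exact: leq_trans Tr.
      apply: (le_trans (hU r tr)).
      have gr := gm r (T + k)%N (ltnW rk).
      have h3 : y r + W r + g r <= 4 * A * g (T + k)%N.
        have : A * g r <= A * g (T + k)%N by rewrite ler_wpM2l // ltW.
        have : kap * (A * g r) <= 8^-1 * (A * g r).
          by rewrite ler_wpM2r // mulr_ge0 // ltW.
        have : 1 * g r <= A * g r by rewrite ler_wpM2r //; lra.
        have : 0 <= A * g r by rewrite mulr_ge0 // ltW.
        lra.
      have S0 : 0 <= y r + W r + g r by rewrite !addr_ge0.
      apply: ler_pM => //; first by rewrite mulr_ge0 // (le_trans _ C1).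
      by rewrite ler_wpM2l ?alm // (le_trans _ C1).
    have h := mab T hT.
    (* The constant [32 * C ^+ 2] of the hypothesis is [4 * C / kap]. *)
    have -> : (m T)%:R * (C * al T * (4 * A * g (T + k)%N)) =
       ((m T)%:R * al T * (32 * C ^+ 2)) * (kap * A * g (T + k)%N).
      have -> : 32 * C ^+ 2 = 4 * C / kap by rewrite /kap; field; lra.
      by field; rewrite gt_eqF.
    have : 0 <= kap * A * g (T + k)%N by rewrite !mulr_ge0 // ltW.
    by move=> /ler_wpM2r /(_ _ _ h); lra.
  have betb := bet01 T hT.
  have base : W T <= 2 * kap * A * g T.
    have : 0 <= kap * A * g T by rewrite !mulr_ge0 // ltW.
    lra.
  elim=> [|k IH] km.
    split; first by move=> t; rewrite addn0; exact: hyT.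
    split; first by move=> j; rewrite leqn0 => /eqP ->; rewrite addn0.
    rewrite addn0 big_geq // !mulr_ge0 // ?(ltW kap0) ?(ltW A0) //; lra.
  have [h1 [h2 h3]] := IH (ltnW km).
  have sU := sumU _ km.
  have {}sU : \sum_(T <= r < T + k.+1) U r <= bet T * kap * A * g (T + k.+1)%N.
    apply: sU => j; rewrite ltnS => jk; split; last exact: h2.
    by apply: h1; rewrite leq_add2l jk andbT (leq_trans hT) // leq_addr.
  split.
    move=> t; case/andP => ht; rewrite addnS leq_eqVlt => /orP[/eqP->|].
      have tk : (t0 <= T + k)%N by rewrite (leq_trans hT) // leq_addr.
      apply: (le_trans (hy _ tk)).
      have hyk := h1 (T + k)%N; rewrite tk leqnn in hyk; have {}hyk := hyk isT.
      have hWk := h2 k (leqnn k).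
      have gS := gm _ _ (leqnSn (T + k)%N).
      set a := al (T + k)%N; set G := g (T + k)%N in hyk hWk gS *.
      have a0 : 0 <= a by exact: al0.
      have a1 : a <= 1 by exact: al1.
      have G0 : 0 <= G by exact: g0.
      have e1 : (1 - a / 2) * y (T + k)%N <= (1 - a / 2) * (A * G).
        by rewrite ler_wpM2l //; lra.
      have e2 : C * a * (W (T + k)%N + G) <= C * a * (2 * kap * A * G + G).
        by rewrite ler_wpM2l ?lerD2r // mulr_ge0 // (le_trans _ C1).
      have e3 : C * a * (2 * kap * A * G + G) = a * G * (A / 4 + C).
        have -> : C * a * (2 * kap * A * G + G) = a * G * (2 * (kap * C) * A + C) by ring.
        by rewrite kapC; congr (_ * (_ + _)); lra.
      have e4 : a * G * (A / 4 + C) <= a * G * (A / 2).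
        by rewrite ler_wpM2l ?mulr_ge0 //; lra.
      have : A * G <= A * g (T + k).+1 by rewrite ler_wpM2l // ltW.
      lra.
    by rewrite ltnS => h; apply: h1; rewrite ht.
  split => // j; rewrite leq_eqVlt => /orP[/eqP->|]; last by rewrite ltnS; exact: h2.
  have [w _] := WD T hT.
  apply: (le_trans (w _ km)).
  have gS := gm T (T + k.+1)%N (leq_addr _ _).
  have kA : 0 <= kap * A by rewrite mulr_ge0 // ltW.
  have : kap * A * g T <= kap * A * g (T + k.+1)%N by rewrite ler_wpM2l.
  have : bet T * (kap * A * g (T + k.+1)%N) <= 1 * (kap * A * g (T + k.+1)%N).
    by rewrite ler_wpM2r //; [rewrite mulr_ge0|case/andP: betb].
  lra.
pose P T := (forall t, (t0 <= t <= T)%N -> y t <= A * g t) /\ W T <= kap * A * g T.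
have P0 : P t0.
  split.
    move=> t h; have -> : t = t0 by apply/eqP; rewrite eqn_leq andbC.
    have : A * 1 <= A * g t0 by rewrite ler_wpM2l // ltW.
    have : y t0 <= A by rewrite /A; lra.
    lra.
  have : W t0 <= kap * A.
    have -> : kap * A = 4 * (kap * C) + kap * y t0 + 8 * (kap * C) * W t0.
      by rewrite /A; ring.
    rewrite kapC; have : 0 <= kap * y t0 by rewrite mulr_ge0 // ltW.
    lra.
  have : kap * A * 1 <= kap * A * g t0 by rewrite ler_wpM2l // mulr_ge0 // ltW.
  lra.
have PS T : (t0 <= T)%N -> P T -> P (T + m T)%N.
  move=> hT [h1 h2]; have [h3 [h4 h5]] := inside T hT h1 h2 _ (leqnn _).
  split => //; have [_ w] := WD T hT; apply: (le_trans w).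
  have betb := bet01 T hT.
  have gS := gm T (T + m T)%N (leq_addr _ _).
  have kA : 0 <= kap * A by rewrite mulr_ge0 // ltW.
  have e1 : (1 - bet T) * W T <= (1 - bet T) * (kap * A * g (T + m T)%N).
    rewrite ler_wpM2l //; first by case/andP: betb; lra.
    by apply: (le_trans h2); rewrite ler_wpM2l.
  lra.
exists A => t ht.
have [T [[PT1 PT2] /andP[h1 h2] h3]] := window_cover m0 P0 PS ht.
have hk : (t - T <= m T)%N by rewrite leq_subLR.
have [h4 [h5 _]] := inside T h1 PT1 PT2 _ hk.
split; first by apply: h4; rewrite ht subnKC // leqnn.
have := h5 _ (leqnn _); rewrite subnKC // => h; apply: (le_trans h).
have : 0 <= A * g t by rewrite mulr_ge0 // ltW.
have : kap * (A * g t) <= 8^-1 * (A * g t).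
  by rewrite ler_wpM2r // mulr_ge0 // ltW.
lra.
Qed.

(** Since [tau <= 1], the step is at least [a / (t+1)], and t^-a decays no faster than the factors
    [1 - a / (t+1)] allow. Hence [eps / 2 + A * t^-a] is an invariant bound on the error once the
    input stays within [eps / 2] of its limit. *)
Lemma averaging_cvg (a tau : R) (y v : nat -> R) (l : R) :
  0 < a -> 0 < tau <= 1 ->
  (forall t, y t.+1 = (1 - stepw a tau t) * y t + stepw a tau t * v t) ->
  v @ \oo --> l -> y @ \oo --> l.
Proof.
move=> a0 /andP[tau0 tau1] hy hv; apply/cvgrPdist_le => eps eps0.
have eps2 : 0 < eps / 2 by lra.
have [t1 _ H1] : \forall t \near \oo, `|l - v t| <= eps / 2.
  by move/cvgrPdist_le: hv; exact.
have [t2 _ H2] : \forall t \near \oo, a * (t.+1%:R : R) `^ (- tau) <= 1 * t.+1%:R `^ 0.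
  by apply: near_powS_le => //; lra.
pose t0 := maxn t1 t2.
pose A := `|l - y t0| * (t0.+1%:R : R) `^ a.
have step t : (t0 <= t)%N -> `|l - y t| <= eps / 2 + A * (t.+1%:R : R) `^ (- a) ->
    `|l - y t.+1| <= eps / 2 + A * (t.+2%:R : R) `^ (- a).
  move=> ht IH.
  have h1 : `|l - v t| <= eps / 2.
    by apply: H1; rewrite /= (leq_trans _ ht) // leq_maxl.
  have h2 : stepw a tau t <= 1.
    have := H2 t; rewrite /= (leq_trans _ ht) ?leq_maxr // => /(_ isT).
    by rewrite powRr0 mulr1 stepwE.
  have s0 : 0 < stepw a tau t by exact: stepw_gt0.
  have h3 : a / t.+1%:R <= stepw a tau t.
    rewrite /stepw ler_wpM2l ?(ltW a0) // lef_pV2 ?posrE ?powS_gt0 ?ltr0n //.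
    by rewrite ler1_powR // ler1n.
  have h4 := powS_shift_ge t 1 (ltW a0); rewrite addn1 mulr1 in h4.
  have A0 : 0 <= A by rewrite mulr_ge0 // powR_ge0.
  have -> : l - y t.+1 = (1 - stepw a tau t) * (l - y t) + stepw a tau t * (l - v t).
    by rewrite hy; ring.
  apply: (le_trans (ler_normD _ _)).
  rewrite [X in X + _]normrM [X in _ + X]normrM (ger0_norm (ltW s0)).
  have s1 : 0 <= 1 - stepw a tau t by lra.
  rewrite (ger0_norm s1).
  set p := (t.+1%:R : R) `^ (- a) in IH h4.
  have p0 : 0 < p by exact: powS_gt0.
  set s := stepw a tau t in s0 h2 h3 *.
  have e1 : (1 - s) * `|l - y t| <= (1 - s) * (eps / 2 + A * p).
    by rewrite ler_wpM2l //; lra.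
  have e2 : s * `|l - v t| <= s * (eps / 2) by rewrite ler_wpM2l // ltW.
  have e3 : A * (p * (1 - a / t.+1%:R)) <= A * (t.+2%:R `^ (- a)).
    by rewrite ler_wpM2l.
  have e4 : (A * p) * (a / t.+1%:R) <= (A * p) * s.
    by rewrite ler_wpM2l // mulr_ge0 // ltW.
  move: e3 e4; set q := a / _; set p' := _ `^ _ => e3 e4.
  lra.
have all t : (t0 <= t)%N -> `|l - y t| <= eps / 2 + A * (t.+1%:R : R) `^ (- a).
  elim: t => [|t IH].
    rewrite leqn0 => /eqP e; rewrite -{1}e /A -mulrA e -powSD subrr powRr0 mulr1.
    lra.
  rewrite leq_eqVlt => /orP[/eqP e|h]; last by apply: step => //; exact: IH.
  rewrite -{1}e /A -mulrA e -powSD subrr powRr0 mulr1.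
  lra.
have [t3 _ H3] : \forall t \near \oo, A * (t.+1%:R : R) `^ (- a) <= (eps / 2) * t.+1%:R `^ 0.
  by apply: near_powS_le => //; lra.
exists (maxn t0 t3) => // t /=; rewrite geq_max => /andP[h1 h2].
apply: (le_trans (all _ h1)).
have := H3 _ h2; rewrite powRr0; lra.
Qed.

End Rates.

(** * Entrywise convergence of matrices *)

Section MatrixSequences.
Variable R : realType.

Definition mxcvg m n (A : nat -> 'M[R]_(m, n)) (B : 'M[R]_(m, n)) :=
  forall i j, (fun t => A t i j) @ \oo --> B i j.

Lemma cvg_sumr (I : Type) (r : seq I) (P : pred I) (f : I -> nat -> R) (l : I -> R) :
  (forall i, P i -> f i @ \oo --> l i) ->
  (fun t => \sum_(i <- r | P i) f i t) @ \oo --> \sum_(i <- r | P i) l i.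
Proof.
move=> h; elim: r => [|i r IH].
  by rewrite big_nil; under eq_fun do rewrite big_nil; exact: cvg_cst.
rewrite big_cons; under eq_fun do rewrite big_cons.
by case: (boolP (P i)) => Pi //; apply: cvgD => //; exact: h.
Qed.

Lemma cvg_prodr (I : Type) (r : seq I) (P : pred I) (f : I -> nat -> R) (l : I -> R) :
  (forall i, P i -> f i @ \oo --> l i) ->
  (fun t => \prod_(i <- r | P i) f i t) @ \oo --> \prod_(i <- r | P i) l i.
Proof.
move=> h; elim: r => [|i r IH].
  by rewrite big_nil; under eq_fun do rewrite big_nil; exact: cvg_cst.
rewrite big_cons; under eq_fun do rewrite big_cons.
by case: (boolP (P i)) => Pi //; apply: cvgM => //; exact: h.
Qed.

Lemma mxcvg_cst m n (A : 'M[R]_(m, n)) : mxcvg (fun=> A) A.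
Proof. by move=> i j; exact: cvg_cst. Qed.

Lemma mxcvgD m n (A B : nat -> 'M[R]_(m, n)) A' B' :
  mxcvg A A' -> mxcvg B B' -> mxcvg (fun t => A t + B t) (A' + B').
Proof.
move=> hA hB i j; rewrite mxE; under eq_fun do rewrite mxE.
by apply: cvgD; [exact: hA|exact: hB].
Qed.

Lemma mxcvgZ m n (A : nat -> 'M[R]_(m, n)) A' c : mxcvg A A' ->
  mxcvg (fun t => c *: A t) (c *: A').
Proof.
move=> hA i j; rewrite mxE; under eq_fun do rewrite mxE.
exact: cvg_mulc.
Qed.

Lemma mxcvg_scalar m (c : nat -> R) (l : R) : c @ \oo --> l ->
  mxcvg (fun t => (c t)%:M : 'M[R]_m) l%:M.
Proof.
move=> hc i j; rewrite mxE; under eq_fun do rewrite mxE.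
case: (i == j); rewrite ?mulr1n ?mulr0n; first exact: hc.
exact: cvg_cst.
Qed.

Lemma mxcvgM m n p (A : nat -> 'M[R]_(m, n)) (B : nat -> 'M[R]_(n, p)) A' B' :
  mxcvg A A' -> mxcvg B B' -> mxcvg (fun t => A t *m B t) (A' *m B').
Proof.
move=> hA hB i j; rewrite mxE; under eq_fun do rewrite mxE.
by apply: cvg_sumr => k _; apply: cvgM; [exact: hA|exact: hB].
Qed.

Lemma mxcvg_sum m n (I : finType) (A : I -> nat -> 'M[R]_(m, n)) A' :
  (forall i, mxcvg (A i) (A' i)) ->
  mxcvg (fun t => \sum_i A i t) (\sum_i A' i).
Proof.
move=> hA i j; rewrite summxE; under eq_fun do rewrite summxE.
by apply: cvg_sumr => k _; exact: hA.
Qed.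

Lemma cvg_det m (A : nat -> 'M[R]_m) A' : mxcvg A A' ->
  (fun t => \det (A t)) @ \oo --> \det A'.
Proof.
move=> hA; apply: cvg_sumr => s _; apply: cvg_mulc.
by apply: cvg_prodr => i _; exact: hA.
Qed.

Lemma mxcvg_adj m (A : nat -> 'M[R]_m) A' : mxcvg A A' ->
  mxcvg (fun t => \adj (A t)) (\adj A').
Proof.
move=> hA i j; rewrite mxE; under eq_fun do rewrite mxE.
rewrite /cofactor; apply: cvg_mulc; apply: cvg_det => k l.
by rewrite !mxE; under eq_fun do rewrite !mxE; exact: hA.
Qed.

Lemma mxcvg_inv m (A : nat -> 'M[R]_m) A' : A' \in unitmx -> mxcvg A A' ->
  mxcvg (fun t => invmx (A t)) (invmx A').
Proof.
move=> uA hA i j.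
have dA := cvg_det hA.
have nz : \det A' != 0 by move: uA; rewrite unitmxE unitfE.
rewrite /invmx uA mxE.
(* [invmx] returns a singular matrix unchanged, so the adjugate formula holds only once the
   determinants have come close to that of [A']. *)
have ev : \forall t \near \oo, (\det (A t))^-1 * \adj (A t) i j = invmx (A t) i j.
  move/cvgrPdist_lt: dA => /(_ `|\det A'|); rewrite normr_gt0 => /(_ nz).
  apply: filterS => t ht.
  have uAt : A t \in unitmx.
    rewrite unitmxE unitfE; apply: contraTN ht => /eqP ->.
    by rewrite subr0 ltxx.
  by rewrite /invmx uAt [RHS]mxE.
apply: cvg_trans; first by apply: near_eq_cvg; exact: ev.
by apply: cvgM; [exact: cvgV|exact: mxcvg_adj].
Qed.

(** The entrywise l1 norm is submultiplicative and, on columns, a sum over coordinates; it therefore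
    fits a total disagreement that is itself summed over coordinates. *)
Definition norm1 m n (A : 'M[R]_(m, n)) : R := \sum_i \sum_j `|A i j|.

Lemma norm1_ge0 m n (A : 'M[R]_(m, n)) : 0 <= norm1 A.
Proof. by apply: sumr_ge0 => i _; exact: sumr_ge0. Qed.

Lemma norm1_le_entry m n (A : 'M[R]_(m, n)) i j : `|A i j| <= norm1 A.
Proof.
rewrite /norm1 (bigD1 i) //= (bigD1 j) //= -addrA lerDl addr_ge0 //.
  exact: sumr_ge0.
by apply: sumr_ge0 => k _; exact: sumr_ge0.
Qed.

Lemma norm1D m n (A B : 'M[R]_(m, n)) : norm1 (A + B) <= norm1 A + norm1 B.
Proof.
rewrite /norm1 -big_split /=; apply: ler_sum => i _.
rewrite -big_split /=; apply: ler_sum => j _; rewrite mxE; exact: ler_normD.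
Qed.

Lemma norm1Z m n c (A : 'M[R]_(m, n)) : norm1 (c *: A) = `|c| * norm1 A.
Proof.
rewrite /norm1 mulr_sumr; apply: eq_bigr => i _; rewrite mulr_sumr.
by apply: eq_bigr => j _; rewrite mxE normrM.
Qed.

Lemma norm1N m n (A : 'M[R]_(m, n)) : norm1 (- A) = norm1 A.
Proof. by rewrite -scaleN1r norm1Z normrN1 mul1r. Qed.

Lemma norm1B m n (A B : 'M[R]_(m, n)) : norm1 (A - B) <= norm1 A + norm1 B.
Proof. by rewrite -(norm1N B); exact: norm1D. Qed.

Lemma norm1_sum m n (I : finType) (A : I -> 'M[R]_(m, n)) :
  norm1 (\sum_i A i) <= \sum_i norm1 (A i).
Proof.
elim/big_rec2: _ => [|i y A' _ h].
  by rewrite /norm1 big1 // => i _; rewrite big1 // => j _; rewrite mxE normr0.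
by apply: (le_trans (norm1D _ _)); rewrite lerD2l.
Qed.

Lemma norm1M m n p (A : 'M[R]_(m, n)) (B : 'M[R]_(n, p)) :
  norm1 (A *m B) <= norm1 A * norm1 B.
Proof.
apply: (@le_trans _ _ (\sum_i \sum_k \sum_j (`|A i j| * `|B j k|))).
  apply: ler_sum => i _; apply: ler_sum => k _; rewrite mxE.
  apply: (le_trans (ler_norm_sum _ _ _)); apply: ler_sum => j _.
  by rewrite normrM.
rewrite /norm1 mulr_suml; apply: ler_sum => i _.
rewrite exchange_big /= mulr_suml; apply: ler_sum => j _.
rewrite -mulr_sumr ler_wpM2l // (bigD1 j) //= lerDl.
by apply: sumr_ge0 => k _; exact: sumr_ge0.
Qed.

Lemma norm1_cvg m n (A : nat -> 'M[R]_(m, n)) B : mxcvg A B ->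
  (fun t => norm1 (A t)) @ \oo --> norm1 B.
Proof.
by move=> h; apply: cvg_sumr => i _; apply: cvg_sumr => j _; apply: cvg_norm; exact: h.
Qed.

Lemma cvgr_bounded (u : nat -> R) (l : R) : u @ \oo --> l ->
  exists2 C : R, 0 <= C & forall t, `|u t| <= C.
Proof.
move=> h; have := cvg_seq_bounded (cvgP _ h).
move=> [M [_ /(_ (M + 1))]]; rewrite ltrDl ltr01 => /(_ isT) hb.
have C0 : `|u 0%N| <= M + 1 by exact: hb.
by exists (M + 1) => [|t]; [exact: le_trans C0|exact: hb].
Qed.

Lemma mxcvg_bounded m n (A : nat -> 'M[R]_(m, n)) B : mxcvg A B ->
  exists2 C : R, 0 <= C & forall t, norm1 (A t) <= C.
Proof.
move=> /norm1_cvg /cvgr_bounded[C C0 hC]; exists C => // t.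
exact: le_trans (ler_norm _) (hC t).
Qed.

End MatrixSequences.

(** * Consensus and the estimation recursion on one path *)

Section Consensus.
Variables (R : realType) (N : nat) (A : nat -> rel 'I_N) (e : rel 'I_N).
Variables (b tau2 del : R) (tW : nat).
Hypotheses (N0 : (0 < N)%N) (sA : forall r, symmetric (A r)).
Hypothesis e_connected : forall i j, connect e i j.
Hypothesis e_window : forall t, (tW <= t)%N -> forall i j, e i j ->
  exists2 r, (t <= r < t + winlen del t)%N & A r i j.
Hypotheses (b0 : 0 < b) (tau20 : 0 < tau2) (tau21 : tau2 <= 1).
Hypotheses (del0 : 0 < del) (deltau : del < tau2).

Definition disagreement (z : 'I_N -> R) := l2norm (centered z).

(** 24 = 8 * 3: the 8 is that of [window_contraction], and the 3 comes from comparing the steps of a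
    window with its first one. *)
Definition mixing_rate : R := (24 * N%:R ^+ 4)^-1.

Lemma mixing_rate_gt0 : 0 < mixing_rate.
Proof. by rewrite invr_gt0 mulr_gt0 // exprn_gt0 // ltr0n. Qed.

(** The time [t0] is chosen before the trajectory, so one value serves all entries of G and all
    coordinates of x. It exists because a window carries total weight of order t^(del - tau2), which
    vanishes as [del < tau2]. *)
Lemma consensus_window_decay : exists t0, forall (z u : nat -> 'I_N -> R),
  (forall r i, z r.+1 i = lapstep (A r) (stepw b tau2 r) (z r) i + u r i) ->
  window_decay (winlen del) (fun t => mixing_rate * stepw b tau2 t)
    (fun t => l2norm (u t)) (fun t => disagreement (z t)) t0.
Proof.
have N3 : 0 < (8 * N%:R ^+ 3)^-1 :> R.
  by rewrite invr_gt0 mulr_gt0 // exprn_gt0 // ltr0n.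
have [t1 _ H1] : \forall t \near \oo, (2 * b) * (t.+1%:R : R) `^ (del - tau2)
    <= (8 * N%:R ^+ 3)^-1 * t.+1%:R `^ 0.
  by apply: near_powS_le => //; rewrite subr_lt0.
have [t2 _ H2] : \forall t \near \oo, (b * N%:R) * (t.+1%:R : R) `^ (- tau2)
    <= 2^-1 * t.+1%:R `^ 0.
  by apply: near_powS_le; rewrite ?invr_gt0 // oppr_lt0.
exists (maxn tW (maxn t1 t2)) => z u hz t; rewrite !geq_max => /and3P[htW ht1 ht2].
set bt := stepw b tau2.
have bt0 r : 0 <= bt r by rewrite ltW // stepw_gt0.
have btN r : (t <= r)%N -> bt r * N%:R <= 2^-1.
  move=> tr; have := H2 r; rewrite /= (leq_trans ht2 tr) => /(_ isT).
  rewrite powRr0 mulr1 /bt stepwE; lra.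
(* Centering commutes with a Laplacian step, so the centered state obeys the same recursion and has
   the zero sum that [window_contraction] asks for. *)
pose zc r i := centered (z r) i; pose uc r i := centered (u r) i.
have hzc r : zc r.+1 =1 fun i => lapstep (A r) (bt r) (zc r) i + uc r i.
  move=> i; rewrite -centered_lapstep // -centeredD /zc /centered.
  by congr (_ - _ * _); [exact: hz|apply: eq_bigr => j _; exact: hz].
have win_le : \sum_(t <= r < t + winlen del t) bt r <= (8 * N%:R ^+ 3)^-1.
  have h := sum_window_le (bt0 t) (leqnn (winlen del t)).
  apply: (le_trans (h _ _ _)) => [r /andP[tr _]|].
    by apply: stepw_le => //; exact: ltW.
  have := H1 t ht1; rewrite powRr0 mulr1 powSD /bt stepwE => h1.
  apply: le_trans h1.
  have := winlen_le t (ltW del0); move=> /(ler_wpM2r (powR_ge0 (t.+1%:R : R) (- tau2))).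
  move=> /(ler_wpM2l (ltW b0)); lra.
have [z' [z't z'S z'n]] := perturbed_flow sA bt0
  (fun r (h : (t <= r < t + winlen del t)%N) => btN r (proj1 (andP h)))
  (fun r (_ : (t <= r < t + winlen del t)%N) => hzc r).
have uc_le j : \sum_(t <= r < t + j) l2norm (uc r) <= \sum_(t <= r < t + j) l2norm (u r).
  by apply: ler_sum => r _; exact: centered_l2norm.
split=> [k km|].
  apply: (le_trans (z'n k km)); apply: lerD => //.
  rewrite /disagreement -(eq_l2norm z't).
  apply: (lapstep_flow_l2norm sA bt0 _ z'S km) => r /andP[tr _]; exact: btN.
apply: (le_trans (z'n _ (leqnn _))); apply: lerD => //.
have -> : mixing_rate * bt t = bt t / 3 / (8 * N%:R ^+ 4).
  by rewrite /mixing_rate; field; rewrite pnatr_eq0 -lt0n.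
rewrite /disagreement -(eq_l2norm z't).
apply: (window_contraction sA bt0 N0 e_connected _ z'S win_le).
- by move=> i j; exact: e_window.
- move=> r /andP[_ hr]; apply: (@stepw_win _ _ _ del); rewrite ?(ltW b0) ?(ltW tau20) //.
    by rewrite (ltW del0) /= ltW //; exact: lt_le_trans tau21.
  exact: ltnW.
- by rewrite divr_ge0.
- by rewrite (eq_bigr _ (fun i _ => z't i)); exact: centered_sum0.
Qed.

End Consensus.

(** The gains couple the coordinates of the error, so only the sum of their disagreements satisfies
    a closed estimate. *)
Lemma window_decay_sum (R : realType) (I : finType) (m : nat -> nat) (bet : nat -> R)
  (U W : I -> nat -> R) t0 : (forall i, window_decay m bet (U i) (W i) t0) ->
  window_decay m bet (fun t => \sum_i U i t) (fun t => \sum_i W i t) t0.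
Proof.
move=> h t ht; split=> [k km|].
  rewrite exchange_big /= -big_split /=; apply: ler_sum => i _.
  by have [h1 _] := h i t ht; exact: h1.
rewrite exchange_big /= mulr_sumr -big_split /=; apply: ler_sum => i _.
by have [_ h1] := h i t ht.
Qed.

(** * The gain and estimate recursions along a fixed path *)

Section Pathwise.
Variables (R : realType) (N M : nat) (Md : 'I_N -> nat).
Variables (H : forall n : 'I_N, 'M[R]_(Md n, M)) (theta : 'cV[R]_M).
Variables (zeta : forall n : 'I_N, nat -> 'cV[R]_(Md n)).
Variables (Rn : forall n : 'I_N, 'M[R]_(Md n)).
Variables (A : nat -> rel 'I_N) (e : rel 'I_N).
Variables (a b tau1 tau2 del p tau0 Cz : R) (gamma : nat -> R) (tW : nat).
Variables (x : 'I_N -> nat -> 'cV[R]_M) (G : 'I_N -> nat -> 'M[R]_M).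
Variables (Q : forall n : 'I_N, nat -> 'M[R]_(Md n)).

Hypotheses (N0 : (0 < N)%N) (sA : forall r, symmetric (A r)).
Hypothesis e_connected : forall i j, connect e i j.
Hypothesis e_window : forall t, (tW <= t)%N -> forall i j, e i j ->
  exists2 r, (t <= r < t + winlen del t)%N & A r i j.
Hypotheses (a0 : 0 < a) (b0 : 0 < b) (tau20 : 0 < tau2) (tau11 : tau1 <= 1).
Hypotheses (del0 : 0 < del) (deltau : del < tau2) (deltau1 : del + tau2 < 1).
Hypotheses (p0 : 0 < p) (tau00 : 0 <= tau0).
Hypothesis slack : tau0 < tau1 - p - tau2 - del.

Let S := N%:R^-1 *: \sum_(n < N) (H n)^T *m invmx (Rn n) *m H n.

Hypothesis RnU : forall n, Rn n \in unitmx.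
Hypothesis SU : S \in unitmx.
Hypothesis gamma0 : gamma @ \oo --> (0 : R).
Hypothesis Qcvg : forall n, mxcvg (Q n) (Rn n).
Hypothesis zeta_le : forall n t, norm1 (zeta n t) <= Cz * t.+1%:R `^ p.

Hypothesis Hx : forall n t, x n t.+1 =
  x n t - stepw b tau2 t *: (\sum_(l < N | A t n l) (x n t - x l t))
  + stepw a tau1 t *: (gain (G n t) (H n) (Q n t) (gamma t)
      *m (H n *m theta + zeta n t - H n *m x n t)).
Hypothesis HG : forall n t, G n t.+1 =
  G n t - stepw b tau2 t *: (\sum_(l < N | A t n l) (G n t - G l t))
  + stepw a tau1 t *: ((H n)^T *m invmx (Q n t + (gamma t)%:M) *m H n - G n t).

Let D n t := (H n)^T *m invmx (Q n t + (gamma t)%:M) *m H n.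
Let al := stepw a tau1.
Let bt := stepw b tau2.

Lemma mxcvg_regularized m (B : nat -> 'M[R]_m) B' : mxcvg B B' ->
  mxcvg (fun t => B t + (gamma t)%:M) B'.
Proof.
move=> h; rewrite -[B']addr0 -(raddf0 (@scalar_mx R m)).
by apply: mxcvgD => //; exact: mxcvg_scalar.
Qed.

Lemma innovation_gain_cvg n : mxcvg (D n) ((H n)^T *m invmx (Rn n) *m H n).
Proof.
apply: mxcvgM; last exact: mxcvg_cst.
apply: mxcvgM; first exact: mxcvg_cst.
by apply: mxcvg_inv => //; exact: mxcvg_regularized.
Qed.

Lemma step_entry m1 m2 (B X Y : 'M[R]_(m1, m2)) c c' k l :
  (B - c *: X + c' *: Y) k l = B k l - c * X k l + c' * Y k l.
Proof. by rewrite !mxE. Qed.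

Lemma lap_entry m1 m2 (B : 'I_N -> 'M[R]_(m1, m2)) t n k l :
  (\sum_(j < N | A t n j) (B n - B j)) k l = lap (A t) (fun n => B n k l) n.
Proof. by rewrite summxE; apply: eq_bigr => j _; rewrite !mxE. Qed.

Lemma tau10 : 0 < tau1. Proof. by move: slack tau00 p0 tau20 del0; lra. Qed.

Lemma al_gt0 t : 0 < al t. Proof. exact: stepw_gt0. Qed.

Lemma G_entry n t k l : G n t.+1 k l =
  lapstep (A t) (bt t) (fun n => G n t k l) n + al t * (D n t k l - G n t k l).
Proof.
have eB (X Y : 'M[R]_M) : (X - Y) k l = X k l - Y k l by rewrite !mxE.
by rewrite HG step_entry lap_entry eB.
Qed.

(** Once the steps are small, each new entry is a convex combination of the old entries of the
    agents and of a bounded input, so a common bound persists. [B] also covers the finitely many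
    earlier times. *)
Lemma G_bounded k l : exists C : R, forall n t, `|G n t k l| <= C.
Proof.
have hD n : exists2 C : R, 0 <= C & forall t, norm1 (D n t) <= C.
  exact: mxcvg_bounded (@innovation_gain_cvg n).
have [CD CDge0 hCD] : exists2 C : R, 0 <= C & forall n t, norm1 (D n t) <= C.
  have h n := cid2 (hD n).
  exists (\sum_n s2val (h n)) => [|n t].
    by apply: sumr_ge0 => n _; exact: s2valP (h n).
  apply: (le_trans (s2valP' (h n) t)); rewrite (bigD1 n) //= lerDl.
  by apply: sumr_ge0 => j _; exact: s2valP (h j).
have [t1 _ H1] : \forall t \near \oo, (b * N%:R) * (t.+1%:R : R) `^ (- tau2)
    <= 2^-1 * t.+1%:R `^ 0.
  by apply: near_powS_le; rewrite ?invr_gt0 // oppr_lt0.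
have [t2 _ H2] : \forall t \near \oo, a * (t.+1%:R : R) `^ (- tau1)
    <= 2^-1 * t.+1%:R `^ 0.
  by apply: near_powS_le; rewrite ?invr_gt0 // oppr_lt0; exact: tau10.
pose t0 := maxn t1 t2.
pose B := CD + \sum_(t < t0.+1) \sum_n `|G n t k l|.
have B0 t n : (t <= t0)%N -> `|G n t k l| <= B.
  move=> ht; rewrite /B (bigD1 (Ordinal (ht : (t < t0.+1)%N))) //= (bigD1 n) //=.
  have h1 : 0 <= \sum_(i < N | i != n) `|G i t k l| by exact: sumr_ge0.
  have h2 : 0 <= \sum_(i < t0.+1 | i != Ordinal (ht : (t < t0.+1)%N)) \sum_n `|G n i k l|.
    by apply: sumr_ge0 => j _; exact: sumr_ge0.
  lra.
have CDB : CD <= B.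
  by rewrite /B lerDl; apply: sumr_ge0 => j _; exact: sumr_ge0.
have Bge0 : 0 <= B by exact: le_trans CDB.
exists B => n t; elim: t n => [|t IH] n; first exact: B0.
case: (leqP t.+1 t0) => [|ht]; first exact: B0.
rewrite ltnS geq_max in ht; case/andP: ht => ht1 ht2.
have bN : bt t * N%:R <= 2^-1.
  have := H1 t ht1; rewrite powRr0 mulr1 /bt stepwE; lra.
have aN : al t <= 2^-1.
  have := H2 t ht2; rewrite powRr0 mulr1 /al stepwE; lra.
have al0 := al_gt0 t.
have bt0 : 0 < bt t by exact: stepw_gt0.
have DB : `|D n t k l| <= B.
  by apply: le_trans CDB; apply: le_trans (hCD n t); exact: norm1_le_entry.
set q := #|[pred j | A t n j]|.
have qN : q%:R <= N%:R :> R by rewrite ler_nat -[leqRHS]card_ord max_card.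
have -> : G n t.+1 k l = (1 - bt t * q%:R - al t) * G n t k l
    + bt t * (\sum_(j < N | A t n j) G j t k l) + al t * D n t k l.
  rewrite G_entry /lapstep /lap sumrB sumr_const -[_ *+ _]mulr_natl -/q.
  ring.
have sB : `|\sum_(j < N | A t n j) G j t k l| <= q%:R * B.
  apply: (le_trans (ler_norm_sum _ _ _)).
  have -> : q%:R * B = \sum_(j < N | A t n j) B by rewrite sumr_const mulr_natl.
  by apply: ler_sum => j _; exact: IH.
have btq : bt t * q%:R <= bt t * N%:R by rewrite ler_wpM2l // ltW.
have c0 : 0 <= 1 - bt t * q%:R - al t by lra.
apply: (le_trans (ler_normD _ _)).
apply: (le_trans (lerD (ler_normD _ _) (lexx _))).
rewrite !(normrM (_ - _ - _)) !(normrM (bt t)) !(normrM (al t)).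
rewrite (ger0_norm c0) (gtr0_norm bt0) (gtr0_norm al0).
have e1 := ler_wpM2l c0 (IH n).
have e2 := ler_wpM2l (ltW bt0) sB.
have e3 := ler_wpM2l (ltW al0) DB.
lra.
Qed.

Lemma centered_mean (z : 'I_N -> R) n : z n = centered z n + N%:R^-1 * \sum_j z j.
Proof. by rewrite /centered subrK. Qed.

Lemma mean_lapstep (z u : 'I_N -> R) t :
  N%:R^-1 * \sum_n (lapstep (A t) (bt t) z n + u n) =
  N%:R^-1 * \sum_n z n + N%:R^-1 * \sum_n u n.
Proof. by rewrite big_split sumrB /= -mulr_sumr lap_sum0 // mulr0 subr0 mulrDr. Qed.

Lemma stepw_tau1E t : al t = a * t.+1%:R `^ (- tau1).
Proof. exact: stepwE. Qed.

Lemma tau2_le1 : tau2 <= 1. Proof. by move: deltau1 del0; lra. Qed.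

Let consensus := consensus_window_decay N0 sA e_connected e_window b0 tau20
  tau2_le1 del0 deltau.

Lemma G_cvg n : mxcvg (G n) S.
Proof.
move=> k l; have [t0 CW] := consensus.
pose z t n := G n t k l; pose u t n := al t * (D n t k l - G n t k l).
have WD := CW z u (fun t n => G_entry n t k l).
have [CG hG] := G_bounded k l.
have hD m : exists2 C : R, 0 <= C & forall t, norm1 (D m t) <= C.
  exact: mxcvg_bounded (@innovation_gain_cvg m).
have h m := cid2 (hD m).
pose C := \sum_m (s2val (h m) + CG).
have CG0 : 0 <= CG by exact: le_trans (hG n 0%N).
have C0 : 0 <= C by apply: sumr_ge0 => m _; rewrite addr_ge0 //; exact: s2valP (h m).
(* The leak [- al t * G] is counted as input too; boundedness of G is what makes this input
   O(t^-tau1). *)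
have U_le t : (t0 <= t)%N -> l2norm (u t) <= a * C * t.+1%:R `^ (- tau1).
  move=> _; apply: (le_trans (l2norm_le_sum _)).
  rewrite mulrAC -stepwE mulr_sumr; apply: ler_sum => m _.
  rewrite /u normrM (gtr0_norm (al_gt0 t)) ler_wpM2l ?(ltW (al_gt0 t)) //.
  apply: (le_trans (ler_normB _ _)); apply: lerD; last exact: hG.
  exact: le_trans (norm1_le_entry _ _ _) (s2valP' (h m) t).
have aC0 : 0 <= a * C by rewrite mulr_ge0 // ltW.
have sl : 0 < tau1 - tau2 - del by move: slack tau00 p0; lra.
have := window_rate b0 (mixing_rate_gt0 _ N0) tau20 del0 deltau1 WD
  (fun t => l2norm_ge0 _) U_le aC0 (lexx 0) sl.
under eq_fun do rewrite powRr0 mul1r.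
move=> Wcvg.
have ccvg : (fun t => centered (z t) n) @ \oo --> (0 : R).
  apply/norm_cvg0P; apply: (squeeze_cvgr _ (@cvg_cst _ _ _ _ _) Wcvg).
  by apply: nearW => t; rewrite normr_ge0 /=; exact: le_l2norm.
have mcvg : (fun t => N%:R^-1 * \sum_j z t j) @ \oo --> S k l.
  apply: (@averaging_cvg _ a tau1 _ (fun t => N%:R^-1 * \sum_n D n t k l)) => //.
  - by rewrite tau10.
  - move=> t; rewrite (eq_bigr _ (fun n _ => G_entry n t k l)) mean_lapstep.
    by rewrite -mulr_sumr sumrB -/al; ring.
  - rewrite /S mxE summxE; apply: cvg_mulc; apply: cvg_sumr => m _.
    exact: innovation_gain_cvg.
rewrite -[S k l]add0r.
have -> : (fun t => G n t k l) = (fun t => centered (z t) n + N%:R^-1 * \sum_j z t j).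
  by apply/funext => t; rewrite -centered_mean.
exact: cvgD.
Qed.

Let K n t := gain (G n t) (H n) (Q n t) (gamma t).

Lemma K_cvg n : mxcvg (K n) (invmx S *m (H n)^T *m invmx (Rn n)).
Proof.
apply: mxcvgM; last by apply: mxcvg_inv => //; exact: mxcvg_regularized.
apply: mxcvgM; last exact: mxcvg_cst.
by apply: mxcvg_inv => //; apply: mxcvg_regularized; exact: G_cvg.
Qed.

Let Kmean t := N%:R^-1 *: \sum_n K n t *m H n.

Lemma Kmean_cvg : mxcvg Kmean 1%:M.
Proof.
have -> : 1%:M = N%:R^-1 *: \sum_n (invmx S *m (H n)^T *m invmx (Rn n) *m H n).
  rewrite -(mulVmx SU) {2}/S -scalemxAr mulmx_sumr; congr (_ *: _).
  by apply: eq_bigr => n _; rewrite !mulmxA.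
apply: mxcvgZ; apply: mxcvg_sum => n; apply: mxcvgM; last exact: mxcvg_cst.
exact: K_cvg.
Qed.

Let err n t := x n t - theta.
Let ebar t := N%:R^-1 *: \sum_n err n t.
Let inp n t := K n t *m (zeta n t - H n *m err n t).

Lemma err_entry n t k : err n t.+1 k 0 =
  lapstep (A t) (bt t) (fun n => err n t k 0) n + al t * inp n t k 0.
Proof.
have eB (X Y : 'cV[R]_M) : (X - Y) k 0 = X k 0 - Y k 0 by rewrite !mxE.
rewrite /err eB Hx step_entry lap_entry /inp -/(K n t) /err.
have -> : H n *m theta + zeta n t - H n *m x n t = zeta n t - H n *m (x n t - theta).
  rewrite mulmxBr; move: (H n *m theta) (H n *m x n t) => X Y.
  by apply/matrixP => i j; rewrite !mxE; ring.
rewrite /lapstep eB.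
have -> : lap (A t) (fun n0 => (x n0 t - theta) k 0) n = lap (A t) (fun n0 => x n0 t k 0) n.
  by apply: eq_bigr => j _; rewrite !eB; ring.
by rewrite -/al -/bt; ring.
Qed.

Lemma ebar_entry t k : ebar t k 0 = N%:R^-1 * \sum_n err n t k 0.
Proof. by rewrite mxE summxE. Qed.

(** Writing each error as the mean plus a deviation isolates the averaged gain [Kmean], which tends
    to the identity. What remains is driven by noise and deviations alone. *)
Lemma ebarS t : ebar t.+1 = (1 - al t) *: ebar t - al t *: ((Kmean t - 1%:M) *m ebar t)
  + al t *: (N%:R^-1 *: \sum_n K n t *m (zeta n t - H n *m (err n t - ebar t))).
Proof.
have -> : ebar t.+1 = ebar t + al t *: (N%:R^-1 *: \sum_n inp n t).
  apply/matrixP => k j; rewrite ord1 ebar_entry.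
  rewrite (eq_bigr _ (fun n _ => err_entry n t k)) mean_lapstep -ebar_entry.
  have eD (X Y : 'cV[R]_M) c c' : (X + c *: (c' *: Y)) k 0 = X k 0 + c * (c' * Y k 0).
    by rewrite !mxE.
  by rewrite eD summxE -mulr_sumr mulrCA.
have -> : N%:R^-1 *: \sum_n inp n t =
   N%:R^-1 *: (\sum_n K n t *m (zeta n t - H n *m (err n t - ebar t)))
   - Kmean t *m ebar t.
  rewrite /Kmean -scalemxAl mulmx_suml -scalerBr -sumrB; congr (_ *: _).
  apply: eq_bigr => n _; rewrite /inp -(mulmxA (K n t) (H n)) -mulmxBr; congr (_ *m _).
  rewrite (mulmxBr (H n) (err n t) (ebar t)).
  move: (H n *m ebar t) (H n *m err n t) => X Y.
  by apply/matrixP => i j; rewrite !mxE; ring.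
rewrite mulmxBl mul1mx; set X := N%:R^-1 *: _; set Y := Kmean t *m _.
move: X Y (ebar t) => X Y E.
by apply/matrixP => i j; rewrite !mxE; ring.
Qed.

Lemma norm1_col m (v : 'cV[R]_m) : norm1 v = \sum_i `|v i 0|.
Proof. by apply: eq_bigr => i _; rewrite big_ord1. Qed.

Let W t := \sum_k disagreement (fun n => err n t k 0).

Lemma W_ge0 t : 0 <= W t.
Proof. by apply: sumr_ge0 => k _; exact: l2norm_ge0. Qed.

Lemma dev_le n t : norm1 (err n t - ebar t) <= W t.
Proof.
rewrite norm1_col; apply: ler_sum => k _.
have -> : (err n t - ebar t) k 0 = centered (fun n => err n t k 0) n.
  have eB (X Y : 'cV[R]_M) : (X - Y) k 0 = X k 0 - Y k 0 by rewrite !mxE.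
  by rewrite eB ebar_entry.
exact: (le_l2norm (centered _)).
Qed.

Lemma err_le n t : norm1 (err n t) <= norm1 (ebar t) + W t.
Proof.
have -> : err n t = ebar t + (err n t - ebar t) by rewrite addrC subrK.
by apply: (le_trans (norm1D _ _)); rewrite lerD2l; exact: dev_le.
Qed.

Lemma pathwise_consensus n l :
  (fun t => t.+1%:R `^ tau0 * vnorm (x n t - x l t)) @ \oo --> (0 : R).
Proof.
have [tC CW] := consensus.
have hK m := cid2 (mxcvg_bounded (@K_cvg m)).
(* One constant for both recursions: it dominates the gains and their products with [H], and the
   leading 1 gives [1 <= C]. *)
pose C := 1 + \sum_m s2val (hK m) * (1 + norm1 (H m)).
have ck0 m : 0 <= s2val (hK m) by exact: s2valP (hK m).
have hn0 m := norm1_ge0 (H m).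
have C1 : 1 <= C.
  by rewrite lerDl; apply: sumr_ge0 => m _; rewrite mulr_ge0 // addr_ge0.
have C0 : 0 <= C by exact: le_trans C1.
(* The noise envelope, enlarged so that [1 <= g] holds whatever the sign and size of [Cz]. *)
pose g t : R := (1 + `|Cz|) * t.+1%:R `^ p.
have g1 t : 1 <= g t.
  rewrite -[leLHS]mulr1; apply: ler_pM => //; first by rewrite lerDl.
  by apply: powS_ge1; exact: ltW.
have g0 t : 0 <= g t by exact: le_trans (g1 t).
have gm t r : (t <= r)%N -> g t <= g r.
  move=> tr; rewrite ler_wpM2l ?addr_ge0 // ge0_ler_powR ?nnegrE ?ler_nat //.
  exact: ltW.
have zg m t : norm1 (zeta m t) <= g t.
  apply: (le_trans (zeta_le m t)); rewrite ler_wpM2r ?powR_ge0 //.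
  by apply: (le_trans (ler_norm _)); rewrite lerDr.
pose y t := norm1 (ebar t).
have y0 t : 0 <= y t by exact: norm1_ge0.
have W0 := W_ge0.
pose U t := \sum_k l2norm (fun n => al t * inp n t k 0).
have al0 t := ltW (al_gt0 t).
have U_le t : U t <= C * al t * (y t + W t + g t).
  apply: (@le_trans _ _ (al t * \sum_m norm1 (inp m t))).
    apply: (@le_trans _ _ (\sum_k \sum_m al t * `|inp m t k 0|)).
      apply: ler_sum => k _; apply: (le_trans (l2norm_le_sum _)).
      by apply: ler_sum => m _; rewrite normrM (ger0_norm (al0 t)).
    rewrite exchange_big /= mulr_sumr; apply: ler_sum => m _.
    by rewrite norm1_col mulr_sumr.
  rewrite -mulrA mulrCA ler_wpM2l // /C mulrDl mul1r mulr_suml.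
  rewrite -[leLHS]add0r; apply: lerD; first by rewrite !addr_ge0.
  apply: ler_sum => m _; apply: (le_trans (norm1M _ _)).
  rewrite -mulrA; apply: ler_pM; rewrite ?norm1_ge0 //; first exact: (s2valP' (hK m)).
  apply: (le_trans (norm1B _ _)).
  have h1 := zg m t; have h2 := norm1M (H m) (err m t); have h3 := err_le m t.
  have h4 := ler_wpM2l (hn0 m) h3.
  have h5 : 0 <= norm1 (H m) * g t by rewrite mulr_ge0.
  rewrite -/(y t) in h4; have := y0 t; have := W0 t; lra.
have [t1 _ H1] : \forall t \near \oo, a * (t.+1%:R : R) `^ (- tau1) <= 1 * t.+1%:R `^ 0.
  by apply: near_powS_le; rewrite ?ltr01 // oppr_lt0; exact: tau10.
have mu0 := mixing_rate_gt0 R N0.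
have [t2 _ H2] : \forall t \near \oo,
    (mixing_rate R N * b) * (t.+1%:R : R) `^ (- tau2) <= 1 * t.+1%:R `^ 0.
  by apply: near_powS_le; rewrite ?ltr01 // oppr_lt0.
have [t3 _ H3] : \forall t \near \oo,
    (2 * a * (32 * C ^+ 2)) * (t.+1%:R : R) `^ (del - tau1)
      <= (mixing_rate R N * b) * t.+1%:R `^ (- tau2).
  apply: near_powS_le; last by rewrite mulr_gt0.
  by move: slack tau00 p0; lra.
(* Within distance 1/2 of the identity, the averaged gain leaves the mean error the contraction
   factor [1 - al + al / 2 = 1 - al / 2]. *)
have [t4 _ H4] : \forall t \near \oo, norm1 (Kmean t - 1%:M) <= 2^-1.
  have h : mxcvg (fun t => Kmean t - 1%:M) (1%:M - 1%:M).
    by apply: mxcvgD; [exact: Kmean_cvg|exact: mxcvg_cst].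
  have {h} := norm1_cvg h; rewrite subrr (_ : norm1 0 = 0); last first.
    by rewrite /norm1 big1 // => i _; rewrite big1 // => j _; rewrite mxE normr0.
  move=> /cvgrPdist_le /(_ 2^-1); rewrite invr_gt0 ltr0n => /(_ isT).
  by apply: filterS => t; rewrite sub0r normrN ger0_norm // norm1_ge0.
pose T0 := maxn tC (maxn t1 (maxn t2 (maxn t3 t4))).
have TM t : (T0 <= t)%N -> [/\ (tC <= t)%N, (t1 <= t)%N, (t2 <= t)%N, (t3 <= t)%N & (t4 <= t)%N].
  by rewrite !geq_max => /and5P.
have WD : window_decay (winlen del) (fun t => mixing_rate R N * bt t) U W T0.
  have h : window_decay (winlen del) (fun t => mixing_rate R N * bt t) U W tC.
    apply: (@window_decay_sum _ _ _ _ (fun k t => l2norm (fun n => al t * inp n t k 0))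
      (fun k t => disagreement (fun n => err n t k 0))) => k.
    apply: (CW (fun t n => err n t k 0) (fun t n => al t * inp n t k 0)) => r i.
    exact: err_entry.
  by move=> t /TM[ht _ _ _ _]; exact: h.
have al1 t : (T0 <= t)%N -> al t <= 1.
  move=> /TM[_ /H1 + _ _ _].
  by rewrite /= powRr0 mulr1 -stepwE.
have bt0 t : 0 < bt t by exact: stepw_gt0.
have [B hB] : exists B, forall t, (T0 <= t)%N -> y t <= B * g t /\ W t <= B * g t.
  apply: (@small_gain _ (winlen del) y W U g al (fun t => mixing_rate R N * bt t) C) => //.
  - by move=> t r; apply: stepw_le; rewrite ltW // tau10.
  - move=> t /TM[_ _ /H2 + _ _].
    rewrite /= powRr0 mulr1 -mulrA -stepwE => ->.
    by rewrite mulr_ge0 // ltW.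
  - move=> t /TM[_ _ _ /H3 /= + _].
    rewrite -[in leRHS]mulrA -stepwE; apply: le_trans.
    rewrite powSD stepw_tau1E.
    have h := winlen_le t (ltW del0).
    have h' : 0 <= a * (t.+1%:R : R) `^ (- tau1) * (32 * C ^+ 2).
      by rewrite !mulr_ge0 ?powR_ge0 // ltW.
    by have := ler_wpM2r h' h; lra.
  - move=> t ht; rewrite [y t.+1]/y ebarS.
    have [_ _ _ _ /H4 /= hK4] := TM t ht.
    have a1 := al1 t ht; have alt := al0 t.
    apply: (le_trans (norm1D _ _)); apply: (@le_trans _ _
      ((1 - al t) * y t + al t * (2^-1 * y t) + C * al t * (W t + g t))); last by lra.
    apply: lerD.
      apply: (le_trans (norm1B _ _)).
      rewrite (norm1Z _ (ebar t)) (norm1Z _ (_ *m _)).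
      have c1 : 0 <= 1 - al t by lra.
      rewrite (ger0_norm c1) (ger0_norm alt) lerD2l ler_wpM2l //.
      by apply: (le_trans (norm1M _ _)); exact: ler_wpM2r (y0 t) _ _ hK4.
    rewrite norm1Z (ger0_norm alt) -mulrA mulrCA ler_wpM2l // norm1Z.
    have Ni : `|N%:R^-1| <= 1 :> R.
      by rewrite ger0_norm ?invr_ge0 // invf_le1 ?ltr0n // ler1n.
    apply: (@le_trans _ _ (1 * \sum_m norm1 (K m t *m (zeta m t - H m *m (err m t - ebar t))))).
      by apply: ler_pM => //; [exact: norm1_ge0|exact: norm1_sum].
    rewrite mul1r /C mulrDl mul1r mulr_suml.
    rewrite -[leLHS]add0r; apply: lerD; first by rewrite !addr_ge0.
    apply: ler_sum => m _; apply: (le_trans (norm1M _ _)).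
    rewrite -mulrA; apply: ler_pM; rewrite ?norm1_ge0 //; first exact: (s2valP' (hK m)).
    apply: (le_trans (norm1B _ _)).
    have h1 := zg m t; have h2 := norm1M (H m) (err m t - ebar t).
    have h3 := ler_wpM2l (hn0 m) (dev_le m t).
    have h5 : 0 <= norm1 (H m) * g t by rewrite mulr_ge0.
    have := W0 t; lra.
pose C' := C * a * ((2 * B + 1) * (1 + `|Cz|)).
have B0 : 0 <= B.
  have [h _] := hB T0 (leqnn _).
  have := le_trans (y0 T0) h; rewrite pmulr_lge0 //; exact: lt_le_trans (g1 T0).
have C'0 : 0 <= C'.
  apply: mulr_ge0; first by rewrite mulr_ge0 // ltW.
  by apply: mulr_ge0; rewrite addr_ge0 // mulr_ge0.
have U_rate t : (T0 <= t)%N -> U t <= C' * t.+1%:R `^ (- (tau1 - p)).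
  move=> ht; apply: (le_trans (U_le t)); have [h1 h2] := hB t ht.
  have -> : C' * t.+1%:R `^ (- (tau1 - p)) = C * al t * ((2 * B + 1) * g t).
    rewrite opprB addrC powSD stepw_tau1E /C' /g; ring.
  apply: ler_wpM2l; first exact: mulr_ge0.
  have -> : (2 * B + 1) * g t = B * g t + B * g t + g t by ring.
  by rewrite lerD2r lerD.
have sl : tau0 < (tau1 - p) - tau2 - del by exact: slack.
have Wcvg := window_rate b0 mu0 tau20 del0 deltau1 WD W0 U_rate C'0 tau00 sl.
have key t : vnorm (x n t - x l t) <= 2 * W t.
  apply: (@le_trans _ _ (\sum_k `|(x n t - x l t) k 0|)).
    exact: (l2norm_le_sum (fun k => (x n t - x l t) k 0)).
  rewrite mulr_sumr; apply: ler_sum => k _.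
  have eB (X Y : 'cV[R]_M) : (X - Y) k 0 = X k 0 - Y k 0 by rewrite !mxE.
  set z := fun n => err n t k 0.
  have -> : (x n t - x l t) k 0 = centered z n - centered z l.
    by rewrite eB /centered /z /err !eB; ring.
  have h1 := le_l2norm (centered z) n; have h2 := le_l2norm (centered z) l.
  by apply: (le_trans (ler_normB _ _)); rewrite /disagreement; lra.
apply: (@squeeze_cvgr _ _ _ _ (fun=> 0) (fun t => 2 * (t.+1%:R `^ tau0 * W t))).
- apply: nearW => t; rewrite mulr_ge0 ?powR_ge0 ?sqrtr_ge0 //=.
  by rewrite mulrCA ler_wpM2l ?powR_ge0.
- exact: cvg_cst.
- by have := cvg_mulc (c := 2) Wcvg; rewrite mulr0.
Qed.

End Pathwise.

(** * Borel-Cantelli and the strong law *)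

Section SummablePowers.
Variable R : realType.

(** Discrete form of the comparison of the sum with an integral. With [v = 1 / (t+2)] it reduces to
    Bernoulli's inequality [1 + x * v <= (1 - v)^-x]. *)
Lemma powS_telescope t (x : R) : 0 < x ->
  x * t.+2%:R `^ (- (1 + x)) <= t.+1%:R `^ (- x) - t.+2%:R `^ (- x).
Proof.
move=> x0.
have s0 : 0 < t.+2%:R :> R by rewrite ltr0n.
have e1 : (t.+1%:R : R) = t.+2%:R * (1 - t.+2%:R^-1).
  by rewrite mulrBr mulr1 divff ?gt_eqF // -[in RHS]natr1 addrK.
have v1 : t.+2%:R^-1 < 1 :> R by rewrite invf_lt1 // ltr1n.
have v0 : 0 < t.+2%:R^-1 :> R by rewrite invr_gt0.
rewrite e1 powRM ?subr_ge0 ?(ltW v1) //.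
rewrite opprD powSD powR_inv1 //.
set v := t.+2%:R^-1 in v0 v1 *; set p := t.+2%:R `^ _.
have p0 : 0 < p by exact: powS_gt0.
suff h : 1 + x * v <= (1 - v) `^ (- x).
  by have := ler_wpM2l (ltW p0) h; lra.
rewrite /powR gt_eqF ?subr_gt0 //.
apply: (le_trans (expR_ge1Dx _)); rewrite ler_expR mulNr -mulrN ler_wpM2l ?(ltW x0) //.
have := @le_ln1Dx _ (- v); rewrite ltrN2 => /(_ v1); lra.
Qed.

Lemma sum_powS_le (e : R) n : 1 < e ->
  \sum_(0 <= t < n) (t.+1%:R : R) `^ (- e) <= 1 + (e - 1)^-1.
Proof.
move=> e1; set x := e - 1.
have x0 : 0 < x by rewrite subr_gt0.
have eE : e = 1 + x by rewrite /x; ring.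
case: n => [|n].
  by rewrite big_geq // addr_ge0 // invr_ge0 ltW.
have h : \sum_(0 <= t < n.+1) (t.+1%:R : R) `^ (- e) <= 1 + (1 - n.+1%:R `^ (- x)) / x.
  elim: n => [|n IH]; first by rewrite big_nat1 !powR1 subrr mul0r addr0.
  rewrite big_nat_recr //=; apply: (le_trans (lerD IH (lexx _))).
  rewrite -addrA lerD2l eE -lerBrDl -mulrBl ler_pdivlMr // mulrC.
  by apply: (le_trans (powS_telescope n x0)); lra.
apply: (le_trans h); rewrite lerD2l -[leRHS]mul1r ler_wpM2r ?invr_ge0 ?(ltW x0) //.
Qed.

End SummablePowers.

Section AlmostSure.
Local Open Scope ereal_scope.
Context (d : measure_display) (T : measurableType d) (R : realType) (P : probability T R).

Lemma borel_cantelli_powS (E : nat -> set T) (C e : R) :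
  (forall n, measurable (E n)) -> (0 <= C)%R -> (1 < e)%R ->
  (forall n, P (E n) <= (C * n.+1%:R `^ (- e))%:E) ->
  {ae P, forall w, \forall n \near \oo, ~ E n w}.
Proof.
move=> mE C0 e1 hE.
have sumE : \sum_(n <oo) P (E n) < +oo.
  apply: (@le_lt_trans _ _ (C * (1 + (e - 1)^-1))%:E); last exact: ltry.
  apply: lime_le; first exact: is_cvg_nneseries.
  apply: nearW => n.
  apply: (@le_trans _ _ (\sum_(0 <= t < n) (C * t.+1%:R `^ (- e))%:E)).
    by apply: lee_sum => t _; exact: hE.
  rewrite sumEFin lee_fin -mulr_sumr ler_wpM2l //; exact: sum_powS_le.
have z := lim_sup_set_cvg0 mE sumE.
exists (lim_sup_set E); split => //.
  apply: bigcap_measurableType => n _; apply: bigcup_measurable => k _; exact: mE.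
move=> w /= nh n _.
apply: contrapT => hn; apply: nh; exists n => // k /= nk Ek.
by apply: hn; exists k.
Qed.

Lemma measurable_powR_comp (f : T -> R) (x : R) : measurable_fun setT f ->
  measurable_fun setT (fun w => (f w `^ x)%R).
Proof. by move=> mf; exact: (measurableT_comp (measurable_powR x) mf). Qed.

Lemma measurable_superlevel (f : T -> R) (c : R) : measurable_fun setT f ->
  measurable [set w | (c <= f w)%R].
Proof.
move=> mf; rewrite (_ : [set w | _] = f @^-1` `[c, +oo[%classic); last first.
  by apply/seteqP; split => w; rewrite /= in_itv /= andbT.
by rewrite -[X in measurable X]setTI; apply: mf => //; exact: measurable_itv.
Qed.

Lemma markov_ge0 (f : T -> R) (c : R) : measurable_fun setT f ->
  (forall w, 0 <= f w)%R -> (0 < c)%R ->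
  P [set w | (c <= f w)%R] <= c^-1%:E * \int[P]_w (f w)%:E.
Proof.
move=> mf f0 c0.
have mE : measurable [set w | (c <= f w)%R] by exact: measurable_superlevel.
rewrite lee_pdivlMl //.
rewrite -(setIT [set w | _]) -integral_indic // -ge0_integralZl_EFin //; last 2 first.
- by apply/measurable_EFinP; exact: measurable_indic.
- exact: ltW.
apply: ge0_le_integral => //.
- by move=> w _; rewrite mule_ge0 // lee_fin // ltW.
- apply: measurable_funeM; apply/measurable_EFinP; exact: measurable_indic.
- by apply/measurable_EFinP.
move=> w _; rewrite -EFinM lee_fin indicE.
by case: (boolP (w \in _)); rewrite ?inE /= ?mulr1 ?mulr0.
Qed.

Lemma expect_le (f g : T -> R) : measurable_fun setT f -> measurable_fun setT g ->
  (forall w, 0 <= f w)%R -> (forall w, f w <= g w)%R ->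
  \int[P]_w (f w)%:E <= \int[P]_w (g w)%:E.
Proof.
move=> mf mg f0 fg; apply: ge0_le_integral => //.
- by move=> w _; rewrite lee_fin.
- exact/measurable_EFinP.
- exact/measurable_EFinP.
- by move=> w _; rewrite lee_fin.
Qed.

Lemma expectD (f g : T -> R) : measurable_fun setT f -> measurable_fun setT g ->
  (forall w, 0 <= f w)%R -> (forall w, 0 <= g w)%R ->
  \int[P]_w (f w + g w)%:E = \int[P]_w (f w)%:E + \int[P]_w (g w)%:E.
Proof.
move=> mf mg f0 g0; under eq_integral do rewrite EFinD.
apply: ge0_integralD => //; try exact/measurable_EFinP.
- by move=> w _; rewrite lee_fin.
- by move=> w _; rewrite lee_fin.
Qed.

Lemma expectZ (c : R) (f : T -> R) : measurable_fun setT f -> (0 <= c)%R ->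
  (forall w, 0 <= f w)%R -> \int[P]_w (c * f w)%:E = c%:E * \int[P]_w (f w)%:E.
Proof.
move=> mf c0 f0; under eq_integral do rewrite EFinM.
apply: ge0_integralZl_EFin => //; last exact/measurable_EFinP.
by move=> w _; rewrite lee_fin.
Qed.

Lemma expect_sum (I : Type) (r : seq I) (f : I -> T -> R) :
  (forall i, measurable_fun setT (f i)) -> (forall i w, 0 <= f i w)%R ->
  \int[P]_w (\sum_(i <- r) f i w)%:E = \sum_(i <- r) \int[P]_w (f i w)%:E.
Proof.
move=> mf f0; under eq_integral do rewrite -sumEFin.
apply: ge0_integral_sum => // i; first exact/measurable_EFinP.
by move=> w _; rewrite lee_fin.
Qed.

Lemma expect_cst (c : R) : \int[P]_w c%:E = c%:E.
Proof.
by rewrite integral_cst // [X in _ * X]probability_setT mule1.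
Qed.

Lemma same_law_integral (X Y : T -> R) (f : R -> R) :
  measurable_fun setT X -> measurable_fun setT Y ->
  (forall B, measurable B -> P (X @^-1` B) = P (Y @^-1` B)) ->
  measurable_fun setT f -> (forall r, 0 <= f r)%R ->
  \int[P]_w (f (X w))%:E = \int[P]_w (f (Y w))%:E.
Proof.
move=> mX mY XY mf f0.
have mf' : measurable_fun setT (fun r => (f r)%:E) by exact/measurable_EFinP.
pose X' : {RV P >-> R} := mfun_Sub (mem_set mX).
pose Y' : {RV P >-> R} := mfun_Sub (mem_set mY).
have h (Z : {RV P >-> R}) :
    \int[P]_w (f (Z w))%:E = \int[distribution P Z]_r (f r)%:E.
  by rewrite ge0_integral_distribution // => r; rewrite lee_fin.
rewrite (h X') (h Y'); apply: eq_measure_integral => B mB _.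
exact: XY.
Qed.

(** Independence fixes the joint law on rectangles, hence identifies it with the product of the
    marginal laws; Tonelli then separates the factors. *)
Lemma indep_integral (X Y : T -> R) :
  measurable_fun setT X -> measurable_fun setT Y ->
  (forall w, 0 <= X w)%R -> (forall w, 0 <= Y w)%R ->
  (forall A B, measurable A -> measurable B ->
    P (X @^-1` A `&` Y @^-1` B) = P (X @^-1` A) * P (Y @^-1` B)) ->
  \int[P]_w (X w * Y w)%:E = (\int[P]_w (X w)%:E) * (\int[P]_w (Y w)%:E).
Proof.
move=> mX mY X0 Y0 XY.
pose X' : {RV P >-> R} := mfun_Sub (mem_set mX).
pose Y' : {RV P >-> R} := mfun_Sub (mem_set mY).
have mZ : measurable_fun setT (fun w => (X w, Y w)) by exact: measurable_fun_pair.
pose Z' : {RV P >-> (R * R)%type} := mfun_Sub (mem_set mZ).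
(* Truncating at 0 makes the integrands nonnegative on all of R. *)
pose f (z : R * R) : \bar R := (Num.max z.1 0 * Num.max z.2 0)%:E.
have mmax : measurable_fun setT (fun r : R => Num.max r 0%R).
  exact: measurable_maxr.
have mf : measurable_fun setT f.
  apply/measurable_EFinP; apply: measurable_funM.
    by apply: (measurableT_comp mmax); exact: measurable_fst.
  by apply: (measurableT_comp mmax); exact: measurable_snd.
have max0 (r : R) : (0 <= Num.max r 0)%R by rewrite le_max lexx orbT.
have f0 z : 0 <= f z by rewrite lee_fin mulr_ge0.
transitivity (\int[distribution P Z']_z f z).
  rewrite ge0_integral_distribution //; apply: eq_integral => w _ /=.
  by rewrite /f /= !max_l.
transitivity (\int[distribution P X' \x distribution P Y']_z f z).
  apply: eq_measure_integral => B mB _; apply/esym.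
  apply: product_measure_unique => // A1 A2 mA1 mA2; exact: XY.
rewrite fubini_tonelli1 // /fubini_F.
have E (V : {RV P >-> R}) : (forall w, 0 <= V w)%R ->
   \int[distribution P V]_r (Num.max r 0)%:E = \int[P]_w (V w)%:E.
  move=> V0; rewrite ge0_integral_distribution; last 2 first.
  - exact/measurable_EFinP.
  - by move=> r; rewrite lee_fin.
  by apply: eq_integral => w _ /=; rewrite max_l.
rewrite /f /=.
under eq_integral => r _.
  under eq_integral do rewrite EFinM.
  rewrite ge0_integralZl //; last 3 first.
  - exact/measurable_EFinP.
  - by move=> z _; rewrite lee_fin.
  - by rewrite lee_fin.
  rewrite (E Y') //; over.
rewrite ge0_integralZr //; last 3 first.
- exact/measurable_EFinP.
- by move=> z _; rewrite lee_fin.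
- by apply: integral_ge0 => w _; rewrite lee_fin Y0.
by rewrite (E X').
Qed.

End AlmostSure.

Lemma floor_index (f : nat -> nat) J n : (forall j, (f j < f j.+1)%N) ->
  (f J <= n)%N -> exists j, [/\ (J <= j)%N, (f j <= n)%N & (n < f j.+1)%N].
Proof.
move=> fS; elim: n => [|n IH] h.
  by exists J; split => //; exact: leq_ltn_trans (fS J).
move: h; rewrite leq_eqVlt => /orP[/eqP h|].
  by exists J; rewrite leqnn -h fS leqnn.
rewrite ltnS => /IH[j [h1 h2 h3]].
move: h3; rewrite leq_eqVlt => /orP[/eqP e|h3].
  by exists j.+1; rewrite e; split; rewrite ?leqnn ?fS // leqW.
by exists j; split => //; exact: leqW.
Qed.

(* Monotonicity fills the gaps, because consecutive values of (j+1)^q have ratio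
   tending to 1. *)
Lemma cvg_mean_subseq (R : realType) (S : nat -> R) (q : nat) (mu : R) :
  (0 < q)%N -> (forall n, 0 <= S n) -> (forall n m, (n <= m)%N -> S n <= S m) ->
  (fun j => S (j.+1 ^ q)%N / (j.+1 ^ q)%:R) @ \oo --> mu ->
  (fun n => S n.+1 / n.+1%:R) @ \oo --> mu.
Proof.
move=> q0 S0 Sm hS.
pose k j := (j.+1 ^ q)%N.
have k0 j : (0 < k j)%N by rewrite expn_gt0.
have kS j : (k j < k j.+1)%N by rewrite ltn_exp2r.
have rho : (fun j => (k j.+1)%:R / (k j)%:R : R) @ \oo --> (1 : R).
  have -> : (fun j => (k j.+1)%:R / (k j)%:R : R) = (fun j => (1 + j.+1%:R^-1) ^+ q).
    apply/funext => j; rewrite /k !natrX -expr_div_n; congr (_ ^+ _).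
    by rewrite -[in LHS]natr1 mulrDl divff ?mul1r // pnatr_eq0.
  have h : (fun j => (1 + j.+1%:R^-1) : R) @ \oo --> (1 + 0 : R).
    apply: cvgD; first exact: cvg_cst.
    have := @cvg_powSN R 1 ltr01; under eq_fun do rewrite powR_inv1 //; exact.
  have hq : forall p, (fun j => (1 + j.+1%:R^-1) ^+ p : R) @ \oo --> ((1 + 0) ^+ p : R).
    elim=> [|p IH]; first by under eq_fun do rewrite expr0; rewrite expr0; exact: cvg_cst.
    by under eq_fun do rewrite exprS; rewrite exprS; exact: cvgM.
  by have := hq q; rewrite addr0 expr1n.
have up : (fun j => S (k j.+1) / (k j)%:R) @ \oo --> mu.
  rewrite -[mu]mulr1.
  have -> : (fun j => S (k j.+1) / (k j)%:R) =
     (fun j => (S (k j.+1) / (k j.+1)%:R) * ((k j.+1)%:R / (k j)%:R)).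
    by apply/funext => j; rewrite mulrA divfK // pnatr_eq0 -lt0n.
  apply: cvgM => //.
  by have := hS; rewrite -(cvg_shiftS (fun j => S (k j) / (k j)%:R)).
have lo : (fun j => S (k j) / (k j.+1)%:R) @ \oo --> mu.
  rewrite -[mu]divr1.
  have -> : (fun j => S (k j) / (k j.+1)%:R) =
     (fun j => (S (k j) / (k j)%:R) * ((k j.+1)%:R / (k j)%:R)^-1).
    by apply/funext => j; rewrite invf_div mulrA divfK // pnatr_eq0 -lt0n.
  by apply: cvgM => //; apply: cvgV => //; exact: oner_neq0.
apply/cvgrPdist_le => eps eps0.
have [J1 _ H1] : \forall j \near \oo, `|mu - S (k j.+1) / (k j)%:R| <= eps.
  by move/cvgrPdist_le: up; exact.
have [J2 _ H2] : \forall j \near \oo, `|mu - S (k j) / (k j.+1)%:R| <= eps.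
  by move/cvgrPdist_le: lo; exact.
exists (k (maxn J1 J2)) => // n /= hn.
have [j [h1 h2 h3]] := floor_index kS (leqW hn : (k (maxn J1 J2) <= n.+1)%N).
move: h1; rewrite geq_max => /andP[/H1 /= e1 /H2 /= e2].
have p (i : nat) : (0 < i)%N -> 0 < i%:R :> R by rewrite ltr0n.
have u : S n.+1 / n.+1%:R <= S (k j.+1) / (k j)%:R.
  apply: ler_pM; rewrite ?invr_ge0 //; first by apply: Sm; exact: ltnW.
  by rewrite lef_pV2 ?posrE ?p // ler_nat.
have l : S (k j) / (k j.+1)%:R <= S n.+1 / n.+1%:R.
  apply: ler_pM; rewrite ?invr_ge0 //; first exact: Sm.
  by rewrite lef_pV2 ?posrE ?p // ler_nat ltnW.
move: e1 e2 u l; move: (S (k j.+1) / _) (S (k j) / _) (S n.+1 / _) => A B C.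
rewrite !ler_norml => /andP[a1 a2] /andP[b1 b2] h4 h5; apply/andP; split; lra.
Qed.

(** * Strong law for nonnegative, pairwise independent variables with a moment of order 1 + eta *)

Section StrongLaw.
Context (d : measure_display) (T : measurableType d) (R : realType) (P : probability T R).
Variables (X : nat -> T -> R) (mu eta m : R).
Hypotheses (eta0 : 0 < eta) (eta1 : eta <= 1).
Hypothesis mX : forall s, measurable_fun setT (X s).
Hypothesis X0 : forall s w, 0 <= X s w.
Hypothesis X_law : forall s B, measurable B -> P (X s @^-1` B) = P (X 0%N @^-1` B).
Hypothesis X_indep : forall s r, (s < r)%N -> forall A B, measurable A -> measurable B ->
  P (X s @^-1` A `&` X r @^-1` B) = (P (X s @^-1` A) * P (X r @^-1` B))%E.
Hypothesis X_mean : (\int[P]_w (X 0%N w)%:E = mu%:E)%E.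
Hypothesis X_moment : (\int[P]_w (X 0%N w `^ (1 + eta))%:E = m%:E)%E.

(** The level [k] is later the number [n] of summands, the same for all of them, so the truncated
    variables remain identically distributed and pairwise independent. *)
Let Z (k : R) s w := Num.min (X s w) k.

Lemma m_ge0 : 0 <= m.
Proof.
rewrite -lee_fin -X_moment; apply: integral_ge0 => w _; rewrite lee_fin; exact: powR_ge0.
Qed.

Lemma mZ (k : R) s : measurable_fun setT (Z k s).
Proof. exact: measurable_minr. Qed.

Lemma Z_ge0 (k : R) s w : 0 <= k -> 0 <= Z k s w.
Proof. by move=> k0; rewrite le_min X0 k0. Qed.

Lemma X_moment_eq s : (\int[P]_w (X s w `^ (1 + eta))%:E = m%:E)%E.
Proof.
rewrite -X_moment.
apply: (@same_law_integral _ _ _ _ (X s) (X 0%N) (fun r => r `^ (1 + eta))) => //.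
- by move=> B; exact: X_law.
- by move=> r; exact: powR_ge0.
Qed.

Definition trunc_mean (k : R) := fine (\int[P]_w (Z k 0%N w)%:E)%E.

Lemma Z_mean (k : R) s : 0 <= k -> (\int[P]_w (Z k s w)%:E = (trunc_mean k)%:E)%E.
Proof.
move=> k0.
have -> : (\int[P]_w (Z k s w)%:E = \int[P]_w (Z k 0%N w)%:E)%E.
  (* Transfer of laws is available for functions that are nonnegative on the whole line; the outer
     maximum changes nothing on the nonnegative values of [X]. *)
  have h (r : nat) : (\int[P]_w (Z k r w)%:E =
      \int[P]_w ((fun r : R => Num.max (Num.min r k) 0) (X r w))%:E)%E.
    by apply: eq_integral => w _ /=; rewrite max_l // Z_ge0.
  rewrite (h s) (h 0%N).
  apply: (@same_law_integral _ _ _ _ (X s) (X 0%N) (fun r : R => Num.max (Num.min r k) 0)) => //.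
  - by move=> B; exact: X_law.
  - by apply: measurable_maxr => //; exact: measurable_minr.
  - by move=> r; rewrite le_max lexx orbT.
rewrite /trunc_mean fineK // ge0_fin_numE; last first.
  by apply: integral_ge0 => w _; rewrite lee_fin Z_ge0.
apply: (@le_lt_trans _ _ (\int[P]_w (X 0%N w)%:E)%E); last by rewrite X_mean ltry.
apply: expect_le => //; first exact: mZ.
- by move=> w; exact: Z_ge0.
- by move=> w; rewrite ge_min lexx.
Qed.

Lemma trunc_mean_ge0 (k : R) : 0 <= k -> 0 <= trunc_mean k.
Proof.
move=> k0; rewrite -lee_fin -(Z_mean 0 k0); apply: integral_ge0 => w _.
by rewrite lee_fin Z_ge0.
Qed.

(** Split the square as [z^(1 - eta) * z^(1 + eta)]; bound the first factor by [k] and the second by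
    [X]. *)
Lemma Z_sq (k : R) s : 0 < k ->
  (\int[P]_w (Z k s w * Z k s w)%:E <= (k `^ (1 - eta) * m)%:E)%E.
Proof.
move=> k0; rewrite EFinM -(X_moment_eq s) -expectZ //; last 3 first.
- exact: measurable_powR_comp.
- exact: powR_ge0.
- by move=> w; exact: powR_ge0.
apply: expect_le.
- by apply: measurable_funM; exact: mZ.
- by apply: measurable_funM => //; exact: measurable_powR_comp.
- by move=> w; rewrite mulr_ge0 // Z_ge0 // ltW.
move=> w; set z := Z k s w.
have z0 : 0 <= z by apply: Z_ge0; exact: ltW.
have zk : z <= k by rewrite ge_min lexx orbT.
have zX : z <= X s w by rewrite ge_min lexx.
have -> : z * z = z `^ (1 - eta) * z `^ (1 + eta).
  have [->|zn] := eqVneq z 0.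
    have e0 : 1 + eta != 0 by rewrite gt_eqF // addr_gt0.
    by rewrite (powR0 e0) !mulr0.
  rewrite -powRD ?zn ?implybT //.
  have -> : 1 - eta + (1 + eta) = 2%:R by ring.
  by rewrite powR_mulrn // expr2.
apply: ler_pM; rewrite ?powR_ge0 //.
  by rewrite ge0_ler_powR ?nnegrE ?(ltW k0) // subr_ge0.
by rewrite ge0_ler_powR ?nnegrE // addr_ge0 // ltW.
Qed.

Lemma Z_prod (k : R) s r : 0 <= k -> s != r ->
  (\int[P]_w (Z k s w * Z k r w)%:E = (trunc_mean k * trunc_mean k)%:E)%E.
Proof.
move=> k0; wlog sr : s r / (s < r)%N => [h|_].
  rewrite neq_ltn => /orP[sr|rs]; first by rewrite h // neq_ltn sr.
  under eq_integral do rewrite mulrC.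
  by rewrite h // neq_ltn rs.
rewrite indep_integral; first by rewrite !Z_mean.
- exact: mZ.
- exact: mZ.
- by move=> w; exact: Z_ge0.
- by move=> w; exact: Z_ge0.
move=> A B mA mB.
have mm : measurable_fun setT (fun r : R => Num.min r k) by exact: measurable_minr.
have pre C : measurable C -> measurable ((fun r : R => Num.min r k) @^-1` C).
  by move=> mC; rewrite -[X in measurable X]setTI; exact: mm.
exact: (X_indep sr (pre _ mA) (pre _ mB)).
Qed.

Lemma trunc_variance (k : R) n : 0 < k ->
  (\int[P]_w ((\sum_(s < n) Z k s w - n%:R * trunc_mean k) ^+ 2)%:E
    <= (n%:R * (k `^ (1 - eta) * m))%:E)%E.
Proof.
move=> k0; have k00 := ltW k0; set z := trunc_mean k.
have z0 : 0 <= z by exact: trunc_mean_ge0.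
pose S w := \sum_(s < n) Z k s w.
have mS : measurable_fun setT S by apply: measurable_sum => s; exact: mZ.
have S0 w : 0 <= S w by apply: sumr_ge0 => s _; exact: Z_ge0.
have ES : (\int[P]_w (S w)%:E = (n%:R * z)%:E)%E.
  rewrite expect_sum; first last.
  - by move=> s w; exact: Z_ge0.
  - by move=> s; exact: mZ.
  rewrite (eq_bigr (fun=> z%:E)); last by move=> s _; rewrite Z_mean.
  by rewrite sumEFin sumr_ord_const.
have ES2 : (\int[P]_w (S w ^+ 2)%:E <= (n%:R * (k `^ (1 - eta) * m) + (n%:R * z) ^+ 2)%:E)%E.
  have -> : (\int[P]_w (S w ^+ 2)%:E =
      \int[P]_w (\sum_(s < n) \sum_(r < n) Z k s w * Z k r w)%:E)%E.
    apply: eq_integral => w _; congr (_%:E); rewrite /S expr2 mulr_suml.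
    by apply: eq_bigr => s _; rewrite mulr_sumr.
  rewrite expect_sum; first last.
  - by move=> s w; apply: sumr_ge0 => r _; rewrite mulr_ge0 // Z_ge0.
  - by move=> s; apply: measurable_sum => r; apply: measurable_funM; exact: mZ.
  apply: (@le_trans _ _ (\sum_(s < n) (k `^ (1 - eta) * m + n%:R * (z * z))%:E)%E).
    apply: lee_sum => s _; rewrite expect_sum; first last.
    - by move=> r w; rewrite mulr_ge0 // Z_ge0.
    - by move=> r; apply: measurable_funM; exact: mZ.
    rewrite (bigD1 s) //= EFinD; apply: leeD; first exact: Z_sq.
    rewrite (eq_bigr (fun=> (z * z)%:E)); last first.
      by move=> r rs; rewrite Z_prod // eq_sym; exact: rs.
    rewrite sumEFin lee_fin -sumr_ord_const [leRHS](bigD1 s) //= lerDr.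
    exact: mulr_ge0.
  rewrite sumEFin lee_fin sumr_ord_const mulrDr.
  by rewrite le_eqVlt; apply/orP; left; apply/eqP; ring.
(* Adding [2 * (n * z) * S] turns the variance identity into one between nonnegative integrands,
   [(S - nz)^2 + 2 nz S = S^2 + (nz)^2], so no signed integral is needed. *)
have key : (\int[P]_w ((S w - n%:R * z) ^+ 2)%:E + (2 * (n%:R * z) ^+ 2)%:E <=
    (n%:R * (k `^ (1 - eta) * m) + 2 * (n%:R * z) ^+ 2)%:E)%E.
  have nz0 : 0 <= n%:R * z by rewrite mulr_ge0.
  have -> : ((2 * (n%:R * z) ^+ 2)%:E = \int[P]_w (2 * (n%:R * z) * S w)%:E)%E.
    by rewrite expectZ // ?ES ?mulr_ge0 // -EFinM; congr (_%:E); ring.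
  rewrite -expectD //; first last.
  - by move=> w; rewrite mulr_ge0 // mulr_ge0.
  - by move=> w; exact: sqr_ge0.
  - exact: measurable_funM.
  - by apply: measurable_funX; exact: measurable_funB.
  have -> : (\int[P]_w ((S w - n%:R * z) ^+ 2 + 2 * (n%:R * z) * S w)%:E =
     \int[P]_w (S w ^+ 2 + (n%:R * z) ^+ 2)%:E)%E.
    by apply: eq_integral => w _; congr (_%:E); ring.
  rewrite expectD //; first last.
  - by move=> w; exact: sqr_ge0.
  - by move=> w; exact: sqr_ge0.
  - exact: measurable_funX.
  rewrite expect_cst.
  have := ES2 => /(leeD2r ((n%:R * z) ^+ 2)%:E) h; apply: (le_trans h).
  by rewrite -EFinD lee_fin; lra.
by move: key; rewrite EFinD leeD2rE.
Qed.

(** Pointwise, [X <= min X k + k^-eta * X^(1 + eta)]: where [X > k], the last term alone exceeds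
    [X]. *)
Lemma trunc_bias (k : R) : 0 < k -> mu - trunc_mean k <= k `^ (- eta) * m.
Proof.
move=> k0; have k00 := ltW k0.
rewrite lerBlDl -lee_fin EFinD -(Z_mean 0 k00) -X_mean EFinM -(X_moment_eq 0).
rewrite -expectZ //; last 3 first.
- exact: measurable_powR_comp.
- exact: powR_ge0.
- by move=> w; exact: powR_ge0.
rewrite -expectD //; first last.
- by move=> w; rewrite mulr_ge0 // powR_ge0.
- by move=> w; exact: Z_ge0.
- by apply: measurable_funM => //; exact: measurable_powR_comp.
- exact: mZ.
apply: expect_le => //.
- apply: measurable_funD; first exact: mZ.
  by apply: measurable_funM => //; exact: measurable_powR_comp.
move=> w; rewrite /Z; case: (leP (X 0%N w) k) => h.
  by rewrite lerDl mulr_ge0 // powR_ge0.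
have x0 : 0 < X 0%N w by exact: lt_trans h.
apply: (@le_trans _ _ (k `^ (- eta) * X 0%N w `^ (1 + eta))); last by rewrite lerDr.
rewrite powRD; last by rewrite (gt_eqF x0) implybT.
rewrite powRr1 ?(ltW x0) // mulrCA ler_peMr ?(ltW x0) //.
rewrite powRN mulrC ler_pdivlMr ?powR_gt0 // mul1r ge0_ler_powR ?nnegrE ?(ltW eta0) //.
exact: ltW.
Qed.

Lemma tail_bound (k : R) s : 0 < k -> (P [set w | (k <= X s w)%R] <= (k `^ (- (1 + eta)) * m)%:E)%E.
Proof.
move=> k0.
have m1 : measurable_fun setT (fun w => X s w `^ (1 + eta)).
  exact: measurable_powR_comp.
have := @markov_ge0 _ _ _ P _ (k `^ (1 + eta)) m1 (fun w => powR_ge0 _ _) (powR_gt0 _ k0).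
rewrite X_moment_eq -EFinM -powRN; apply: le_trans.
have mset (f : T -> R) c := @measurable_superlevel _ T R f c.
apply: le_measure; rewrite ?inE; try exact: mset.
move=> w /= h; rewrite ge0_ler_powR ?nnegrE ?(ltW k0) ?X0 //.
by rewrite addr_ge0 // ltW.
Qed.

Let S n w := \sum_(s < n) X s w.

(** Either some summand reaches the level [n], or the truncated sum deviates by at least half as
    much, the bias taking the other half. The union bound gives [n * n^-(1 + eta)], and Chebyshev
    [n * n^(1 - eta) / n^2]: both are of order n^-eta. *)
Lemma mean_deviation n (eps : R) : (0 < n)%N -> 0 < eps ->
  n%:R `^ (- eta) * m <= eps / 2 ->
  (P [set w | (eps * n%:R <= `|S n w - n%:R * mu|)%R] <=
    ((m + 4 * m / eps ^+ 2) * n%:R `^ (- eta))%:E)%E.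
Proof.
move=> n0 eps0 hn; have k0 : 0 < n%:R :> R by rewrite ltr0n.
set k := n%:R : R in hn k0 *.
have mset (f : T -> R) c := @measurable_superlevel _ T R f c.
have mS : measurable_fun setT (S n) by apply: measurable_sum => s; exact: mX.
pose SZ w := \sum_(s < n) Z k s w.
have mSZ : measurable_fun setT SZ by apply: measurable_sum => s; exact: mZ.
pose D w := (SZ w - k * trunc_mean k) ^+ 2.
have mD : measurable_fun setT D by apply: measurable_funX; exact: measurable_funB.
pose B := \big[setU/set0]_(s < n) [set w | k <= X s w].
pose C := [set w | (eps * k / 2) ^+ 2 <= D w].
have mB : measurable B by apply: bigsetU_measurable => s _; exact: mset.
have mC : measurable C by exact: mset.
have sub : [set w | (eps * k <= `|S n w - k * mu|)%R] `<=` B `|` C.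
  move=> w /= hw; case: (pselect (B w)) => [|nB]; first by left.
  right; rewrite /C /=.
  have XZ (s : 'I_n) : X s w = Z k s w.
    rewrite /Z min_l // leNgt; apply/negP => h; apply: nB.
    by rewrite /B (bigD1 s) //=; left; exact: ltW.
  have SE : S n w = SZ w by apply: eq_bigr => s _; exact: XZ.
  have b := trunc_bias k0.
  have zmu : trunc_mean k <= mu.
    rewrite -lee_fin -X_mean -(Z_mean 0 (ltW k0)); apply: expect_le => //.
    - exact: mZ.
    - by move=> w'; apply: Z_ge0; exact: ltW.
    - by move=> w'; rewrite ge_min lexx.
  have h1 : eps * k / 2 <= `|SZ w - k * trunc_mean k|.
    have : `|S n w - k * mu| <= `|SZ w - k * trunc_mean k| + k * (mu - trunc_mean k).
      rewrite SE.
      have -> : SZ w - k * mu = (SZ w - k * trunc_mean k) - k * (mu - trunc_mean k) by ring.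
      apply: (le_trans (ler_normB _ _)); rewrite lerD2l ger0_norm //.
      by rewrite mulr_ge0 ?(ltW k0) // subr_ge0.
    have : k * (mu - trunc_mean k) <= k * (eps / 2).
      by rewrite ler_wpM2l ?(ltW k0) //; exact: le_trans hn.
    lra.
  rewrite /D -[leRHS](real_normK (num_real _)) ler_pXn2r ?nnegrE //.
  by rewrite divr_ge0 // mulr_ge0 // ltW.
have mE : measurable [set w | (eps * k <= `|S n w - k * mu|)%R].
  apply: mset; apply: measurableT_comp => //; exact: measurable_funB.
apply: (@le_trans _ _ (P (B `|` C))).
  by apply: le_measure; rewrite ?inE //; exact: measurableU.
apply: (le_trans (measureU2 _ mB mC)).
have PB : (P B <= (m * k `^ (- eta))%:E)%E.
  apply: (le_trans (@Boole_inequality _ _ _ P (fun s => [set w | k <= X s w]) n _)).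
    by move=> s _; exact: mset.
  apply: (@le_trans _ _ (\sum_(s < n) (k `^ (- (1 + eta)) * m)%:E)%E).
    by apply: lee_sum => s _; exact: tail_bound.
  rewrite sumEFin lee_fin sumr_ord_const opprD powRD; last by rewrite (gt_eqF k0) implybT.
  by rewrite powR_inv1 ?(ltW k0) // -/k mulrA [_ * (_ * _)]mulrA divff ?gt_eqF // mul1r mulrC.
have PC : (P C <= (4 * m / eps ^+ 2 * k `^ (- eta))%:E)%E.
  have c0 : 0 < (eps * k / 2) ^+ 2 by rewrite exprn_gt0 // divr_gt0 // mulr_gt0.
  apply: (le_trans (@markov_ge0 _ _ _ P D _ mD (fun w => sqr_ge0 _) c0)).
  rewrite lee_pdivrMl //; apply: (le_trans (@trunc_variance k n k0)).
  rewrite -EFinM lee_fin -/k.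
  rewrite powRD; last by rewrite (gt_eqF k0) implybT.
  rewrite powRr1 ?(ltW k0) //.
  rewrite le_eqVlt; apply/orP; left; apply/eqP; field.
  by rewrite gt_eqF.
by rewrite mulrDl EFinD; exact: leeD.
Qed.

Lemma strong_law : {ae P, forall w, (fun n => S n.+1 w / n.+1%:R) @ \oo --> mu}.
Proof.
(* Along [n = (j+1)^q] the deviation probabilities are O(j^-(q * eta)), summable because
   [q * eta >= 2]. *)
pose q := (Num.truncn (2 / eta)).+1.
have q2 : 2 <= q%:R * eta.
  have h : 2 / eta < q%:R by exact: truncnS_gt.
  by rewrite -ler_pdivrMr // ltW.
have kpow j x : ((j.+1 ^ q)%:R : R) `^ x = j.+1%:R `^ (q%:R * x).
  by rewrite natrX -powR_mulrn // -powRrM.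
have sub : {ae P, forall w i, \forall j \near \oo,
    ~ (i.+1%:R^-1 * (j.+1 ^ q)%:R <= `|S (j.+1 ^ q) w - (j.+1 ^ q)%:R * mu|)}.
  apply: ae_foralln => i; set eps := i.+1%:R^-1.
  have eps0 : 0 < eps :> R by rewrite invr_gt0.
  have [j0 _ H0] : \forall j \near \oo,
      m * (j.+1%:R : R) `^ (- (q%:R * eta)) <= (eps / 2) * j.+1%:R `^ 0.
    apply: near_powS_le; last by rewrite divr_gt0.
    by rewrite oppr_lt0; lra.
  (* The bound must hold at every index, whereas [mean_deviation] applies only once the bias is
     small; the early events are made empty. *)
  pose E j := if (j0 <= j)%N then
    [set w | (eps * (j.+1 ^ q)%:R <= `|S (j.+1 ^ q)%N w - (j.+1 ^ q)%:R * mu|)%R] else set0.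
  pose C := m + 4 * m / eps ^+ 2.
  have C0 : 0 <= C.
    by rewrite addr_ge0 ?m_ge0 // divr_ge0 ?sqr_ge0 // mulr_ge0 // m_ge0.
  have hE : {ae P, forall w, \forall j \near \oo, ~ E j w}.
    apply: (@borel_cantelli_powS _ _ _ P E C (q%:R * eta)) => //.
    - move=> j; rewrite /E; case: ifP => // _.
      set f := fun w => `|S (j.+1 ^ q)%N w - (j.+1 ^ q)%:R * mu|.
      have mf : measurable_fun setT f.
        apply: measurableT_comp => //; apply: measurable_funB => //.
        by apply: measurable_sum => s; exact: mX.
      exact: measurable_superlevel mf.
    - lra.
    - move=> j; rewrite /E; case: ifP => hj; last first.
        by rewrite measure0 lee_fin mulr_ge0 // powR_ge0.
      rewrite -(mulrN q%:R eta) -kpow; apply: mean_deviation => //; first by rewrite expn_gt0.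
      by rewrite kpow mulrC mulrN; have := H0 j hj; rewrite powRr0 mulr1.
  move: hE; apply: filterS => w [j1 _ h1]; exists (maxn j0 j1) => // j /=.
  rewrite geq_max => /andP[a1 a2]; have := h1 j a2; rewrite /E a1; exact.
move: sub; apply: filterS => w hw.
apply: (@cvg_mean_subseq _ (S ^~ w) q) => //.
- by move=> n; apply: sumr_ge0.
- move=> n1 n2 n12; rewrite /S -(subnKC n12) big_split_ord /= lerDl.
  by apply: sumr_ge0.
apply/cvgrPdist_lt => eps eps0.
have [i hi] : exists i : nat, i.+1%:R^-1 < eps.
  exists (Num.truncn eps^-1); rewrite -[ltRHS]invrK ltf_pV2 ?posrE ?invr_gt0 //.
  exact: truncnS_gt.
have [j0 _ h0] := hw i; exists j0 => // j /= /h0 /negP; rewrite -ltNge => h.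
have k0 : 0 < (j.+1 ^ q)%:R :> R by rewrite ltr0n expn_gt0.
have -> : mu - S (j.+1 ^ q)%N w / (j.+1 ^ q)%:R =
   - ((S (j.+1 ^ q)%N w - (j.+1 ^ q)%:R * mu) / (j.+1 ^ q)%:R).
  by field; rewrite gt_eqF.
rewrite normrN normrM (gtr0_norm (_ : 0 < (j.+1 ^ q)%:R^-1)) ?invr_gt0 //.
rewrite ltr_pdivrMr //; apply: (lt_trans h).
by rewrite ltr_pM2r.
Qed.

End StrongLaw.

(** * Algebraic connectivity *)

Section Connectivity.

(* Multiplying 'X - A on the left by a basis that starts with a basis of the kernel
   makes the first rows divisible by 'X. *)
Lemma kernel_dvd_char_poly (F : fieldType) n (A : 'M[F]_n) :
  'X^(\rank (kermx A)) %| char_poly A.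
Proof.
set K := kermx A; set r := \rank K.
pose E := row_ebase K.
have EA (i : 'I_n) : (i < r)%N -> row i (E *m A) = 0.
  move=> ir.
  have h : pid_mx r *m (E *m A) = (0 : 'M[F]_n).
    have KA : K *m A = 0 by exact: mulmx_ker.
    move: KA; rewrite -(mulmx_ebase K) -!mulmxA => h.
    by rewrite -[LHS](mulKmx (col_ebase_unit K)) h mulmx0.
  apply/rowP => j; rewrite !mxE.
  move/matrixP/(_ i j): h; rewrite !mxE (bigD1 i) //= big1 ?addr0; last first.
    move=> k ki; rewrite [pid_mx _ _ _]mxE (_ : (i == k :> nat) = false) ?mul0r //.
    by rewrite eq_sym; exact: negbTE ki.
  by rewrite [pid_mx _ _ _]mxE eqxx ir /= mul1r mxE.
pose Ep := map_mx polyC E.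
pose B := Ep *m char_poly_mx A.
pose D := \row_(i < n) (if (i < r)%N then 'X else 1 : {poly F}).
pose B' := \matrix_(i < n, j < n) (if (i < r)%N then (E i j)%:P else B i j).
have BE : B = diag_mx D *m B'.
  apply/matrixP => i j; rewrite mul_diag_mx [RHS]mxE [D 0 i]mxE [B' i j]mxE.
  case: ifP => ir; last by rewrite mul1r.
  rewrite /B /char_poly_mx mulmxBr mul_mx_scalar -map_mxM.
  have := EA i ir => /rowP /(_ j); rewrite mxE [X in _ = X]mxE => e.
  have eB (X Y : 'M[{poly F}]_n) : (X - Y) i j = X i j - Y i j by rewrite !mxE.
  by rewrite eB [X in _ - X]mxE e rmorph0 subr0 !mxE.
have dE : \det Ep = (\det E)%:P by rewrite det_map_mx.
have h : (\det E)%:P * char_poly A = (\prod_i D 0 i) * \det B'.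
  by rewrite -dE /char_poly -det_mulmx -/B BE det_mulmx det_diag.
have uE : \det E != 0 by have := row_ebase_unit K; rewrite unitmxE unitfE.
have -> : 'X^r %| char_poly A = ('X^r %| (\det E)%:P * char_poly A).
  by rewrite mul_polyC dvdpZr.
rewrite h dvdp_mulr //.
have rn : (r <= n)%N by exact: rank_leq_row.
suff -> : \prod_i D 0 i = 'X^r by exact: dvdpp.
rewrite (eq_bigr (fun i : 'I_n => if (i < r)%N then 'X else 1)); last first.
  by move=> i _; rewrite mxE.
by rewrite -big_mkcond /= -(big_ord_widen n (fun=> 'X) rn) prodr_const card_ord.
Qed.

(** A positive [lambda2] excludes the default list of [eigs], whose entry there is 0. So the
    characteristic polynomial does split, and every root but the smallest is positive, which leaves
    0 at most simple. *)
Lemma lambda2_X2_ndvd (R : realType) N (A : 'M[R]_N) : 0 < lambda2 A ->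
  ~~ ('X^2 %| char_poly A).
Proof.
rewrite /lambda2 /eigs; case: xgetP => [s _ [ss ->] |]; last by rewrite ltxx.
case: s ss => [|a0 [|a1 s]] /=; rewrite ?ltxx // => /andP[_ ps] a1_gt0.
have wn : (\prod_(a <- a1 :: s) ('X - a%:P)).[0] != 0.
  rewrite horner_prod prodf_seq_neq0; apply/allP => a ha.
  rewrite hornerXsubC sub0r oppr_eq0 gt_eqF //=; move: ha; rewrite inE.
  case/orP => [/eqP -> //|ha]; apply: (lt_le_trans a1_gt0).
  by have := order_path_min le_trans ps => /allP /(_ _ ha).
apply/negP => /dvdpP[h]; rewrite big_cons => e.
have a00 : a0 = 0.
  have := congr1 (fun p => p.[0]) e.
  rewrite hornerM hornerXsubC sub0r hornerM hornerXn expr0n /= mulr0 => /eqP.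
  by rewrite mulf_eq0 (negPf wn) orbF oppr_eq0 => /eqP.
move: e; rewrite a00 subr0 expr2 mulrCA => /(mulfI (negbT (polyX_eq0 R))) e.
by move: wn; rewrite e hornerM hornerX mulr0 eqxx.
Qed.

(** If [j] cannot be reached from [i], the component of [i] and its complement both have their
    indicators in the kernel. Then 0 would be at least a double root of the characteristic
    polynomial. *)
Lemma lambda2_connected (R : realType) N (A : 'M[R]_N) :
  A^T = A -> (forall i, \sum_j A i j = 0) -> 0 < lambda2 A ->
  forall i j, connect (fun i j => (i != j) && (A i j != 0)) i j.
Proof.
move=> sA rA l2 i j; set e := fun i j => _.
apply/negPn/negP => nij.
have symA k l : A k l = A l k by rewrite -{1}sA mxE.
pose S k := connect e i k.
have cut k l : S k -> ~~ S l -> A k l = 0.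
  move=> Sk nSl; apply/eqP/negPn/negP => nz.
  have kl : k != l by apply: contraNneq nSl => <-.
  by move/negP: nSl; apply; apply: connect_trans Sk _; apply: connect1; rewrite /e kl nz.
(* Row 0 is the indicator of [S], row 1 that of its complement; the columns [i] and [j] show that
   they are independent. *)
pose B : 'M[R]_(2, N) := \matrix_(a < 2, k < N) ((S k == (a == 0))%:R).
have BA : B *m A = 0.
  apply/matrixP => a k; rewrite !mxE.
  have same l : S l != S k -> A l k = 0.
    case Sl : (S l); case Sk : (S k) => // _; first by apply: cut; rewrite ?Sl ?Sk.
    by rewrite symA; apply: cut; rewrite ?Sl ?Sk.
  have [Ska|Ska] := boolP (S k == (a == 0)).
    transitivity (\sum_l A l k).
      apply: eq_bigr => l _; rewrite mxE.
      have [e1|e1] := eqVneq (S l) (S k); first by rewrite e1 Ska mul1r.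
      by rewrite same // mulr0.
    by rewrite (eq_bigr (fun l => A k l)) // => l _; rewrite symA.
  rewrite big1 // => l _; rewrite mxE.
  have [e1|e1] := eqVneq (S l) (S k); first by rewrite e1 (negPf Ska) mul0r.
  by rewrite same // mulr0.
have fB : row_free B.
  apply/row_freeP; exists (\matrix_(k < N, c < 2) (k == (if c == 0 then i else j))%:R).
  apply/matrixP => a c; rewrite !mxE.
  set t := if c == 0 then i else j.
  rewrite (bigD1 t) //= big1 ?addr0; last first.
    by move=> k kt; rewrite !mxE -/t (negPf kt) mulr0.
  rewrite !mxE eqxx mulr1; congr (_%:R).
  have -> : S t = (c == 0).
    by rewrite /t; case: ifP => // _; [rewrite /S connect0|exact: negbTE].
  by case: a c {t} => [[|[|]]] // pa [[|[|]]].
have rk : (2 <= \rank (kermx A))%N.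
  have := mxrankS (_ : (B <= kermx A)%MS); rewrite sub_kermx BA eqxx => /(_ isT).
  by move/eqP: fB => ->.
have := lambda2_X2_ndvd l2; rewrite (dvdp_trans _ (kernel_dvd_char_poly A)) //.
exact: dvdp_exp2l.
Qed.

End Connectivity.

(** * The random graph and the noise *)

Section MatrixMeasurability.
Context (d : measure_display) (T : measurableType d) (R : realType) (P : probability T R).
Variables (m n : nat).

(* The generator of [mx_borel], so that [mx_borel] is convertible to the measurable
   sets of [g_sigma_algebraType mxgen]. *)
Definition mxgen : set_system 'M[R]_(m, n) :=
  [set S | exists (i : 'I_m) (j : 'I_n) (B : set R),
     measurable B /\ S = [set A : 'M[R]_(m, n) | B (A i j)]].

Let MX := g_sigma_algebraType mxgen.

Lemma measurable_entry i j : measurable_fun setT (fun A : MX => (A : 'M[R]_(m, n)) i j).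
Proof.
move=> _ B mB; rewrite setTI; apply: sub_sigma_algebra.
by exists i, j, B.
Qed.

Lemma mx_borel_preimage (f : 'M[R]_(m, n) -> R) (B : set R) :
  measurable_fun setT (f : MX -> R) -> measurable B -> mx_borel (f @^-1` B).
Proof. by move=> mf mB; rewrite -[X in mx_borel X]setTI; exact: mf. Qed.

Variables (F : set_system T) (X : T -> 'M[R]_(m, n)).
Hypotheses (sF : F `<=` measurable) (X_meas : meas_wrt F X).

Lemma measurable_mx_comp (f : 'M[R]_(m, n) -> R) :
  measurable_fun setT (f : MX -> R) -> measurable_fun setT (f \o X).
Proof.
move=> mf _ B mB; rewrite setTI comp_preimage; apply: sF; apply: X_meas.
exact: mx_borel_preimage.
Qed.

End MatrixMeasurability.

Lemma sigma_algebra_setI (T : Type) (G : set_system T) A B :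
  sigma_algebra setT G -> G A -> G B -> G (A `&` B).
Proof.
move=> [G0 GC GU] GA GB.
have GCc C : G C -> G (~` C) by move=> h; rewrite -setTD; exact: GC.
rewrite -[A `&` B]setCK; apply: (GCc); rewrite setCI -bigcup2E; apply: GU => i.
by rewrite /bigcup2; case: ifP => _; [exact: GCc|case: ifP => _ //; exact: GCc].
Qed.

Section RandomGraph.
Context (d : measure_display) (T : measurableType d) (R : realType) (P : probability T R).
Variables (F : nat -> set_system T) (N : nat) (L : nat -> T -> 'M[R]_N) (Lbar : 'M[R]_N).
Hypotheses (HF : filtration F).
Hypothesis HL_lap : forall t w, is_graph_laplacian (L t w).
Hypothesis HL_meas : forall t, meas_wrt (F t.+1) (L t).
Hypothesis HL_indep : forall t, indep P (F t) (sigmaX (L t)).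
Hypothesis Lbar_mean : forall t i j, Ex P (fun w => L t w i j) = (Lbar i j)%:E.

Definition adj t w (i j : 'I_N) := L t w i j == -1.

Lemma adj_sym t w : symmetric (adj t w).
Proof.
have [A [_ [_ [sA LE]]]] := HL_lap t w.
have sA' i j : A i j = A j i by rewrite -{1}sA mxE.
move=> i j; rewrite /adj LE !mxE sA' eq_sym; have [->//|ij] := eqVneq i j.
by rewrite eq_sym.
Qed.

Lemma laplacian_offdiag t w i j : i != j -> L t w i j = - (adj t w i j)%:R.
Proof.
move=> ij; have [A [A01 [_ [_ LE]]]] := HL_lap t w.
have Lij : L t w i j = - A i j by rewrite LE !mxE (negPf ij) mulr0n sub0r.
rewrite /adj Lij; case: (A01 i j) => ->; last by rewrite eqxx.
by rewrite oppr0 eq_sym oppr_eq0 oner_eq0 oppr0.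
Qed.

Lemma laplacian_diag t w i : L t w i i = \sum_(j | i != j) (adj t w i j)%:R.
Proof.
have [A [A01 [A0 [_ LE]]]] := HL_lap t w.
rewrite {1}LE !mxE eqxx mulr1n A0 subr0 (bigD1 i) //= A0 add0r.
apply: eq_big => [j|j ij]; first by rewrite eq_sym.
have := @laplacian_offdiag t w i j; rewrite eq_sym => /(_ ij) /eqP.
rewrite {1}LE !mxE (_ : (i == j) = false) ?mulr0n ?sub0r ?eqr_opp; last first.
  by rewrite eq_sym; exact: negbTE.
by move/eqP.
Qed.

Lemma measurable_adj t i j : measurable [set w | adj t w i j].
Proof.
have [_ [sF _]] := HF.
apply: (sF t.+1); apply: (@HL_meas t [set A : 'M[R]_N | A i j == -1]).
apply: (@mx_borel_preimage _ _ _ (fun A => A i j) [set r | r == -1]).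
  exact: measurable_entry.
rewrite (_ : [set r : R | r == -1] = [set -1]); last first.
  by apply/seteqP; split => r /= /eqP.
exact: measurable_set1.
Qed.

Lemma adj_indic t i j : (fun w => (adj t w i j)%:R : R) = \1_[set w | adj t w i j].
Proof. by apply/funext => w; rewrite indicE; congr (nat_of_bool _)%:R; rewrite mem_setE. Qed.

Lemma expect_adjacency t i j :
  (\int[P]_w ((adj t w i j)%:R)%:E = P [set w | adj t w i j])%E.
Proof.
rewrite -[X in P X]setIT -integral_indic //; last exact: measurable_adj.
by apply: eq_integral => w _; rewrite -adj_indic.
Qed.

(** Minus an off-diagonal entry of the mean Laplacian is an edge probability. Symmetry and zero row
    sums of [Lbar] are derived from this, using integrals of indicators only. *)
Lemma expect_adj t i j : i != j -> P [set w | adj t w i j] = (- Lbar i j)%:E.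
Proof.
move=> ij; have := Lbar_mean t i j; rewrite /Ex.
under eq_integral do rewrite laplacian_offdiag // EFinN.
rewrite integral_ge0N; last by move=> w _; rewrite lee_fin.
by rewrite expect_adjacency EFinN => <-; rewrite oppeK.
Qed.

Lemma Lbar_sym : Lbar^T = Lbar.
Proof.
apply/matrixP => i j; rewrite mxE; have [->//|ij] := eqVneq i j.
apply/eqP; rewrite -eqr_opp -eqe -(expect_adj 0) 1?eq_sym // -(expect_adj 0) //.
by apply/eqP; congr (P _); apply/seteqP; split => w /=; rewrite adj_sym.
Qed.

Lemma Lbar_row i : \sum_j Lbar i j = 0.
Proof.
suff h : Lbar i i = \sum_(j | i != j) - Lbar i j.
  rewrite (bigD1 i) //= h sumrN addrC.
  by rewrite (eq_bigl (fun j => i != j)) ?subrr // => j; rewrite eq_sym.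
apply/eqP; rewrite -eqe -(Lbar_mean 0 i i) /Ex -sumEFin.
under eq_integral do rewrite laplacian_diag big_mkcond /=.
rewrite expect_sum; first last.
- by move=> j w; case: ifP.
- move=> j; case: (i != j); last exact: measurable_cst.
  rewrite adj_indic; exact/measurable_indic/measurable_adj.
rewrite [X in _ == X]big_mkcond /=; apply/eqP; apply: eq_bigr => j _.
case: (boolP (i != j)) => ij; last by rewrite integral0.
by rewrite expect_adjacency expect_adj.
Qed.

Lemma edge_connected : 0 < lambda2 Lbar ->
  forall i j, connect (fun i j => (i != j) && (Lbar i j != 0)) i j.
Proof. exact: (lambda2_connected Lbar_sym Lbar_row). Qed.

Lemma nonadj_prob t i j : i != j -> P [set w | ~~ adj t w i j] = (1 + Lbar i j)%:E.
Proof.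
move=> ij; have h := probability_setC P (measurable_adj t i j).
have -> : [set w | ~~ adj t w i j] = ~` [set w | adj t w i j].
  by apply/seteqP; split => w /= /negP.
by rewrite h expect_adj // -EFinB opprK.
Qed.

Let silent t m i j := [set w | forall r, (t <= r < t + m)%N -> ~~ adj r w i j].

(** The two claims go together in the induction: [L (t + m)] is independent of the past up to
    [t + m], to which silence until then belongs, so each time contributes one factor. *)
Lemma silent_prob t m i j : i != j ->
  F (t + m)%N (silent t m i j) /\ P (silent t m i j) = ((1 + Lbar i j) ^+ m)%:E.
Proof.
move=> ij; have [sF [mF Fm]] := HF.
elim: m => [|m [IH1 IH2]].
  have -> : silent t 0 i j = setT.
    apply/seteqP; split => // w _ r /andP[h1 h2].
    by have := leq_ltn_trans h1 h2; rewrite addn0 ltnn.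
  rewrite addn0 probability_setT expr0; split => //.
  by have [G0 GC _] := sF t; have := GC _ G0; rewrite setD0.
have -> : silent t m.+1 i j = silent t m i j `&` [set w | ~~ adj (t + m)%N w i j].
  apply/seteqP; split => w.
    move=> h; split => [r /andP[h1 h2]|]; apply: h; last by rewrite leq_addr addnS leqnn.
    by rewrite h1 addnS ltnS ltnW.
  move=> [h1 h2] r /andP[tr]; rewrite addnS ltnS leq_eqVlt => /orP[/eqP -> //|rm].
  by apply: h1; rewrite tr rm.
have mxB : mx_borel [set A : 'M[R]_N | A i j != -1].
  apply: (@mx_borel_preimage _ _ _ (fun A => A i j) [set r | r != -1]).
    exact: measurable_entry.
  rewrite (_ : [set r : R | r != -1] = ~` [set -1]); last first.
    by apply/seteqP; split => r /= /eqP.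
  by apply: measurableC; exact: measurable_set1.
have nE : [set w | ~~ adj (t + m)%N w i j] = L (t + m)%N @^-1` [set A | A i j != -1] by [].
split.
  rewrite addnS; apply: sigma_algebra_setI => //; first exact: Fm.
  by rewrite nE; exact: HL_meas.
rewrite (@HL_indep (t + m)%N) //; last by exists [set A : 'M[R]_N | A i j != -1].
by rewrite IH2 nonadj_prob // -EFinM exprSr.
Qed.

(** Bound [q] by [exp (- lam)] and the length from below by [y = t^del]. With [k = 2 / del],
    [exp (- lam * y)] is the power [-k] of [exp (lam / k * y)], and [exp z >= z] turns it into a
    multiple of t^(- del * k) = t^-2. *)
Lemma exp_winlen_le (q del : R) : 0 <= q -> q < 1 -> 0 < del ->
  exists2 C : R, 0 <= C & forall t, q ^+ winlen del t <= C * t.+1%:R `^ (- 2).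
Proof.
move=> q0 q1 del0; pose lam : R := 1 - q; pose k := 2 / del.
have lam0 : 0 < lam by rewrite subr_gt0.
have k0 : 0 < k by rewrite divr_gt0.
exists ((lam / k) `^ (- k)) => [|t]; first exact: powR_ge0.
pose y := (t.+1%:R : R) `^ del.
have y0 : 0 < y by exact: powS_gt0.
have -> : (lam / k) `^ (- k) * t.+1%:R `^ (- 2) = (lam / k * y) `^ (- k).
  rewrite (@powRM _ (lam / k) y) ?powR_ge0 //; last by rewrite divr_ge0 // ltW.
  rewrite -powRrM; congr (_ * _ `^ _).
  by rewrite /k; field; rewrite gt_eqF.
have z0 : 0 < lam / k * y by rewrite mulr_gt0 // divr_gt0.
apply: (@le_trans _ _ (expR (- (lam * y)))).
  have qe : q <= expR (- lam) by have := expR_ge1Dx (- lam); rewrite /lam; lra.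
  apply: (@le_trans _ _ (expR (- lam) ^+ winlen del t)).
    by rewrite lerXn2r ?nnegrE ?expR_ge0.
  rewrite -expRM_natl ler_expR mulrN lerN2 [leRHS]mulrC ler_wpM2l ?(ltW lam0) //.
  exact: winlen_ge.
have -> : - (lam * y) = - k * (lam / k * y) by field; rewrite gt_eqF.
rewrite mulNr expRN powRN lef_pV2 ?posrE ?expR_gt0 ?powR_gt0 //.
rewrite (mulrC k) expRM ge0_ler_powR ?nnegrE ?expR_ge0 ?(ltW k0) ?(ltW z0) //.
by have := expR_ge1Dx (lam / k * y); lra.
Qed.

Lemma edge_window (del : R) : 0 < del ->
  {ae P, forall w, exists tW, forall t, (tW <= t)%N -> forall i j,
     (i != j) && (Lbar i j != 0) ->
     exists2 r, (t <= r < t + winlen del t)%N & adj r w i j}.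
Proof.
move=> del0; have [sF [mF _]] := HF.
have edge i j : {ae P, forall w, \forall t \near \oo, (i != j) && (Lbar i j != 0) ->
     exists2 r, (t <= r < t + winlen del t)%N & adj r w i j}.
  have [/andP[ij nz]|nh] := boolP ((i != j) && (Lbar i j != 0)); last first.
    by apply: aeW => w; apply: nearW.
  have q0 : 0 <= 1 + Lbar i j by rewrite -lee_fin -(nonadj_prob 0).
  have q1 : 1 + Lbar i j < 1.
    have : 0 <= - Lbar i j by rewrite -lee_fin -(expect_adj 0).
    by rewrite gtrDl oppr_ge0 => h; rewrite lt_neqAle nz.
  have [C C0 hC] := exp_winlen_le q0 q1 del0.
  have h : {ae P, forall w, \forall t \near \oo, ~ silent t (winlen del t) i j w}.
    apply: (@borel_cantelli_powS _ _ _ P _ C 2) => //; last 2 first.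
    - by rewrite ltr1n.
    - move=> t; have [_ ->] := silent_prob t (winlen del t) ij.
      by rewrite lee_fin.
    by move=> t; have [h _] := silent_prob t (winlen del t) ij; exact: mF h.
  move: h; apply: filterS => w; apply: filterS => t ns _.
  apply: contrapT => nE; apply: ns => r hr; apply/negP => ha.
  by apply: nE; exists r.
have h : {ae P, forall w i j, \forall t \near \oo, (i != j) && (Lbar i j != 0) ->
     exists2 r, (t <= r < t + winlen del t)%N & adj r w i j}.
  by apply: filter_forall => i; apply: filter_forall => j; exact: edge.
move: h; apply: filterS => w h.
have [tW _ H] : \forall t \near \oo, forall i j, (i != j) && (Lbar i j != 0) ->
     exists2 r, (t <= r < t + winlen del t)%N & adj r w i j.
  by apply: filter_forall => i; apply: filter_forall => j; exact: h.
by exists tW => t /H.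
Qed.

End RandomGraph.

(** * Consistency of the sample covariance *)

Section Averages.
Variable R : realType.
Implicit Types f g : nat -> R.

Definition avg f n : R := (\sum_(s < n.+1) f s) / n.+1%:R.

Lemma avgD f g n : avg (fun s => f s + g s) n = avg f n + avg g n.
Proof. by rewrite /avg big_split mulrDl. Qed.

Lemma avgZ c f n : avg (fun s => c * f s) n = c * avg f n.
Proof. by rewrite /avg -mulr_sumr mulrA. Qed.

Lemma avg_cst c n : avg (fun=> c) n = c.
Proof. by rewrite /avg sumr_ord_const mulrAC divff ?mul1r // pnatr_eq0. Qed.

Lemma avg_cvgD f g (a b : R) : avg f @ \oo --> a -> avg g @ \oo --> b ->
  avg (fun s => f s + g s) @ \oo --> a + b.
Proof. by move=> hf hg; rewrite (funext (avgD f g)); exact: cvgD. Qed.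

Lemma avg_cvgZ c f (a : R) : avg f @ \oo --> a -> avg (fun s => c * f s) @ \oo --> c * a.
Proof. by move=> hf; rewrite (funext (avgZ c f)); exact: cvg_mulc. Qed.

Lemma avg_cvg_cst (c : R) : avg (fun=> c) @ \oo --> c.
Proof. by rewrite (funext (avg_cst c)); exact: cvg_cst. Qed.

Lemma eq_avg_cvg f g (a : R) : f =1 g -> avg f @ \oo --> a -> avg g @ \oo --> a.
Proof. by move=> /funext ->. Qed.

Lemma sample_covariance_cvg m (h : 'cV[R]_m) (z : nat -> 'cV[R]_m) (C : 'M[R]_m)
  (Q : nat -> 'M[R]_m) :
  (forall i, avg (fun s => z s i 0) @ \oo --> (0 : R)) ->
  (forall i j, avg (fun s => z s i 0 * z s j 0) @ \oo --> C i j) ->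
  (forall t, (1 <= t)%N -> Q t.+1 =
     t%:R^-1 *: (\sum_(s < t.+1) (h + z s) *m (h + z s)^T)
     - (t%:R^-1 *: \sum_(s < t) (h + z s)) *m (t%:R^-1 *: \sum_(s < t) (h + z s))^T) ->
  mxcvg Q C.
Proof.
move=> hz hzz HQ i j.
have yi k : avg (fun s => h k 0 + z s k 0) @ \oo --> h k 0.
  by rewrite -[X in _ --> X]addr0; apply: avg_cvgD => //; exact: avg_cvg_cst.
have yy : avg (fun s => (h i 0 + z s i 0) * (h j 0 + z s j 0)) @ \oo -->
    h i 0 * h j 0 + C i j.
  apply: (@eq_avg_cvg (fun s => (h i 0 * h j 0 + (h i 0 * z s j 0 + h j 0 * z s i 0))
     + z s i 0 * z s j 0)) => [s|]; first by ring.
  apply: avg_cvgD => //.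
  rewrite -[X in _ --> X]addr0; apply: avg_cvgD; first exact: avg_cvg_cst.
  rewrite -[X in _ --> X]addr0; apply: avg_cvgD.
    by rewrite -(mulr0 (h i 0)); apply: avg_cvgZ.
  by rewrite -(mulr0 (h j 0)); apply: avg_cvgZ.
pose Y := avg (fun s => (h i 0 + z s i 0) * (h j 0 + z s j 0)).
(* The second-moment sum has one more term than its divisor, hence the factor tending to 1. The
   shift by two respects the range on which the update formula is assumed. *)
have QE t : Q t.+2 i j = (1 + t.+1%:R^-1) * Y t.+1
    - avg (fun s => h i 0 + z s i 0) t * avg (fun s => h j 0 + z s j 0) t.
  rewrite HQ //.
  have eB (V W : 'M[R]_m) : (V - W) i j = V i j - W i j by rewrite !mxE.
  rewrite eB; congr (_ - _).
    rewrite mxE summxE /Y /avg.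
    rewrite (eq_bigr (fun s : 'I_t.+2 => (h i 0 + z s i 0) * (h j 0 + z s j 0))); last first.
      by move=> s _; rewrite mxE big_ord1 !mxE.
    rewrite -[t.+2%:R]natr1; field.
    by rewrite nat1r natr1 !pnatr_eq0.
  rewrite mxE big_ord1.
  have eZ k : (t.+1%:R^-1 *: \sum_(s < t.+1) (h + z s)) k 0 = avg (fun s => h k 0 + z s k 0) t.
    rewrite mxE summxE mulrC /avg; congr (_ / _).
    by apply: eq_bigr => s _; rewrite mxE.
  by rewrite eZ mxE eZ.
rewrite -(cvg_shiftn 2); under eq_fun do rewrite addn2 QE.
have -> : C i j = (1 + 0) * (h i 0 * h j 0 + C i j) - h i 0 * h j 0 by ring.
apply: cvgB; last by apply: cvgM.
apply: cvgM; last by rewrite (cvg_shiftS Y).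
apply: cvgD; first exact: cvg_cst.
have := @cvg_powSN R 1 ltr01; under eq_fun do rewrite powR_inv1 //; exact.
Qed.

End Averages.

Section Means.
Context (d : measure_display) (T : measurableType d) (R : realType) (P : probability T R).

Definition has_mean (f : T -> R) (a : R) :=
  P.-integrable setT (fun w => (f w)%:E) /\ (\int[P]_w (f w)%:E = a%:E)%E.

Lemma has_meanD f g a b : has_mean f a -> has_mean g b ->
  has_mean (fun w => f w + g w) (a + b).
Proof.
move=> [f1 f2] [g1 g2]; split.
  under eq_fun do rewrite EFinD; exact: integrableD.
under eq_integral do rewrite EFinD.
by rewrite (integralD measurableT f1 g1) f2 g2.
Qed.

Lemma has_meanZ c f a : has_mean f a -> has_mean (fun w => c * f w) (c * a).
Proof.
move=> [f1 f2]; split.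
  under eq_fun do rewrite EFinM; exact: integrableZl.
under eq_integral do rewrite EFinM.
by rewrite (integralZl measurableT f1) f2.
Qed.

Lemma has_mean_cst c : has_mean (fun=> c) c.
Proof. by split; [exact: finite_measure_integrable_cst|exact: expect_cst]. Qed.

Lemma eq_has_mean f g a : f =1 g -> has_mean f a -> has_mean g a.
Proof. by move=> /funext ->. Qed.

End Means.

(** * Size and empirical moments of the observation noise *)

Section Noise.
Context (d : measure_display) (T : measurableType d) (R : realType) (P : probability T R).
Variables (F : nat -> set_system T) (m : nat) (zeta : nat -> T -> 'cV[R]_m) (C : 'M[R]_m).
Variable eps1 : R.
Hypotheses (HF : filtration F).
Hypothesis zeta_meas : forall t, meas_wrt (F t.+1) (zeta t).
Hypothesis zeta_indep : forall t, indep P (F t) (sigmaX (zeta t)).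
Hypothesis zeta_law : forall t, same_law P (zeta t) (zeta 0%N).
Hypothesis zeta_mean : forall i, has_mean P (fun w => zeta 0%N w i 0) 0.
Hypothesis zeta_cov : forall i j,
  has_mean P (fun w => zeta 0%N w i 0 * zeta 0%N w j 0) (C i j).
Hypothesis eps10 : 0 < eps1.
Hypothesis zeta_moment : (\int[P]_w ((vnorm (zeta 0%N w)) `^ (2 + eps1))%:E < +oo)%E.

Lemma measurable_vnorm :
  measurable_fun setT ((@vnorm R m) : g_sigma_algebraType (@mxgen R m 1) -> R).
Proof.
have -> : @vnorm R m = fun v => (\sum_(i < m) (v i 0) ^+ 2) `^ 2^-1.
  apply/funext => v; rewrite powR12_sqrt //.
  by apply: sumr_ge0 => i _; exact: sqr_ge0.
apply: measurable_powR_comp; apply: measurable_sum => i.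
by apply: measurable_funX; exact: measurable_entry.
Qed.

Lemma measurable_noise t (f : 'cV[R]_m -> R) :
  measurable_fun setT (f : g_sigma_algebraType (@mxgen R m 1) -> R) ->
  measurable_fun setT (fun w => f (zeta t w)).
Proof.
move=> mf; have [_ [sF _]] := HF.
exact: (measurable_mx_comp (sF t.+1) (@zeta_meas t) mf).
Qed.

Lemma noise_law t (f : 'cV[R]_m -> R) (B : set R) :
  measurable_fun setT (f : g_sigma_algebraType (@mxgen R m 1) -> R) -> measurable B ->
  P ((fun w => f (zeta t w)) @^-1` B) = P ((fun w => f (zeta 0%N w)) @^-1` B).
Proof. by move=> mf mB; exact: (zeta_law t (mx_borel_preimage mf mB)). Qed.

Lemma filtration_le t s : (t <= s)%N -> F t `<=` F s.
Proof.
have [_ [_ FS]] := HF; move=> /subnKC <-; elim: (s - t)%N => [|k IH].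
  by rewrite addn0.
by rewrite addnS; apply: subset_trans IH _; exact: FS.
Qed.

Lemma noise_indep s r (f : 'cV[R]_m -> R) (A B : set R) : (s < r)%N ->
  measurable_fun setT (f : g_sigma_algebraType (@mxgen R m 1) -> R) ->
  measurable A -> measurable B ->
  P ((fun w => f (zeta s w)) @^-1` A `&` (fun w => f (zeta r w)) @^-1` B) =
  (P ((fun w => f (zeta s w)) @^-1` A) * P ((fun w => f (zeta r w)) @^-1` B))%E.
Proof.
move=> sr mf mA mB; apply: (@zeta_indep r).
  apply: (filtration_le sr).
  by have := @zeta_meas s _ (mx_borel_preimage mf mA).
by exists (f @^-1` B) => //; exact: mx_borel_preimage.
Qed.

Lemma vnorm_ge0 (v : 'cV[R]_m) : 0 <= vnorm v.
Proof. exact: sqrtr_ge0. Qed.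

Lemma entry_le_vnorm (v : 'cV[R]_m) i : `|v i 0| <= vnorm v.
Proof. exact: (le_l2norm (fun i => v i 0)). Qed.

Lemma noise_tail (p : R) : (2 + eps1)^-1 < p ->
  {ae P, forall w, exists K, forall t, norm1 (zeta t w) <= K * t.+1%:R `^ p}.
Proof.
move=> hp; have e0 : 0 < 2 + eps1 by rewrite addr_gt0.
have p0 : 0 < p by apply: lt_trans hp; rewrite invr_gt0.
have m0 : measurable_fun setT (fun w => vnorm (zeta 0%N w)).
  exact: measurable_noise measurable_vnorm.
have M0 : (0 <= \int[P]_w ((vnorm (zeta 0%N w)) `^ (2 + eps1))%:E)%E.
  by apply: integral_ge0 => w _; rewrite lee_fin powR_ge0.
pose M := fine (\int[P]_w ((vnorm (zeta 0%N w)) `^ (2 + eps1))%:E)%E.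
have ME : (\int[P]_w ((vnorm (zeta 0%N w)) `^ (2 + eps1))%:E = M%:E)%E.
  by rewrite fineK // ge0_fin_numE.
have Mge0 : 0 <= M by rewrite -lee_fin -ME.
pose E t := [set w | (t.+1%:R `^ p <= vnorm (zeta t w))%R].
have hE : {ae P, forall w, \forall t \near \oo, ~ E t w}.
  apply: (@borel_cantelli_powS _ _ _ P E M (p * (2 + eps1))) => //.
  - move=> t; apply: measurable_superlevel; exact: measurable_noise measurable_vnorm.
  - by rewrite -ltr_pdivrMr // div1r.
  move=> t.
  have c0 : 0 < (t.+1%:R : R) `^ p by exact: powS_gt0.
  have -> : P (E t) = P [set w | (t.+1%:R `^ p <= vnorm (zeta 0%N w))%R].
    have := @noise_law t _ `[(t.+1%:R : R) `^ p, +oo[%classic measurable_vnorm (measurable_itv _).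
    rewrite /preimage /E.
    have sE s : [set w | `[(t.+1%:R : R) `^ p, +oo[%classic (vnorm (zeta s w))] =
        [set w | (t.+1%:R `^ p <= vnorm (zeta s w))%R].
      by apply/seteqP; split => w; rewrite /= in_itv /= andbT.
    by rewrite !sE.
  have mpow := measurable_powR_comp (2 + eps1) m0.
  have := @markov_ge0 _ _ _ P _ ((t.+1%:R `^ p) `^ (2 + eps1)) mpow
    (fun w => powR_ge0 _ _) (powR_gt0 _ c0).
  have eP : ((t.+1%:R `^ p) `^ (2 + eps1))^-1 = (t.+1%:R : R) `^ (- (p * (2 + eps1))).
    by rewrite -powRrM -powRN.
  rewrite ME eP -EFinM [X in (_ <= X%:E)%E -> _]mulrC.
  apply: le_trans; apply: le_measure; rewrite ?inE.
  - exact: measurable_superlevel.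
  - exact: measurable_superlevel.
  move=> w /= h; rewrite ge0_ler_powR ?nnegrE ?vnorm_ge0 ?powR_ge0 //; exact: ltW.
move: hE; apply: filterS => w [t0 _ h].
(* The sum covers the finitely many times before [t0]; later [norm1] is at most [m] times the
   Euclidean norm, which is below t^p. *)
pose K := m%:R + \sum_(t < t0) norm1 (zeta t w).
exists K => t; have p1 := powS_ge1 t (ltW p0).
have n1 : norm1 (zeta t w) <= m%:R * vnorm (zeta t w).
  rewrite norm1_col -sumr_ord_const; apply: ler_sum => i _; exact: entry_le_vnorm.
have s0 : 0 <= \sum_(t < t0) norm1 (zeta t w) by apply: sumr_ge0 => i _; exact: norm1_ge0.
case: (ltnP t t0) => ht.
  apply: (@le_trans _ _ K); last by rewrite ler_peMr // addr_ge0.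
  rewrite /K (bigD1 (Ordinal ht)) //= addrCA lerDl addr_ge0 //.
  by apply: sumr_ge0 => i _; exact: norm1_ge0.
have /negP := h t ht; rewrite -ltNge => hv.
apply: (le_trans n1); rewrite /K mulrDl.
have : m%:R * vnorm (zeta t w) <= m%:R * t.+1%:R `^ p by rewrite ler_wpM2l // ltW.
have : 0 <= (\sum_(t < t0) norm1 (zeta t w)) * t.+1%:R `^ p by rewrite mulr_ge0 // powR_ge0.
lra.
Qed.

(** The strong law above is for nonnegative variables, so it is applied to squares of affine forms
    of the noise; signed averages are recovered from these by polarization. *)
Lemma quadratic_avg (i j : 'I_m) (c b : R) :
  {ae P, forall w, avg (fun s => (zeta s w i 0 + c * zeta s w j 0 + b) ^+ 2) @ \oo -->
    C i i + c ^+ 2 * C j j + 2 * c * C i j + b ^+ 2}.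
Proof.
pose f (v : 'cV[R]_m) : R := (v i 0 + c * v j 0 + b) ^+ 2.
have mf : measurable_fun setT (f : g_sigma_algebraType (@mxgen R m 1) -> R).
  apply: measurable_funX; apply: measurable_funD => //; apply: measurable_funD.
    exact: measurable_entry.
  by apply: measurable_funM => //; exact: measurable_entry.
pose eta : R := Num.min (eps1 / 2) 1.
have eta0 : 0 < eta by rewrite lt_min divr_gt0 //= ltr01.
have eta1 : eta <= 1 by rewrite ge_min lexx orbT.
(* A moment of order [1 + eta] of a square is one of order [2 (1 + eta)] of the noise, which (A.4)
   controls; the cap at 1 is required by the strong law. *)
have eta2 : 2 * (1 + eta) <= 2 + eps1.
  have : eta <= eps1 / 2 by rewrite ge_min lexx.
  lra.
pose M := fine (\int[P]_w ((fun w => f (zeta 0%N w)) w `^ (1 + eta))%:E)%E.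
have ME : (\int[P]_w (f (zeta 0%N w) `^ (1 + eta))%:E = M%:E)%E.
  rewrite fineK // ge0_fin_numE; last first.
    by apply: integral_ge0 => w _; rewrite lee_fin powR_ge0.
  pose B := 1 + `|c| + `|b|.
  have B0 : 0 <= B by rewrite !addr_ge0.
  have mv : measurable_fun setT (fun w => vnorm (zeta 0%N w)).
    exact: measurable_noise measurable_vnorm.
  apply: (@le_lt_trans _ _ (\int[P]_w (B `^ (2 * (1 + eta)) *
     (1 + vnorm (zeta 0%N w) `^ (2 + eps1)))%:E)%E); last first.
    rewrite expectZ ?powR_ge0 //; first last.
    - by move=> w; rewrite addr_ge0 // powR_ge0.
    - by apply: measurable_funD => //; exact: measurable_powR_comp.
    rewrite expectD //; first last.
    - by move=> w; exact: powR_ge0.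
    - exact: measurable_powR_comp.
    by rewrite expect_cst lte_mul_pinfty ?lee_fin ?powR_ge0 // lte_add_pinfty // ltry.
  apply: expect_le => //.
  - by apply: measurable_powR_comp; exact: measurable_noise.
  - apply: measurable_funM => //; apply: measurable_funD => //.
    exact: measurable_powR_comp.
  - by move=> w; exact: powR_ge0.
  move=> w; set v := zeta 0%N w; set V := Num.max (vnorm v) 1.
  have V1 : 1 <= V by rewrite le_max lexx orbT.
  have V0 : 0 <= V by exact: le_trans V1.
  have vV : vnorm v <= V by rewrite le_max lexx.
  have fV : f v <= (B * V) ^+ 2.
    rewrite /f -[leLHS](real_normK (num_real _)) ler_pXn2r ?nnegrE ?mulr_ge0 //.
    apply: (le_trans (ler_normD _ _)); rewrite /B mulrDl; apply: lerD; last first.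
      by rewrite ler_peMr.
    apply: (le_trans (ler_normD _ _)); rewrite mulrDl mul1r normrM; apply: lerD.
      by apply: le_trans vV; exact: entry_le_vnorm.
    by rewrite ler_wpM2l //; apply: le_trans vV; exact: entry_le_vnorm.
  apply: (@le_trans _ _ (((B * V) ^+ 2) `^ (1 + eta))).
    by rewrite ge0_ler_powR ?nnegrE ?sqr_ge0 //; lra.
  rewrite -powR_mulrn ?mulr_ge0 // -powRrM powRM // ler_wpM2l ?powR_ge0 //.
  rewrite /V; case: (leP (vnorm v) 1) => hv.
    by rewrite powR1 lerDl powR_ge0.
  apply: (@le_trans _ _ (vnorm v `^ (2 + eps1))); last by rewrite lerDr.
  by rewrite ler_powR // ltW.
have Emean : (\int[P]_w (f (zeta 0%N w))%:E =
    (C i i + c ^+ 2 * C j j + 2 * c * C i j + b ^+ 2)%:E)%E.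
  have hm : has_mean P (fun w => f (zeta 0%N w))
     (C i i + c ^+ 2 * C j j + 2 * c * C i j + (b ^+ 2 + 2 * b * 0 + 2 * b * c * 0)).
    apply: (@eq_has_mean _ _ _ P (fun w => zeta 0%N w i 0 * zeta 0%N w i 0
      + c ^+ 2 * (zeta 0%N w j 0 * zeta 0%N w j 0)
      + 2 * c * (zeta 0%N w i 0 * zeta 0%N w j 0)
      + (b ^+ 2 + 2 * b * zeta 0%N w i 0 + 2 * b * c * zeta 0%N w j 0))).
      by move=> w; rewrite /f; ring.
    repeat (first [exact: has_mean_cst | exact: zeta_cov | exact: zeta_mean
      | apply: has_meanD | apply: has_meanZ]).
  by have [_ ->] := hm; congr (_%:E); ring.
have := @strong_law _ _ _ P (fun s w => f (zeta s w)) _ eta M eta0 eta1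
  (fun s => measurable_noise s mf) (fun s w => sqr_ge0 _)
  (fun s B mB => noise_law s mf mB)
  (fun s r sr A B mA mB => noise_indep sr mf mA mB) Emean ME.
exact.
Qed.

(** Polarization: [z_i = ((z_i + 1)^2 - z_i^2 - 1) / 2] and [z_i z_j = ((z_i + z_j)^2 - z_i^2 -
    z_j^2) / 2]. *)
Lemma noise_averages : {ae P, forall w,
  (forall i, avg (fun s => zeta s w i 0) @ \oo --> (0 : R)) /\
  (forall i j, avg (fun s => zeta s w i 0 * zeta s w j 0) @ \oo --> C i j)}.
Proof.
have h : {ae P, forall w, forall i j,
   [/\ avg (fun s => (zeta s w i 0 + 0 * zeta s w j 0 + 0) ^+ 2) @ \oo -->
         C i i + 0 ^+ 2 * C j j + 2 * 0 * C i j + 0 ^+ 2,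
       avg (fun s => (zeta s w i 0 + 0 * zeta s w j 0 + 1) ^+ 2) @ \oo -->
         C i i + 0 ^+ 2 * C j j + 2 * 0 * C i j + 1 ^+ 2 &
       avg (fun s => (zeta s w i 0 + 1 * zeta s w j 0 + 0) ^+ 2) @ \oo -->
         C i i + 1 ^+ 2 * C j j + 2 * 1 * C i j + 0 ^+ 2]}.
  apply: filter_forall => i; apply: filter_forall => j.
  have h1 := quadratic_avg i j 0 0; have h2 := quadratic_avg i j 0 1.
  have h3 := quadratic_avg i j 1 0.
  by apply: filterS3 h1 h2 h3 => w a1 a2 a3; split.
move: h; apply: filterS => w h; split=> [i|i j].
  have [h0 h1 _] := h i i.
  have -> : (0 : R) = 2^-1 * ((C i i + 0 ^+ 2 * C i i + 2 * 0 * C i i + 1 ^+ 2)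
     + (-1) * (C i i + 0 ^+ 2 * C i i + 2 * 0 * C i i + 0 ^+ 2) + -1) by lra.
  apply: (@eq_avg_cvg _ (fun s => 2^-1 * ((zeta s w i 0 + 0 * zeta s w i 0 + 1) ^+ 2 +
    (-1) * (zeta s w i 0 + 0 * zeta s w i 0 + 0) ^+ 2 + -1))) => [s|]; first by lra.
  by apply: avg_cvgZ; apply: avg_cvgD; [apply: avg_cvgD => //; exact: avg_cvgZ|exact: avg_cvg_cst].
have [h1 _ h3] := h i j; have [h2 _ _] := h j j.
have -> : C i j = 2^-1 * ((C i i + 1 ^+ 2 * C j j + 2 * 1 * C i j + 0 ^+ 2)
   + (-1) * (C i i + 0 ^+ 2 * C j j + 2 * 0 * C i j + 0 ^+ 2)
   + (-1) * (C j j + 0 ^+ 2 * C j j + 2 * 0 * C j j + 0 ^+ 2)) by lra.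
apply: (@eq_avg_cvg _ (fun s => 2^-1 * ((zeta s w i 0 + 1 * zeta s w j 0 + 0) ^+ 2
  + (-1) * (zeta s w i 0 + 0 * zeta s w j 0 + 0) ^+ 2
  + (-1) * (zeta s w j 0 + 0 * zeta s w j 0 + 0) ^+ 2))) => [s|]; first by lra.
by apply: avg_cvgZ; apply: avg_cvgD; [apply: avg_cvgD => //; exact: avg_cvgZ|exact: avg_cvgZ].
Qed.

End Noise.

Theorem theorem3p1
  (R : realType) (d : measure_display) (T : measurableType d)
  (P : probability T R) (F : nat -> set_system T)
  (N M : nat) (Md : 'I_N -> nat)
  (H : forall n : 'I_N, 'M[R]_(Md n, M)) (theta : 'cV[R]_M)
  (zeta : forall n : 'I_N, nat -> T -> 'cV[R]_(Md n))
  (Rn : forall n : 'I_N, 'M[R]_(Md n))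
  (L : nat -> T -> 'M[R]_N)
  (a b tau1 tau2 eps1 : R) (gamma : nat -> R)
  (x0 : 'I_N -> 'cV[R]_M) (G0 : 'I_N -> 'M[R]_M)
  (Q0 Q1 : forall n : 'I_N, 'M[R]_(Md n))
  (x : 'I_N -> nat -> T -> 'cV[R]_M) (G : 'I_N -> nat -> T -> 'M[R]_M)
  (Q : forall n : 'I_N, nat -> T -> 'M[R]_(Md n))
  (* filtration *)
  (HF : filtration F)
  (* observation noise *)
  (Hzeta_meas : forall n t, meas_wrt (F t.+1) (zeta n t))
  (Hzeta_indep : forall n t, indep P (F t) (sigmaX (zeta n t)))
  (Hzeta_law : forall n t, same_law P (zeta n t) (zeta n 0%N))
  (Hzeta_int : forall n t i, P.-integrable setT (fun w => (zeta n t w i 0)%:E))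
  (Hzeta_mean : forall n t i, Ex P (fun w => zeta n t w i 0) = 0%E)
  (Hzeta_sq : forall n t i j,
     P.-integrable setT (fun w => (zeta n t w i 0 * zeta n t w j 0)%:E))
  (Hzeta_cov : forall n t i j,
     Ex P (fun w => zeta n t w i 0 * zeta n t w j 0) = (Rn n i j)%:E)
  (HRn : forall n, Rn n \in unitmx)
  (Hzeta_uncorr : forall n l, n != l -> forall t s i j,
     Ex P (fun w => zeta n t w i 0 * zeta l s w j 0) = 0%E)
  (* (A.1) *)
  (HA1 : (N%:R^-1 *: \sum_(n < N) (H n)^T *m invmx (Rn n) *m H n) \in unitmx)
  (* (A.2) *)
  (HL_lap : forall t w, is_graph_laplacian (L t w))
  (HL_meas : forall t, meas_wrt (F t.+1) (L t))
  (HL_indep : forall t, indep P (F t) (sigmaX (L t)))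
  (HL_law : forall t, same_law P (L t) (L 0%N))
  (HA2 : exists Lbar : 'M[R]_N,
     (forall t i j, Ex P (fun w => L t w i j) = (Lbar i j)%:E) /\ 0 < lambda2 Lbar)
  (* (A.3) *)
  (HA3 : indep P (<<s \bigcup_(t in setT) sigmaX (L t) >>)
                 (<<s \bigcup_(n in setT) \bigcup_(t in setT) sigmaX (zeta n t) >>))
  (* (A.4) *)
  (Heps1 : 0 < eps1)
  (HA4 : forall n t,
     (\int[P]_w ((vnorm (zeta n t w)) `^ (2 + eps1))%:E < +oo)%E)
  (* (A.5) *)
  (Ha : 0 < a) (Hb : 0 < b) (Htau2 : 0 < tau2) (Htau21 : tau2 <= tau1)
  (Htau1 : tau1 <= 1)
  (HA5 : tau2 + (2 + eps1)^-1 + 2^-1 < tau1)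
  (* regularization sequence *)
  (Hgamma_pos : forall t, 0 < gamma t)
  (Hgamma_lim : gamma @ \oo --> (0 : R))
  (* deterministic initial values *)
  (Hx0 : forall n w, x n 0%N w = x0 n)
  (HG0 : forall n w, G n 0%N w = G0 n) (HG0psd : forall n, psd (G0 n))
  (HQ0 : forall n w, Q n 0%N w = Q0 n) (HQ0psd : forall n, psd (Q0 n))
  (HQ1 : forall n w, Q n 1%N w = Q1 n) (HQ1psd : forall n, psd (Q1 n))
  (* algorithm *)
  (Hx : forall n t w,
     x n t.+1 w =
       x n t w
       - stepw b tau2 t *: (\sum_(l < N | L t w n l == -1) (x n t w - x l t w))
       + stepw a tau1 t *:
           (gain (G n t w) (H n) (Q n t w) (gamma t)
              *m (H n *m theta + zeta n t w - H n *m x n t w)))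
  (HG : forall n t w,
     G n t.+1 w =
       G n t w
       - stepw b tau2 t *: (\sum_(l < N | L t w n l == -1) (G n t w - G l t w))
       + stepw a tau1 t *:
           ((H n)^T *m invmx (Q n t w + (gamma t)%:M) *m H n - G n t w))
  (HQ : forall n t w, (1 <= t)%N ->
     Q n t.+1 w =
       t%:R^-1 *: (\sum_(s < t.+1) (H n *m theta + zeta n s w)
                                     *m (H n *m theta + zeta n s w)^T)
       - (t%:R^-1 *: \sum_(s < t) (H n *m theta + zeta n s w))
           *m (t%:R^-1 *: \sum_(s < t) (H n *m theta + zeta n s w))^T) :
  forall tau0 : R, 0 <= tau0 -> tau0 < tau1 - tau2 - (2 + eps1)^-1 ->
  forall n l : 'I_N,
    {ae P, forall w,
      (fun t : nat => (t.+1%:R `^ tau0) * vnorm (x n t w - x l t w)) @ \oo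
        --> (0 : R)}.
Proof.
move=> tau0 tau00 htau n0 l0.
have N0 : (0 < N)%N by exact: leq_ltn_trans (ltn_ord n0).
have [Lbar [LbarE l2]] := HA2.
pose r := (2 + eps1)^-1.
have r0 : 0 < r by rewrite invr_gt0 addr_gt0.
(* The room left by the strict bound on [tau0]: [p] exceeds [r] by a quarter of it and [del] uses at
   most another quarter. The cap [tau2 / 2] gives [del < tau2], and also [del + tau2 < 1], because
   (A.5) forces [tau2 < 1/2]. *)
pose sl := tau1 - tau2 - r - tau0.
have sl0 : 0 < sl by rewrite /sl /r; lra.
pose p := r + sl / 4.
have rp : r < p by rewrite /p; lra.
pose del := Num.min (sl / 4) (tau2 / 2).
have del0 : 0 < del by rewrite lt_min !divr_gt0.
have del1 : del <= sl / 4 by rewrite ge_min lexx.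
have del2 : del <= tau2 / 2 by rewrite ge_min lexx orbT.
have tails : {ae P, forall w n, exists K, forall t,
    norm1 (zeta n t w) <= K * t.+1%:R `^ p}.
  apply: filter_forall => n.
  exact: (noise_tail HF (Hzeta_meas n) (Hzeta_law n) Heps1 (HA4 n 0%N) rp).
have avgs : {ae P, forall w n,
    (forall i, avg (fun s => zeta n s w i 0) @ \oo --> (0 : R)) /\
    (forall i j, avg (fun s => zeta n s w i 0 * zeta n s w j 0) @ \oo --> Rn n i j)}.
  apply: filter_forall => n.
  apply: (noise_averages HF (Hzeta_meas n) (Hzeta_indep n) (Hzeta_law n)
    _ _ Heps1 (HA4 n 0%N)) => [i|i j].
    by split; [exact: Hzeta_int|exact: Hzeta_mean].
  by split; [exact: Hzeta_sq|exact: Hzeta_cov].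
have wins := edge_window HF HL_lap HL_meas HL_indep LbarE del0.
apply: filterS3 tails avgs wins => w tail_w avg_w [tW win_w].
have hK n := cid (tail_w n).
pose Cz := \sum_n `|sval (hK n)|.
have zeta_le n t : norm1 (zeta n t w) <= Cz * t.+1%:R `^ p.
  apply: (le_trans (svalP (hK n) t)); rewrite ler_wpM2r ?powR_ge0 //.
  apply: (le_trans (ler_norm _)); rewrite /Cz (bigD1 n) //= lerDl.
  exact: sumr_ge0.
have Q_cvg n : mxcvg (fun t => Q n t w) (Rn n).
  have [h1 h2] := avg_w n.
  exact: (sample_covariance_cvg h1 h2 (fun t ht => HQ n t w ht)).
apply: (@pathwise_consensus R N M Md H theta (fun n t => zeta n t w) Rn
  (fun t => adj L t w) (fun i j => (i != j) && (Lbar i j != 0))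
  a b tau1 tau2 del p tau0 Cz gamma tW (fun n t => x n t w) (fun n t => G n t w)
  (fun n t => Q n t w)) => //.
- by move=> t; exact: adj_sym.
- exact: (edge_connected HF HL_lap HL_meas LbarE l2).
- lra.
- by move: HA5 r0; rewrite -/r; lra.
- by rewrite /p; lra.
- by move: del1 sl0; rewrite /p /sl; lra.
Qed.
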